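(* Let $T>0$. A potential $q\in L^2([0,T],\mathbb{C})$ is finite gap if and only if all but finitely many of its perturbed Fourier coefficients $z_k$, $k\in\mathbb{Z}$, vanish.
   Context: For $q\in L^2([0,T],\mathbb{C})$ (thought of as extended $T$-periodically) let $F(t,\lambda)$, $\lambda\in\mathbb{C}$, solve $\frac{d}{dt}F=F\alpha$, $F(0,\lambda)=\mathbb{1}$, with $\alpha=\frac12\begin{pmatrix}\mathbf{i}\lambda&q\\-\bar q&-\mathbf{i}\lambda\end{pmatrix}$, and let $M(\lambda)=F(T,\lambda)=\begin{pmatrix}a&b\\c&d\end{pmatrix}(\lambda)$ be the monodromy, with entire entries and determinant $1$; put $\Delta=\mathrm{tr}\,M$. Perturbed Fourier coefficients: the zeros (with multiplicities) of the entire function $a-d$ can be enumerated by a sequence $(\lambda_k)_{k\in\mathbb{Z}}$ with $(\lambda_k-\lambda_{k,0})_k\in\ell^2(\mathbb{Z})$, where $\lambda_{k,0}=\frac{2\pi}{T}k$ (for all but finitely many $k$, $\lambda_k$ is the unique zero in a small disc of fixed radius around $\lambda_{k,0}$; the remaining finitely many are numbered arbitrarily). The perturbed Fourier coefficients of $q$ are $z_k=2(-1)^kb(\lambda_k)$. Finite gap: the spectral curve is $\Sigma=\{(\lambda,\mu)\in\mathbb{C}^2:\mu^2-\Delta(\lambda)\mu+1=0\}$. The eigenlines of $M$ form a holomorphic line bundle on a partial desingularisation $\widehat\Sigma$ of $\Sigma$ (the one whose structure sheaf is the endomorphism sheaf of the eigen-sheaf), explicitly $\widehat\Sigma=\{\nu^2=(\Delta(\lambda)^2-4)/(4p(\lambda)^2)\}$,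 where $p$ is an entire function which is a greatest common divisor of $a-d,b,c$. The potential $q$ is called finite gap if it is stationary under all but finitely many flows of the nonlinear Schrödinger hierarchy; equivalently (use this as definition) $\widehat\Sigma$ has finite arithmetic genus after compactification, i.e. the entire function $(\Delta^2-4)/p^2$ has only finitely many zeros counted with multiplicity. *)

(* Defs.v *)
From HB Require Import structures.
From mathcomp Require Import all_boot all_order all_algebra.
From mathcomp Require Import complex.
From mathcomp Require Import all_classical all_reals all_analysis.

Set Implicit Arguments.
Unset Strict Implicit.
Unset Printing Implicit Defensive.

Import Order.TTheory GRing.Theory Num.Theory.
Import numFieldNormedType.Exports.

Local Open Scope classical_set_scope.
Local Open Scope ring_scope.
Local Open Scope complex_scope.

Definition cintegral (R : realType) (a b : R) (f : R -> R[i]) : R[i] :=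
  (\int[lebesgue_measure]_(s in `[a, b]) complex.Re (f s)) +i*
  (\int[lebesgue_measure]_(s in `[a, b]) complex.Im (f s)).

                                                                  
                                                                     
Definition L2_potential (R : realType) (T : R) (q : R -> R[i]) : Prop :=
  [/\ measurable_fun `[0, T] (fun t => complex.Re (q t)),
      measurable_fun `[0, T] (fun t => complex.Im (q t)) &
      (\int[lebesgue_measure]_(t in `[0%R, T])
         ((Normc.normc (q t) ^+ 2)%R)%:E < +oo)%E].

Definition alpha (R : realType) (q : R -> R[i]) (lam : R[i]) (t : R)
    : 'M[R[i]]_2 :=
  2^-1 *: \matrix_(i < 2, j < 2)
    if i == 0 then (if j == 0 then 'i%C * lam else q t)
    else (if j == 0 then - conjc (q t) else - ('i%C * lam)).

                                                                        
                                                                              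
                                                                               
Definition fundamental_solution (R : realType) (T : R) (q : R -> R[i])
    (F : R -> R[i] -> 'M[R[i]]_2) : Prop :=
  forall (lam : R[i]) (i j : 'I_2),
    [/\ {within `[0, T], continuous (fun t => complex.Re (F t lam i j))},
        {within `[0, T], continuous (fun t => complex.Im (F t lam i j))} &
        forall t : R, 0 <= t <= T ->
          F t lam i j =
            (1%:M : 'M[R[i]]_2) i j +
            cintegral 0 t (fun s => (F s lam *m alpha q lam s) i j)].

Definition entire (R : realType) (f : R[i] -> R[i]) : Prop :=
  forall z : R[i], derivable (f : R[i]^o -> R[i]^o) z 1.

Definition entire_dvd (R : realType) (f g : R[i] -> R[i]) : Prop :=
  exists h : R[i] -> R[i], entire h /\ forall z, g z = f z * h z.

Definition entire_gcd3 (R : realType) (p f g h : R[i] -> R[i]) : Prop :=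
  [/\ entire p, [/\ entire_dvd p f, entire_dvd p g & entire_dvd p h] &
      forall r : R[i] -> R[i], entire r ->
        entire_dvd r f -> entire_dvd r g -> entire_dvd r h ->
        entire_dvd r p].

                                                                          
                                  
Definition zero_multiplicity (R : realType) (f : R[i] -> R[i]) (w : R[i])
    (n : nat) : Prop :=
  exists g : R[i] -> R[i],
    [/\ entire g, g w != 0 & forall z, f z = (z - w) ^+ n * g z].

Definition finitely_many_zeros (R : realType) (f : R[i] -> R[i]) : Prop :=
  exists s : seq R[i], forall w, zero_multiplicity f w (count_mem w s).

Definition mon_a (R : realType) (M : R[i] -> 'M[R[i]]_2) : R[i] -> R[i] :=
  fun z => M z 0 0.
Definition mon_b (R : realType) (M : R[i] -> 'M[R[i]]_2) : R[i] -> R[i] :=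
  fun z => M z 0 1.
Definition mon_c (R : realType) (M : R[i] -> 'M[R[i]]_2) : R[i] -> R[i] :=
  fun z => M z 1 0.
Definition mon_d (R : realType) (M : R[i] -> 'M[R[i]]_2) : R[i] -> R[i] :=
  fun z => M z 1 1.

                                          
Definition finite_gap (R : realType) (M : R[i] -> 'M[R[i]]_2) : Prop :=
  exists p Q : R[i] -> R[i],
    [/\ entire_gcd3 p (fun z => mon_a M z - mon_d M z) (mon_b M) (mon_c M),
        entire Q,
        forall z, \tr (M z) ^+ 2 - 4 = p z ^+ 2 * Q z &
        finitely_many_zeros Q].

Definition lam0 (R : realType) (T : R) (k : int) : R[i] :=
  (2 * pi / T * k%:~R)%:C.

                                                                 
                   
Definition zero_enumeration (R : realType) (T : R)
    (M : R[i] -> 'M[R[i]]_2) (lam : int -> R[i]) : Prop :=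
  (forall w : R[i], exists n : nat,
     zero_multiplicity (fun z => mon_a M z - mon_d M z) w n /\
     ([set k | lam k = w] #= `I_n)%card) /\
  (\esum_(k in [set: int]) ((Normc.normc (lam k - lam0 T k) ^+ 2)%R)%:E < +oo)%E.

Definition perturbed_fourier (R : realType) (M : R[i] -> 'M[R[i]]_2)
    (lam : int -> R[i]) (k : int) : R[i] :=
  2 * (-1) ^ k * mon_b M (lam k).

(* Main.v *)
(* Variation of constants, F(z) = F(w) + (z - w) S_w F(z), can be iterated. This yields the
   Taylor expansion of the monodromy at every w with rapidly decaying remainders, hence all the
   complex function theory that is needed (entire quotients, orders of zeros), and in
   particular Delta(z) = Delta(w) + (z - w) tau(w) + (z - w)^2 rho(w, z). By the Riemann-Lebesgue
   lemma F is close to the solution for q = 0 for large |z|: zeros of Delta^2 - 4 of large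
   modulus lie near the points x_k = 2 pi k / T, and rho is close to -(+-1) T^2 / 4 there.

   If q is finite gap: Delta -+ 2 has a zero w near each x_k with |k| large. There
   (Delta^2 - 4) / p^2 does not vanish, so p(w) = 0 and a - d, b, c vanish at w. As lambda_k is
   the only zero of a - d near x_k, w = lambda_k and b(lambda_k) = 0.

   Conversely, if b(lambda_k) = 0 for |k| large, then lambda_k is a simple zero of a - d, it is
   real by the symmetry a(z) = conj d(conj z), and c(lambda_k) = - conj b(lambda_k) = 0. So
   a - d, b and c have a common divisor p with (a - d) / p a polynomial. At w = lambda_k one has
   tau(w) = 0, so Delta -+ 2 = (z - w)^2 rho(w, z); hence (Delta^2 - 4) / p^2 has no zero near
   x_k, and all of its zeros lie in a bounded set. *)
Require Import Defs.
From mathcomp Require Import all_boot all_order all_algebra.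
From mathcomp Require Import complex ring lra zify.
From mathcomp Require Import all_classical all_reals all_analysis.
Import Order.TTheory GRing.Theory Num.Theory.
Import numFieldNormedType.Exports.
Local Open Scope classical_set_scope.
Local Open Scope ring_scope.
Local Open Scope complex_scope.
Set Implicit Arguments.
Unset Strict Implicit.
Unset Printing Implicit Defensive.

(** Without Cauchy integrals, an entire function obtained as a quotient comes with no Taylor
    expansion. Expansions are at hand only for the monodromy entries and their sums; the orders of
    zeros of [p] and [Q] are transferred from a - d, b, c and Delta -+ 2 by cancelling powers of z -
    w away from w and recovering the value at w by continuity. For the same reason the zero of Delta
    -+ 2 near x_k is found by minimising a modulus over a square, not by counting zeros. The
    function b or c may vanish identically, so orders of b and c need not exist; the greatest common
    divisor therefore starts from the orders of a - d, which the enumeration supplies, and corrects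
    them at finitely many points, so that no infinite product has to be built. Near which points the
    zeros of a - d lie is part of the enumeration; for Delta^2 - 4 it has to be proved. The
    asymptotics carry no rate in z. They suffice because rho stays away from 0 near x_k, which keeps
    a double zero of Delta -+ 2 from having a further zero nearby. *)

Notation cRe := complex.Re.
Notation cIm := complex.Im.
Notation nc := Normc.normc.

(** * Complex numbers and integrals *)
Section Modulus.
Variable R : realType.
Implicit Types (z w : R[i]) (x y : R).

(* Working with the l^1 modulus makes n1 (\int f) <= \int n1 f immediate. *)
Definition n1 (z : R[i]) : R := `|cRe z| + `|cIm z|.

Lemma cReD z w : cRe (z + w) = cRe z + cRe w. Proof. by case: z w => [a b] [c d]. Qed.
Lemma cImD z w : cIm (z + w) = cIm z + cIm w. Proof. by case: z w => [a b] [c d]. Qed.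
Lemma cReN z : cRe (- z) = - cRe z. Proof. by case: z. Qed.
Lemma cImN z : cIm (- z) = - cIm z. Proof. by case: z. Qed.
Lemma cReM z w : cRe (z * w) = cRe z * cRe w - cIm z * cIm w.
Proof. by case: z w => [a b] [c d]. Qed.
Lemma cImM z w : cIm (z * w) = cRe z * cIm w + cIm z * cRe w.
Proof. by case: z w => [a b] [c d]. Qed.
Lemma cReJ z : cRe (conjc z) = cRe z. Proof. by case: z. Qed.
Lemma cImJ z : cIm (conjc z) = - cIm z. Proof. by case: z. Qed.
Lemma complex_eqP z w : cRe z = cRe w -> cIm z = cIm w -> z = w.
Proof. by case: z w => [a b] [c d] /= -> ->. Qed.

Lemma n1_ge0 z : 0 <= n1 z. Proof. by rewrite addr_ge0. Qed.
Lemma n10 : n1 0 = 0. Proof. by rewrite /n1 /= normr0 addr0. Qed.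
Lemma n1_real x : n1 x%:C = `|x|. Proof. by rewrite /n1 /= normr0 addr0. Qed.
Lemma n1_1 : n1 1 = 1. Proof. by rewrite /n1 /= normr0 addr0 normr1. Qed.
Lemma n1N z : n1 (- z) = n1 z. Proof. by rewrite /n1 cReN cImN !normrN. Qed.
Lemma n1D z w : n1 (z + w) <= n1 z + n1 w.
Proof.
rewrite /n1 cReD cImD; have := ler_normD (cRe z) (cRe w).
by have := ler_normD (cIm z) (cIm w); lra.
Qed.
Lemma n1B z w : n1 (z - w) <= n1 z + n1 w.
Proof. by rewrite -(n1N w) n1D. Qed.
Lemma n1M z w : n1 (z * w) <= n1 z * n1 w.
Proof.
rewrite /n1 cReM cImM; have := ler_normB (cRe z * cRe w) (cIm z * cIm w).
have := ler_normD (cRe z * cIm w) (cIm z * cRe w).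
rewrite !normrM => *; lra.
Qed.
Lemma n1_eq0 z : n1 z = 0 -> z = 0.
Proof.
case: z => a b; rewrite /n1 /= => h; have := normr_ge0 a; have := normr_ge0 b.
move=> b0 a0; have a0' : `|a| = 0 by lra.
have b0' : `|b| = 0 by lra.
by rewrite (normr0_eq0 a0') (normr0_eq0 b0').
Qed.
Lemma n1_small z : (forall e, 0 < e -> n1 z <= e) -> z = 0.
Proof.
move=> h; apply: n1_eq0; apply/eqP; rewrite eq_le n1_ge0 andbT.
by apply/ler_addgt0Pr => e e0; rewrite add0r h.
Qed.

Lemma nc_ge0 z : 0 <= nc z. Proof. by case: z => a b; exact: sqrtr_ge0. Qed.
Lemma nc_norm z : (nc z)%:C = `|z|. Proof. by rewrite normc_def; case: z. Qed.
Lemma ncD z w : nc (z + w) <= nc z + nc w.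
Proof. by rewrite -lecR rmorphD /= !nc_norm ler_normD. Qed.
Lemma nc_eq0 z : (nc z == 0) = (z == 0).
Proof. by apply/eqP/eqP => [/Normc.eq0_normc//|->]; rewrite Normc.normc0. Qed.
Lemma nc_gt0 z : z != 0 -> 0 < nc z.
Proof. by move=> z0; rewrite lt_neqAle nc_ge0 eq_sym nc_eq0 z0. Qed.
Lemma ncN z : nc (- z) = nc z. Proof. by case: z => a b /=; rewrite !sqrrN. Qed.
Lemma ncJ z : nc (conjc z) = nc z. Proof. by case: z => a b /=; rewrite !sqrrN. Qed.
Lemma ncB z w : nc (z - w) <= nc z + nc w. Proof. by rewrite -(ncN w) ncD. Qed.
Lemma nc_distrC z w : nc (z - w) = nc (w - z). Proof. by rewrite -ncN opprB. Qed.
Lemma nc_sqr z : nc z ^+ 2 = cRe z ^+ 2 + cIm z ^+ 2.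
Proof. by case: z => a b /=; rewrite sqr_sqrtr// addr_ge0 ?sqr_ge0. Qed.
Lemma nc_real x : nc x%:C = `|x|.
Proof. by rewrite /= expr0n addr0 sqrtr_sqr. Qed.
Lemma ncX z n : nc (z ^+ n) = nc z ^+ n.
Proof. by elim: n => [|n IH]; rewrite ?expr0 ?Normc.normc1// !exprS Normc.normcM IH. Qed.
Lemma nc_le_n1 z : nc z <= n1 z.
Proof.
rewrite -(@ler_pXn2r _ 2%N) ?nnegrE ?nc_ge0 ?n1_ge0// nc_sqr /n1 sqrrD.
by rewrite !real_normK ?num_real// -addrA lerD2l lerDr mulrn_wge0// mulr_ge0.
Qed.
Lemma normRe_le_nc z : `|cRe z| <= nc z.
Proof.
rewrite -(@ler_pXn2r _ 2%N) ?nnegrE ?nc_ge0// nc_sqr real_normK ?num_real//.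
by rewrite lerDl sqr_ge0.
Qed.
Lemma normIm_le_nc z : `|cIm z| <= nc z.
Proof.
rewrite -(@ler_pXn2r _ 2%N) ?nnegrE ?nc_ge0// nc_sqr real_normK ?num_real//.
by rewrite lerDr sqr_ge0.
Qed.
Lemma n1_le_nc z : n1 z <= 2 * nc z.
Proof. by have := normRe_le_nc z; have := normIm_le_nc z; rewrite /n1; lra. Qed.

End Modulus.

(** * Integration over [0, T] and absolutely continuous functions *)

Section Integrals.
Variables (R : realType) (T : R).
Hypothesis T0 : 0 < T.
Notation mu := (@lebesgue_measure R).
Implicit Types (f g u v : R -> R[i]) (h k : R -> R).

Definition ing h := mu.-integrable `[0, T] (EFin \o h).
Definition J h (t : R) : R := \int[mu]_(s in `[0, t]) h s.
Definition cing f := ing (fun s => cRe (f s)) /\ ing (fun s => cIm (f s)).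
Definition cc u := {within `[0, T], continuous (fun s => cRe (u s))} /\
  {within `[0, T], continuous (fun s => cIm (u s))}.
Definition CI f (t : R) := cintegral 0 t f.

Lemma ingS h t : 0 <= t <= T -> ing h -> mu.-integrable `[0, t] (EFin \o h).
Proof.
move=> /andP[t0 tT]; apply: integrableS => //.
by apply: subset_itvl; rewrite bnd_simp.
Qed.
Lemma ingD h k : ing h -> ing k -> ing (fun s => h s + k s).
Proof. by move=> ih ik; exact: (integrableD _ ih ik). Qed.
Lemma ingZ c h : ing h -> ing (fun s => c * h s).
Proof. by move=> ih; exact: (integrableZl _ c ih). Qed.
Lemma ingN h : ing h -> ing (fun s => - h s).
Proof. by move=> ih; exact: (integrableN ih). Qed.
Lemma ing_norm h : ing h -> ing (fun s => `|h s|).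
Proof. by move=> ih; exact: (integrable_norm ih). Qed.
Lemma within_bounded h : {within `[0, T], continuous h} ->
  exists M, forall s, 0 <= s <= T -> `|h s| <= M.
Proof.
move=> ch; have := continuous_compact ch (@segment_compact _ 0 T).
move=> /compact_bounded [M [_ HM]]; exists (`|M| + 1) => s sT.
apply: (HM (`|M| + 1)); first by rewrite (le_lt_trans (ler_norm M))// ltrDl.
by exists s => //=; rewrite in_itv.
Qed.
Lemma ing_eq h k : (forall s, 0 <= s <= T -> h s = k s) -> ing h -> ing k.
Proof.
move=> hk; apply: eq_integrable => //= s; rewrite inE /= in_itv /= => sT.
by rewrite hk.
Qed.
Lemma within_measurable h : {within `[0, T], continuous h} -> measurable_fun `[0, T] h.
Proof. by move=> ch; apply: measurable_realfun.subspace_continuous_measurable_fun. Qed.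
Lemma ingM h k : {within `[0, T], continuous h} -> ing k -> ing (fun s => h s * k s).
Proof.
move=> ch ik; apply: (@integrableMr _ _ _ mu `[0, T] _ h (EFin \o k)) => //.
  exact: within_measurable.
have [M HM] := within_bounded ch.
exists M; split; first exact: num_real.
by move=> N MN s /=; rewrite in_itv /= => /HM/le_trans; apply; exact: ltW.
Qed.
Lemma ing_cst c : ing (fun=> c).
Proof.
apply/measurable_bounded_integrable => //.
  rewrite [X in (X < _)%E](_ : _ = mu `[0, T])//.
  by rewrite lebesgue_measure_itv /= lte_fin; case: ifP => // _; rewrite -EFinB ltry.
by exists `|c|; split; [exact: num_real|move=> N cN s _; exact: ltW].
Qed.
Lemma ing_within h : {within `[0, T], continuous h} -> ing h.
Proof.
move=> ch; have := ingM ch (ing_cst 1).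
by apply: ing_eq => s _; rewrite mulr1.
Qed.

Lemma J0 h : J h 0 = 0. Proof. by rewrite /J set_itv1 Rintegral_set1. Qed.
Lemma JD h k t : 0 <= t <= T -> ing h -> ing k ->
  J (fun s => h s + k s) t = J h t + J k t.
Proof. by move=> tT ih ik; rewrite /J RintegralD//; exact: ingS. Qed.
Lemma JZ c h t : 0 <= t <= T -> ing h -> J (fun s => c * h s) t = c * J h t.
Proof. by move=> tT ih; rewrite /J RintegralZl//; exact: ingS. Qed.
Lemma J_eq h k t : 0 <= t <= T -> (forall s, 0 <= s <= T -> h s = k s) -> J h t = J k t.
Proof.
move=> tT hk; apply: eq_Rintegral => s; rewrite inE /= in_itv /= => /andP[s0 st].
by apply: hk; rewrite s0 (le_trans st)//; case/andP: tT.
Qed.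
Lemma J_cst c t : 0 <= t -> J (fun=> c) t = c * t.
Proof.
move=> t0; rewrite /J Rintegral_cst// [X in fine X](_ : _ = mu `[0, t])//.
rewrite lebesgue_measure_itv /= lte_fin.
by case: ltgtP t0 => //= [_ _|<- _]; rewrite ?subr0.
Qed.
Lemma J_incr h s t : 0 <= s -> s <= t -> t <= T -> ing h ->
  J h t - J h s = \int[mu]_(r in `]s, t]) h r.
Proof.
move=> s0 st tT ih; by rewrite /J Rintegral_itvB//; apply: ingS => //; rewrite (le_trans s0).
Qed.
Lemma ing_sub h s t : 0 <= s -> t <= T -> ing h ->
  mu.-integrable `]s, t] (EFin \o h).
Proof.
move=> s0 tT; apply: integrableS => //.
move=> r /=; rewrite !in_itv /= => /andP[sr rt].
by rewrite (le_trans s0 (ltW sr)) (le_trans rt).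
Qed.
Lemma J_le_incr h k s t : 0 <= s -> s <= t -> t <= T -> ing h -> ing k ->
  (forall r, s <= r <= t -> `|h r| <= k r) -> `|J h t - J h s| <= J k t - J k s.
Proof.
move=> s0 st tT ih ik hk; rewrite !J_incr//.
apply: (le_trans (le_normr_Rintegral _ _)) => //; first exact: ing_sub.
apply: le_Rintegral => //; first exact/ing_sub/ing_norm.
  exact: ing_sub.
by move=> r /=; rewrite in_itv /= => /andP[/ltW sr rt]; apply: hk; rewrite sr.
Qed.
Lemma J_mono h s t : 0 <= s -> s <= t -> t <= T -> ing h ->
  (forall r, s <= r <= t -> 0 <= h r) -> J h s <= J h t.
Proof.
move=> s0 st tT ih h0; rewrite -subr_ge0 J_incr// Rintegral_ge0// => r /=.
by rewrite in_itv /= => /andP[/ltW sr rt]; apply: h0; rewrite sr.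
Qed.
Lemma J_le h k t : 0 <= t <= T -> ing h -> ing k ->
  (forall r, 0 <= r <= t -> h r <= k r) -> J h t <= J k t.
Proof.
by move=> tT ih ik hk; apply: (le_Rintegral _ (ingS tT ih) (ingS tT ik)).
Qed.
Lemma J_ge0 h t : 0 <= t <= T -> (forall r, 0 <= r <= T -> 0 <= h r) -> 0 <= J h t.
Proof.
move=> /andP[t0 tT] h0; apply: Rintegral_ge0 => r /=; rewrite in_itv /= => /andP[r0 rt].
by apply: h0; rewrite r0 (le_trans rt).
Qed.
(** Absolute continuity of the Lebesgue integral. [h] is extended by zero because the epsilon-delta
    form used here concerns functions integrable on the whole line. *)
Lemma J_unif h e : ing h -> 0 < e -> exists2 d, 0 < d & forall s t,
  0 <= s -> s <= t -> t <= T -> t - s < d -> `|J h t - J h s| <= e.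
Proof.
move=> ih e0; pose hT := h \_ `[0, T].
have ihT : mu.-integrable setT (EFin \o hT).
  by rewrite -restrict_EFin; apply/integrable_restrict => //=; rewrite setTI.
have [d [d0 Hd]] := integral_normr_continuous ihT e0.
exists d => // s t s0 st tT tsd; rewrite J_incr//.
apply: (le_trans (le_normr_Rintegral _ _)) => //; first exact: ing_sub.
rewrite [leLHS](_ : _ = \int[mu]_(r in `]s, t]) `|hT r|); last first.
  apply: eq_Rintegral => r; rewrite inE /= in_itv /= => /andP[sr rt]; rewrite /hT patchE ifT//.
  by rewrite inE /= in_itv /= (le_trans s0 (ltW sr)) (le_trans rt).
apply/ltW/Hd => //; rewrite [X in (X < _)%E](_ : _ = mu `]s, t])//.
rewrite lebesgue_measure_itv /= lte_fin.
by case: ifP => // _; rewrite -EFinB lte_fin.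
Qed.
Lemma J_within h : ing h -> {within `[0, T], continuous (J h)}.
Proof. by move=> ih; apply: (parameterized_integral_continuous (ltW T0)). Qed.

Lemma cing_eq f g : (forall s, 0 <= s <= T -> f s = g s) -> cing f -> cing g.
Proof.
by move=> fg [a b]; split; [apply: ing_eq a|apply: ing_eq b] => s /fg ->.
Qed.
Lemma cingD f g : cing f -> cing g -> cing (fun s => f s + g s).
Proof.
move=> [a b] [c d]; split.
  by apply: ing_eq (ingD a c) => s _; rewrite cReD.
by apply: ing_eq (ingD b d) => s _; rewrite cImD.
Qed.
Lemma cingN f : cing f -> cing (fun s => - f s).
Proof.
move=> [a b]; split.
  by apply: ing_eq (ingN a) => s _; rewrite cReN.
by apply: ing_eq (ingN b) => s _; rewrite cImN.
Qed.
Lemma cingJ f : cing f -> cing (fun s => conjc (f s)).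
Proof.
move=> [a b]; split.
  by apply: ing_eq a => s _; rewrite cReJ.
by apply: ing_eq (ingN b) => s _; rewrite cImJ.
Qed.
Lemma cingM u f : cc u -> cing f -> cing (fun s => u s * f s).
Proof.
move=> [a b] [c d]; split.
  apply: ing_eq (ingD (ingM a c) (ingN (ingM b d))) => s _; by rewrite cReM.
by apply: ing_eq (ingD (ingM a d) (ingM b c)) => s _; rewrite cImM.
Qed.
Lemma cc_cst c : cc (fun=> c).
Proof. by split; apply: continuous_subspaceT => x; exact: cvg_cst. Qed.
Lemma cingZ c f : cing f -> cing (fun s => c * f s).
Proof. exact/cingM/cc_cst. Qed.
Lemma cing_cc u : cc u -> cing u.
Proof. by move=> [a b]; split; exact: ing_within. Qed.
Lemma ing_n1 f : cing f -> ing (fun s => n1 (f s)).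
Proof. by move=> [a b]; apply: ingD; exact: ing_norm. Qed.

Lemma CIE f t : CI f t = (J (fun s => cRe (f s)) t) +i* (J (fun s => cIm (f s)) t).
Proof. by []. Qed.
Lemma CI0 f : CI f 0 = 0. Proof. by rewrite CIE !J0. Qed.
Lemma CI_eq f g t : 0 <= t <= T -> (forall s, 0 <= s <= T -> f s = g s) -> CI f t = CI g t.
Proof.
by move=> tT fg; rewrite !CIE; congr (_ +i* _); apply: J_eq => // s /fg ->.
Qed.
Lemma CI_D f g t : 0 <= t <= T -> cing f -> cing g ->
  CI (fun s => f s + g s) t = CI f t + CI g t.
Proof.
move=> tT [a b] [c d]; apply: complex_eqP; rewrite ?cReD ?cImD !CIE /=.
  by rewrite -JD//; apply: J_eq => // s _; rewrite cReD.
by rewrite -JD//; apply: J_eq => // s _; rewrite cImD.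
Qed.
Lemma CI_Z c f t : 0 <= t <= T -> cing f -> CI (fun s => c * f s) t = c * CI f t.
Proof.
move=> tT [a b]; apply: complex_eqP; rewrite ?cReM ?cImM !CIE /=.
  rewrite -(JZ _ tT a) -(JZ (cIm c) tT b) -mulN1r -JZ//; last exact: ingZ.
  rewrite -JD//; [|exact: ingZ|exact/ingZ/ingZ].
  by apply: J_eq => // s _; rewrite cReM mulN1r.
rewrite -(JZ _ tT b) -(JZ _ tT a) -JD//; [|exact: ingZ|exact: ingZ].
by apply: J_eq => // s _; rewrite cImM.
Qed.
Lemma CI_N f t : 0 <= t <= T -> cing f -> CI (fun s => - f s) t = - CI f t.
Proof.
move=> tT cf; rewrite -mulN1r -CI_Z//; apply: CI_eq => // s _; by rewrite mulN1r.
Qed.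
Lemma CI_J f t : 0 <= t <= T -> cing f -> CI (fun s => conjc (f s)) t = conjc (CI f t).
Proof.
move=> tT [a b]; apply: complex_eqP; rewrite ?cReJ ?cImJ !CIE /=.
  by apply: J_eq => // s _; rewrite cReJ.
rewrite -mulN1r -JZ//; apply: J_eq => // s _; by rewrite cImJ mulN1r.
Qed.
Lemma CI_le_incr f h s t : 0 <= s -> s <= t -> t <= T -> cing f -> ing h ->
  (forall r, s <= r <= t -> n1 (f r) <= h r) -> n1 (CI f t - CI f s) <= J h t - J h s.
Proof.
move=> s0 st tT cf ih fh; have [a b] := cf.
have := ing_n1 cf => inf.
apply: (@le_trans _ _ (J (fun r => n1 (f r)) t - J (fun r => n1 (f r)) s)); last first.
  have sT := le_trans st tT; have t0 := le_trans s0 st.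
  rewrite !J_incr//; apply: le_Rintegral => //; [exact: ing_sub|exact: ing_sub|].
  by move=> r /=; rewrite in_itv /= => /andP[/ltW sr rt]; apply: fh; rewrite sr.
have sT : 0 <= s <= T by rewrite s0 (le_trans st).
have tT' : 0 <= t <= T by rewrite tT (le_trans s0).
rewrite /n1 !JD//; [|exact: ing_norm|exact: ing_norm|exact: ing_norm|exact: ing_norm].
rewrite cReD cImD cReN cImN !CIE /= opprD addrACA.
by apply: lerD; apply: J_le_incr => //; exact: ing_norm.
Qed.
Lemma CI_le f h t : 0 <= t <= T -> cing f -> ing h ->
  (forall r, 0 <= r <= t -> n1 (f r) <= h r) -> n1 (CI f t) <= J h t.
Proof.
move=> /andP[t0 tT] cf ih fh; have := CI_le_incr (lexx 0) t0 tT cf ih fh.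
by rewrite CI0 J0 !subr0.
Qed.

(* Summing over a fine partition bounds Phi t - Phi 0 by e * (V t - V 0) for every e. *)
Lemma const_of_small_incr (Phi : R -> R[i]) (V : R -> R) :
  (forall e, 0 < e -> exists2 d, 0 < d & forall s t, 0 <= s -> s <= t -> t <= T ->
     t - s < d -> n1 (Phi t - Phi s) <= e * (V t - V s)) ->
  forall t, 0 <= t <= T -> Phi t = Phi 0.
Proof.
move=> H t /andP[t0 tT].
have K e : 0 < e -> n1 (Phi t - Phi 0) <= e * (V t - V 0).
  move=> e0; have [d d0 Hd] := H e e0.
  (* Steps of length at most d / 2 keep every increment of the argument strictly below d. *)
  suff main n : forall r, 0 <= r -> r <= T -> r <= n%:R * (d / 2) ->
      n1 (Phi r - Phi 0) <= e * (V r - V 0).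
    have d20 : 0 < d / 2 by rewrite divr_gt0.
    have := Num.Theory.archi_boundP (divr_ge0 t0 (ltW d20)).
    rewrite ltr_pdivrMr// => /ltW; exact: main.
  elim: n => [|n IH] r r0 rT.
    rewrite mul0r => rle0; have -> : r = 0 by apply/eqP; rewrite eq_le rle0.
    by rewrite !subrr n10 mulr0.
  move=> rn; have [|rn'] := leP r (n%:R * (d / 2)); first exact: IH.
  set s := n%:R * (d / 2) in rn'.
  have s0 : 0 <= s by rewrite mulr_ge0// divr_ge0// ltW.
  have sr := ltW rn'.
  have h1 := IH s s0 (le_trans sr rT) (lexx _).
  have h2 := Hd s r s0 sr rT.
  have : r - s < d by move: rn; rewrite -natr1 mulrDl mul1r -/s; lra.
  move=> /h2 h3; have -> : Phi r - Phi 0 = (Phi r - Phi s) + (Phi s - Phi 0) by ring.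
  apply: (le_trans (n1D _ _)).
  have -> : e * (V r - V 0) = e * (V r - V s) + e * (V s - V 0) by ring.
  exact: lerD.
apply/eqP; rewrite -subr_eq0; apply/eqP; apply: n1_small => e e0.
have [Vle|Vgt] := leP (V t - V 0) 0.
  apply: (le_trans (K e e0)); apply: (le_trans _ (ltW e0)).
  by rewrite pmulr_rle0.
have := K (e / (V t - V 0)) (divr_gt0 e0 Vgt).
by rewrite mulfVK// gt_eqF.
Qed.

(* u is absolutely continuous on [0, T] with derivative f. *)
Definition primitive u f := cing f /\ forall t, 0 <= t <= T -> u t = u 0 + CI f t.

Lemma prim_cing u f : primitive u f -> cing f. Proof. by case. Qed.
Lemma prim_cc u f : primitive u f -> cc u.
Proof.
move=> [[a b] uf]; have [Ja Jb] := (J_within a, J_within b).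
have E1 : {in `[0, T]%classic,
    (fun s => cRe (u 0) + J (fun s => cRe (f s)) s) =1 (fun s => cRe (u s))}.
  by move=> s; rewrite inE /= in_itv /= => sT; rewrite (uf s sT) cReD.
have E2 : {in `[0, T]%classic,
    (fun s => cIm (u 0) + J (fun s => cIm (f s)) s) =1 (fun s => cIm (u s))}.
  by move=> s; rewrite inE /= in_itv /= => sT; rewrite (uf s sT) cImD.
split.
  apply: (subspace_eq_continuous E1).
  by move=> x; apply: cvgD; [exact: cvg_cst|exact: Ja].
apply: (subspace_eq_continuous E2).
by move=> x; apply: cvgD; [exact: cvg_cst|exact: Jb].
Qed.
Lemma prim_eq u f v g : (forall t, 0 <= t <= T -> u t = v t) ->
  (forall t, 0 <= t <= T -> f t = g t) -> primitive u f -> primitive v g.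
Proof.
move=> uv fg [cf uf]; split; first exact: cing_eq cf.
move=> t tT; rewrite -!uv ?lexx ?(ltW T0)// uf//; congr (_ + _); exact: CI_eq.
Qed.
Lemma prim_CI f : cing f -> primitive (CI f) f.
Proof. by move=> cf; split=> // t tT; rewrite CI0 add0r. Qed.
Lemma prim_cst c : primitive (fun=> c) (fun=> 0).
Proof.
split; first exact/cing_cc/cc_cst.
move=> t tT; rewrite CIE /=; have t0 : 0 <= t by case/andP: tT.
by rewrite J_cst// mul0r; apply: complex_eqP; rewrite ?cReD ?cImD /= addr0.
Qed.
Lemma primD u f v g : primitive u f -> primitive v g ->
  primitive (fun t => u t + v t) (fun t => f t + g t).
Proof.
move=> [cf uf] [cg vg]; split; first exact: cingD.
by move=> t tT; rewrite CI_D// uf// vg//; ring.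
Qed.
Lemma primZ c u f : primitive u f -> primitive (fun t => c * u t) (fun t => c * f t).
Proof.
move=> [cf uf]; split; first exact: cingZ.
by move=> t tT; rewrite CI_Z// uf//; ring.
Qed.
Lemma primN u f : primitive u f -> primitive (fun t => - u t) (fun t => - f t).
Proof.
move=> [cf uf]; split; first exact: cingN.
by move=> t tT; rewrite CI_N// uf//; ring.
Qed.
Lemma primB u f v g : primitive u f -> primitive v g ->
  primitive (fun t => u t - v t) (fun t => f t - g t).
Proof. by move=> a b; apply: primD => //; exact: primN. Qed.
Lemma primJ u f : primitive u f -> primitive (fun t => conjc (u t)) (fun t => conjc (f t)).
Proof.
move=> [cf uf]; split; first exact: cingJ.
by move=> t tT; rewrite CI_J// uf// rmorphD.
Qed.
Lemma prim_incr u f s t : primitive u f -> 0 <= s <= T -> 0 <= t <= T ->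
  u t - u s = CI f t - CI f s.
Proof. by move=> [_ uf] sT tT; rewrite (uf s)// (uf t)//; ring. Qed.
Lemma prim_le_incr u f h s t : primitive u f -> ing h -> 0 <= s -> s <= t -> t <= T ->
  (forall r, s <= r <= t -> n1 (f r) <= h r) -> n1 (u t - u s) <= J h t - J h s.
Proof.
move=> uf ih s0 st tT fh; rewrite (prim_incr uf); last 2 first.
- by rewrite s0 (le_trans st).
- by rewrite tT (le_trans s0).
- by apply: CI_le_incr => //; exact: prim_cing uf.
Qed.
Lemma prim_const u f : primitive u f -> (forall t, 0 <= t <= T -> f t = 0) ->
  forall t, 0 <= t <= T -> u t = u 0.
Proof.
move=> [cf uf] f0 t tT; rewrite uf// (CI_eq tT f0).
by have [_ /(_ t tT)] := prim_cst 0; rewrite add0r => <-; rewrite addr0.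
Qed.
Lemma prim_unif u f e : primitive u f -> 0 < e -> exists2 d, 0 < d & forall s t,
  0 <= s -> s <= t -> t <= T -> t - s < d -> n1 (u t - u s) <= e.
Proof.
move=> uf e0; have cf := prim_cing uf.
have [d d0 Hd] := J_unif (ing_n1 cf) e0; exists d => // s t s0 st tT tsd.
apply: (le_trans (prim_le_incr uf (ing_n1 cf) s0 st tT (fun _ _ => lexx _))).
exact: (le_trans (ler_norm _) (Hd s t s0 st tT tsd)).
Qed.

(* The increments of u v - \int (u g + f v) are quadratic in those of the indefinite
   integral of n1 f + n1 g. *)
Lemma primM u f v g : primitive u f -> primitive v g ->
  primitive (fun t => u t * v t) (fun t => f t * v t + u t * g t).
Proof.
move=> uf vg; have [cf _] := uf; have [cg _] := vg.
have ci : cing (fun t => f t * v t + u t * g t).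
  apply: cingD; last exact: cingM (prim_cc uf) cg.
  apply: cing_eq (cingM (prim_cc vg) cf) => s _; exact: mulrC.
split=> // t tT.
pose Phi t := u t * v t - CI (fun t => f t * v t + u t * g t) t.
have K : forall t, 0 <= t <= T -> Phi t = Phi 0.
  apply: (@const_of_small_incr _ (fun t => 3 * J (fun s => n1 (f s) + n1 (g s)) t)).
  move=> e e0.
  have [d1 d10 H1] := prim_unif uf e0; have [d2 d20 H2] := prim_unif vg e0.
  exists (Num.min d1 d2); first by rewrite lt_min d10.
  move=> a b a0 ab bT; rewrite lt_min => /andP[h1 h2].
  have aT : 0 <= a <= T by rewrite a0 (le_trans ab).
  have bT' : 0 <= b <= T by rewrite bT (le_trans a0).
  pose w r := f r * (v r - v a) + (u r - u a) * g r.
  have cw : cing w.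
    apply: cing_eq (cingD ci (cingD (cingZ (- v a) cf) (cingZ (- u a) cg))) => s _.
    by rewrite /w; ring.
  (* Recentring u and v at the left end a leaves a product of two increments and the integral of
     [w], in which f and g are multiplied by increments; each is at most e times the increment of
     [J k]. *)
  have -> : Phi b - Phi a = (u b - u a) * (v b - v a) - (CI w b - CI w a).
    have -> : (u b - u a) * (v b - v a) = u b * v b - u a * v a
        - v a * (u b - u a) - u a * (v b - v a) by ring.
    rewrite (prim_incr uf)// (prim_incr vg)//.
    have Hw c : 0 <= c <= T ->
      CI (fun t => f t * v t + u t * g t) c = CI w c + v a * CI f c + u a * CI g c.
      move=> cT; have cf' := cingZ (v a) cf; have cg' := cingZ (u a) cg.
      rewrite -(CI_Z _ cT cf) -(CI_Z _ cT cg) -(CI_D cT cw cf').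
      rewrite -(CI_D cT (cingD cw cf') cg').
      by apply: CI_eq => // s _; rewrite /w; ring.
    by rewrite /Phi !Hw//; ring.
  pose k := (fun s => n1 (f s) + n1 (g s)).
  have ik : ing k by apply: ingD; exact: ing_n1.
  have Jn x y : 0 <= x <= T -> 0 <= y <= T -> J k y - J k x =
     (J (fun s => n1 (f s)) y - J (fun s => n1 (f s)) x) +
     (J (fun s => n1 (g s)) y - J (fun s => n1 (g s)) x).
    have i1 := ing_n1 cf; have i2 := ing_n1 cg.
    move=> xT yT; rewrite /k (JD xT i1 i2) (JD yT i1 i2).
    by rewrite opprD addrACA.
  have nf := J_mono a0 ab bT (ing_n1 cf) (fun _ _ => n1_ge0 _).
  have ng := J_mono a0 ab bT (ing_n1 cg) (fun _ _ => n1_ge0 _).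
  have I1 : n1 ((u b - u a) * (v b - v a)) <= e * (J k b - J k a).
    apply: (le_trans (n1M _ _)).
    apply: (@le_trans _ _ (e * (J (fun s => n1 (g s)) b - J (fun s => n1 (g s)) a))).
      apply: ler_pM; rewrite ?n1_ge0//; first exact: H1.
      by apply: (prim_le_incr vg) => //; exact: ing_n1.
    rewrite ler_pM2l// Jn//; lra.
  have I2 : n1 (CI w b - CI w a) <= e * (J k b - J k a).
    rewrite mulrBr -!JZ//.
    apply: CI_le_incr => //; first exact: ingZ.
    move=> r /andP[ar rb]; rewrite /w /k.
    apply: (le_trans (n1D _ _)); rewrite [leRHS]mulrDr; apply: lerD.
      apply: (le_trans (n1M _ _)); rewrite mulrC ler_wpM2r ?n1_ge0//.
      apply: H2 => //; [exact: le_trans bT|].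
      by apply: le_lt_trans h2; rewrite lerD2r.
    apply: (le_trans (n1M _ _)); rewrite ler_wpM2r ?n1_ge0//.
    apply: H1 => //; [exact: le_trans bT|].
    by apply: le_lt_trans h1; rewrite lerD2r.
  apply: (le_trans (n1B _ _)); apply: (le_trans (lerD I1 I2)).
  rewrite -/k -mulrDr ler_pM2l//.
  have : 0 <= J k b - J k a by rewrite Jn//; lra.
  lra.
have := K t tT; rewrite /Phi CI0 subr0 => <-; ring.
Qed.

(** Phrased with real parts because the energy in [sol_energy] is a complex-valued product whose
    values happen to be real. *)
Lemma prim_Re_noninc u f : primitive u f -> (forall t, 0 <= t <= T -> cRe (f t) <= 0) ->
  forall t, 0 <= t <= T -> cRe (u t) <= cRe (u 0).
Proof.
move=> [[a b] uf] f0 t tT; rewrite uf// cReD CIE /= gerDl.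
have := @J_le _ (fun=> 0) t tT a (ing_cst 0).
rewrite J_cst ?mul0r; last by case/andP: tT.
apply=> r /andP[r0 rt]; apply: f0; rewrite r0 (le_trans rt)//.
by case/andP: tT.
Qed.

End Integrals.

(** * The Riemann-Lebesgue lemma *)
Section Exponential.
Variable R : realType.
Implicit Types z w : R[i].

Definition cexp z : R[i] :=
  (expR (cRe z) * cos (cIm z)) +i* (expR (cRe z) * sin (cIm z)).

Lemma cexpD z w : cexp (z + w) = cexp z * cexp w.
Proof.
apply: complex_eqP; rewrite ?cReM ?cImM /cexp /= cReD cImD expRD.
  by rewrite cosD; ring.
by rewrite sinD; ring.
Qed.
Lemma cexp0 : cexp 0 = 1.
Proof. by apply: complex_eqP; rewrite /= expR0 ?cos0 ?sin0 ?mulr1 ?mulr0. Qed.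
Lemma cexpN z : cexp z * cexp (- z) = 1.
Proof. by rewrite -cexpD subrr cexp0. Qed.
Lemma nc_cexp z : nc (cexp z) = expR (cRe z).
Proof.
rewrite /= !exprMn -mulrDr cos2Dsin2 mulr1 sqrtr_sqr ger0_norm//.
Qed.
Lemma n1_cexp z : n1 (cexp z) <= 2 * expR (cRe z).
Proof. by rewrite -nc_cexp n1_le_nc. Qed.

End Exponential.

Section Exponential_primitive.
Variables (R : realType) (T : R).
Hypothesis T0 : 0 < T.

Lemma J_FTC (h k : R -> R) (t : R) : (forall x : R, is_derive x 1 h (k x)) ->
  continuous k -> 0 <= t -> J k t = h t - h 0.
Proof.
move=> dh ck; rewrite le_eqVlt => /predU1P[<-|t0]; first by rewrite J0 subrr.
have ch x : {for x, continuous h}.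
  by apply: differentiable_continuous; apply/derivable1_diffP.
rewrite /J /Rintegral (@continuous_FTC2 _ k h)//.
- exact: continuous_subspaceT.
- split=> [x _||]; first by have [] := dh x.
    exact/cvg_at_right_filter/ch.
  exact/cvg_at_left_filter/ch.
- by move=> x _; rewrite derive1E; have [_] := dh x.
Qed.

Lemma prim_cexp (c : R[i]) :
  primitive T (fun t => cexp (c * t%:C)) (fun t => c * cexp (c * t%:C)).
Proof.
pose a := cRe c; pose b := cIm c.
pose h1 (t : R) := expR (a * t) * cos (b * t).
pose h2 (t : R) := expR (a * t) * sin (b * t).
have E1 t : cRe (cexp (c * t%:C)) = h1 t.
  by rewrite /cexp /= cReM cImM /= !mulr0 subr0 add0r.
have E2 t : cIm (cexp (c * t%:C)) = h2 t.
  by rewrite /cexp /= cReM cImM /= !mulr0 subr0 add0r.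
have d1 (x : R) : is_derive x 1 h1 (a * h1 x - b * h2 x).
  rewrite /h1 /h2; apply: is_derive_eq; rewrite /GRing.scale /=; ring.
have d2 (x : R) : is_derive x 1 h2 (a * h2 x + b * h1 x).
  rewrite /h1 /h2; apply: is_derive_eq; rewrite /GRing.scale /=; ring.
have c1 : continuous h1.
  by move=> x; apply: differentiable_continuous; apply/derivable1_diffP; have [] := d1 x.
have c2 : continuous h2.
  by move=> x; apply: differentiable_continuous; apply/derivable1_diffP; have [] := d2 x.
have k1 : continuous (fun x => a * h1 x - b * h2 x).
  by move=> x; apply: cvgB; apply: cvgM => //; [exact: cvg_cst|exact: c1|exact: cvg_cst|exact: c2].
have k2 : continuous (fun x => a * h2 x + b * h1 x).
  by move=> x; apply: cvgD; apply: cvgM => //; [exact: cvg_cst|exact: c2|exact: cvg_cst|exact: c1].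
have F1 t : cRe (c * cexp (c * t%:C)) = a * h1 t - b * h2 t by rewrite cReM E1 E2.
have F2 t : cIm (c * cexp (c * t%:C)) = a * h2 t + b * h1 t by rewrite cImM E1 E2.
split.
  by split; [apply: (@ing_eq _ _ (fun x => a * h1 x - b * h2 x)) => //|
     apply: (@ing_eq _ _ (fun x => a * h2 x + b * h1 x)) => //];
     apply: ing_within => //; exact: continuous_subspaceT.
move=> t tT; have t0 : 0 <= t by case/andP: tT.
apply: complex_eqP.
  rewrite cReD !E1 CIE -[cRe (_ +i* _)]/(J _ _).
  rewrite (@J_eq _ T _ (fun x => a * h1 x - b * h2 x))// (J_FTC d1)//; ring.
rewrite cImD !E2 CIE -[cIm (_ +i* _)]/(J _ _).
rewrite (@J_eq _ T _ (fun x => a * h2 x + b * h1 x))// (J_FTC d2)//; ring.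
Qed.

(** The antiderivative is the integrand divided by c, so only the values at the two ends count:
    modulus at most 2 / |c|, doubled in passing to [n1]. The factor d allows exponentials normalised
    at the right end, such as e^(iz(t - s)). *)
Lemma CI_cexp_le (c d : R[i]) (s t : R) : c != 0 -> 0 <= s <= T -> 0 <= t <= T ->
  nc (d * cexp (c * s%:C)) <= 1 -> nc (d * cexp (c * t%:C)) <= 1 ->
  n1 (CI (fun r => d * cexp (c * r%:C)) t - CI (fun r => d * cexp (c * r%:C)) s)
    <= 4 / nc c.
Proof.
move=> c0 sT tT ds dt.
have P' : primitive T (fun t => c^-1 * (d * cexp (c * t%:C))) (fun t => d * cexp (c * t%:C)).
  apply: (prim_eq T0 _ _ (primZ (c^-1 * d) (prim_cexp c))) => r _; first by rewrite mulrA.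
  by rewrite mulrA (mulrAC _ d) mulVf// mul1r.
rewrite -(prim_incr P')// -mulrBr.
apply: (le_trans (n1_le_nc _)); rewrite Normc.normcM Normc.normcV.
have nc0 := nc_gt0 c0.
have h3 := ncB (d * cexp (c * t%:C)) (d * cexp (c * s%:C)).
have h4 : nc (d * cexp (c * t%:C) - d * cexp (c * s%:C)) <= 2 by lra.
have -> : 4 / nc c = 2 * ((nc c)^-1 * 2) by lra.
by rewrite ler_pM2l// ler_pM2l// invr_gt0.
Qed.

End Exponential_primitive.

Section RiemannLebesgue.
Variables (R : realType) (T : R).
Hypothesis T0 : 0 < T.

(** Heine-Cantor: the property [P d x] holds for x' near x and d near 0+, and compactness of [0, T]
    makes d independent of x. *)
Lemma within_unif (h : R -> R) e : {within `[0, T], continuous h} -> 0 < e ->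
  exists2 d, 0 < d & forall s t, 0 <= s -> s <= t -> t <= T -> t - s < d ->
   `|h t - h s| <= e.
Proof.
move=> ch e0; have e20 : 0 < e / 2 by rewrite divr_gt0.
have K := (compact_near_coveringP _).1 (@segment_compact R 0 T).
pose P (d x : R) := 0 <= x <= T -> forall y, 0 <= y <= T -> `|x - y| < d -> `|h y - h x| <= e.
have : \forall d \near 0^'+, `[0, T] `<=` P d.
  apply: K => x xT; have xT' : 0 <= x <= T by move: xT; rewrite /= in_itv.
  have /cvgrPdist_le/(_ _ e20) := (subspace_continuousP _ _).1 ch x xT.
  rewrite near_withinE => /nbhs_ballP[r r0 Hr]; have {}r0 : 0 < r := r0.
  have Hr' y : 0 <= y <= T -> `|x - y| < r -> `|h x - h y| <= e / 2.
    by move=> yT xy; apply: Hr => //=; rewrite in_itv.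
  have r20 : 0 < r / 2 by rewrite divr_gt0.
  exists (ball x (r / 2), [set d | d < r / 2]) => /=.
    by split; [exact: nbhsx_ballx|exact: nbhs_right_lt].
  move=> [x' d] /= [xx' dr] x'T y yT x'y.
  have {}xx' : `|x - x'| < r / 2 := xx'.
  have {}dr : d < r / 2 := dr.
  have h1 : `|h x - h x'| <= e / 2.
    by apply: Hr' => //; apply: (lt_trans xx'); rewrite ltr_pdivrMr// ltr_pMr// ltr1n.
  have h2 : `|h x - h y| <= e / 2.
    apply: Hr' => //; have h3 := ler_distD x' x y; apply: (le_lt_trans h3).
    by rewrite (splitr r); apply: ltrD => //; exact: lt_trans dr.
  have := ler_distD (h x) (h y) (h x'); rewrite (distrC (h y) (h x)) => h4.
  by apply: (le_trans h4); rewrite (splitr e) lerD.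
move=> Hn; have [d [d0 Pd]] := filter_ex (filterI (nbhs_right_gt (0 : R)) Hn).
exists d => // s t s0 st tT tsd.
apply: (Pd s); rewrite /= ?in_itv /= ?s0 ?(le_trans st)//; first by rewrite (le_trans s0).
by rewrite distrC ger0_norm// subr_ge0.
Qed.

Lemma L1_approx (h : R -> R) e : ing T h -> 0 < e ->
  exists k, [/\ continuous k, ing T k & J (fun s => `|h s - k s|) T <= e].
Proof.
move=> ih e0.
have mT : (lebesgue_measure `[0%R, T] < +oo :> \bar R)%E.
  by rewrite lebesgue_measure_itv /= lte_fin; case: ifP => // _; rewrite -EFinB ltry.
have [g [cg ig]] := approximation_continuous_integrable (measurable_itv `[0%R, T]) mT ih.
move=> /fine_cvgP[_ /cvgrPdist_le /(_ e e0) [N _ HN]].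
exists (g N); split => //; first exact: ig.
have := HN N (leqnn N); rewrite /= sub0r normrN ger0_norm//.
by apply: fine_ge0; apply: integral_ge0.
Qed.

(* The oscillating factor g enters only through its size and the size B of its integrals,
   so K is uniform over all exponentials with large frequency. *)
Lemma riemann_lebesgue_cont (f : R -> R[i]) : cc T f -> forall e, 0 < e ->
  exists2 K, 0 <= K & forall (g : R -> R[i]) t B, 0 <= t <= T -> 0 <= B -> cc T g ->
    (forall s, 0 <= s <= t -> n1 (g s) <= 2) ->
    (forall a b, 0 <= a -> a <= b -> b <= t -> n1 (CI g b - CI g a) <= B) ->
    n1 (CI (fun s => f s * g s) t) <= e + K * B.
Proof.
move=> cf e e0; have [cf1 cf2] := cf.
have e'0 : 0 < e / (4 * T) by rewrite divr_gt0// mulr_gt0.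
have [d1 d10 H1] := within_unif cf1 e'0; have [d2 d20 H2] := within_unif cf2 e'0.
have [M1 HM1] := within_bounded cf1; have [M2 HM2] := within_bounded cf2.
pose d := Num.min d1 d2; have d0 : 0 < d by rewrite lt_min d10.
have Hd s t : 0 <= s -> s <= t -> t <= T -> t - s < d -> n1 (f t - f s) <= e / (2 * T).
  move=> s0 st tT; rewrite lt_min => /andP[a b].
  rewrite /n1 cReD cImD cReN cImN; have := H1 _ _ s0 st tT a; have := H2 _ _ s0 st tT b.
  have -> : e / (2 * T) = e / (4 * T) + e / (4 * T) by field; rewrite gt_eqF.
  by move=> *; exact: lerD.
pose M := M1 + M2.
have HM s : 0 <= s <= T -> n1 (f s) <= M by move=> sT; apply: lerD; [exact: HM1|exact: HM2].
have M0 : 0 <= M by apply: le_trans (n1_ge0 (f 0)) (HM _ _); rewrite lexx ltW.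
have d2' : 0 < d / 2 by rewrite divr_gt0.
pose N := Num.Def.archi_bound (T / (d / 2)).
exists (N%:R * M); first by rewrite mulr_ge0.
move=> g t B /andP[t0 tT] B0 cg g2 gB.
have cfg : cing T (fun s => f s * g s) by apply: cingM => //; exact: cing_cc.
suff main n : forall r, 0 <= r -> r <= t -> r <= n%:R * (d / 2) ->
    n1 (CI (fun s => f s * g s) r) <= e / T * r + n%:R * M * B.
  have : t <= N%:R * (d / 2).
    rewrite -ler_pdivrMr//; apply: le_trans (ltW (Num.Theory.archi_boundP _)).
      by rewrite ler_pM2r// invr_gt0.
    by rewrite divr_ge0// ltW.
  move=> /(main N t t0 (lexx _))/le_trans; apply; rewrite lerD2r.
  by rewrite mulrAC ler_pdivrMr// ler_pM2l.
elim: n => [|n IH] r r0 rt.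
  rewrite mul0r => rle0; have -> : r = 0 by apply/eqP; rewrite eq_le rle0.
  by rewrite CI0 n10 mulr0 !mul0r addr0.
move=> rn; have [rn'|rn'] := leP r (n%:R * (d / 2)).
  apply: (le_trans (IH _ r0 rt rn')); rewrite lerD2l -!mulrA ler_wpM2r ?mulr_ge0//.
  by rewrite ler_nat.
set s := n%:R * (d / 2) in rn'.
have s0 : 0 <= s by rewrite mulr_ge0// ltW.
have sr := ltW rn'.
have rT := le_trans rt tT; have sT := le_trans sr rT.
have h1 := IH s s0 (le_trans sr rt) (lexx _).
have rsd : r - s < d by move: rn; rewrite -natr1 mulrDl mul1r -/s; lra.
pose w x := (f x - f s) * g x.
have icg := cing_cc cg.
have cw : cing T w.
  by apply: (cing_eq _ (cingD cfg (cingZ (- f s) icg))) => x _; rewrite /w; ring.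
have E x : 0 <= x <= T -> CI (fun s => f s * g s) x = CI w x + f s * CI g x.
  move=> xT; rewrite -(CI_Z _ xT icg) -(CI_D xT cw (cingZ _ icg)).
  by apply: (CI_eq xT) => y _; rewrite /w; ring.
have rT' : 0 <= r <= T by rewrite r0.
have sT' : 0 <= s <= T by rewrite s0.
have -> : CI (fun s => f s * g s) r = CI (fun s => f s * g s) s +
   ((CI w r - CI w s) + f s * (CI g r - CI g s)) by rewrite !E//; ring.
have I1 : n1 (CI w r - CI w s) <= e / T * r - e / T * s.
  have -> : e / T * r - e / T * s = J (fun=> e / T) r - J (fun=> e / T) s.
    by rewrite !J_cst.
  apply: (CI_le_incr s0 sr rT cw (ing_cst T _)) => x /andP[sx xr].
  apply: (le_trans (n1M _ _)).
  have -> : e / T = e / (2 * T) * 2 by field; rewrite gt_eqF.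
  apply: ler_pM; rewrite ?n1_ge0//.
    apply: Hd => //; first exact: le_trans rT.
    by apply: le_lt_trans rsd; rewrite lerD2r.
  by apply: g2; rewrite (le_trans s0)//= (le_trans xr).
have I2 : n1 (f s * (CI g r - CI g s)) <= M * B.
  apply: (le_trans (n1M _ _)); apply: ler_pM; rewrite ?n1_ge0//; first exact: HM.
  exact: gB.
apply: (le_trans (n1D _ _)); have := n1D (CI w r - CI w s) (f s * (CI g r - CI g s)).
rewrite -natr1 !mulrDl mul1r; lra.
Qed.

(** Continuous functions are dense in L^1. Since [n1 (g s) <= 2], approximating each of the two real
    components up to e / 8 changes the integral by at most 2 (e / 8 + e / 8) = e / 2. *)
Lemma riemann_lebesgue (f : R -> R[i]) : cing T f -> forall e, 0 < e ->
  exists2 K, 0 <= K & forall (g : R -> R[i]) t B, 0 <= t <= T -> 0 <= B -> cc T g ->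
    (forall s, 0 <= s <= t -> n1 (g s) <= 2) ->
    (forall a b, 0 <= a -> a <= b -> b <= t -> n1 (CI g b - CI g a) <= B) ->
    n1 (CI (fun s => f s * g s) t) <= e + K * B.
Proof.
move=> [if1 if2] e e0; have e8 : 0 < e / 8 by rewrite divr_gt0.
have e2 : 0 < e / 2 by rewrite divr_gt0.
have [k1 [ck1 ik1 H1]] := L1_approx if1 e8; have [k2 [ck2 ik2 H2]] := L1_approx if2 e8.
pose k s := k1 s +i* k2 s.
have cck : cc T k by split; exact: continuous_subspaceT.
have [K K0 HK] := riemann_lebesgue_cont cck e2.
exists K => // g t B tT B0 cg g2 gB.
have cf : cing T f by [].
have ick := cing_cc cck.
have cfk : cing T (fun s => f s - k s) by apply: cingD => //; exact: cingN.
have comm u : (fun s => u s * g s) = (fun s => g s * u s) by apply/funext => s; rewrite mulrC.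
have I u : cing T u -> cing T (fun s => u s * g s).
  by move=> iu; rewrite comm; exact: cingM.
have -> : CI (fun s => f s * g s) t =
   CI (fun s => k s * g s) t + CI (fun s => (f s - k s) * g s) t.
  rewrite -(CI_D tT (I _ ick) (I _ cfk)); apply: (CI_eq tT) => s _; ring.
apply: (le_trans (n1D _ _)).
have -> : e + K * B = (e / 2 + K * B) + e / 2 by lra.
apply: lerD; first exact: HK.
pose w s := 2 * (`|cRe (f s) - k1 s| + `|cIm (f s) - k2 s|).
have i1 : ing T (fun s => `|cRe (f s) - k1 s|).
  by apply/ing_norm/ingD => //; exact: ingN.
have i2 : ing T (fun s => `|cIm (f s) - k2 s|).
  by apply/ing_norm/ingD => //; exact: ingN.
have iw : ing T w by apply/ingZ/ingD.
apply: (@le_trans _ _ (J w t)).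
  apply: (CI_le tT (I _ cfk) iw) => r rt; apply: (le_trans (n1M _ _)).
  rewrite /w mulrC; apply: ler_pM; rewrite ?n1_ge0//; first exact: g2.
  by rewrite /n1 cReD cImD cReN cImN.
have /andP[t0 tT'] := tT.
apply: (@le_trans _ _ (J w T)).
  by apply: (J_mono t0 tT' _ iw) => // r _; rewrite mulr_ge0// addr_ge0.
have TT : 0 <= T <= T by rewrite lexx ltW.
rewrite /w (JZ _ TT (ingD i1 i2)) (JD TT i1 i2); lra.
Qed.

End RiemannLebesgue.

(** * Solutions of the linear system *)
Section Conjugation.
Variable R : realType.
Implicit Types z w : R[i].

Lemma cJD z w : conjc (z + w) = conjc z + conjc w. Proof. exact: rmorphD. Qed.
Lemma cJB z w : conjc (z - w) = conjc z - conjc w. Proof. exact: rmorphB. Qed.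
Lemma cJM z w : conjc (z * w) = conjc z * conjc w. Proof. exact: rmorphM. Qed.
Lemma conj_i : conjc ('i%C : R[i]) = - 'i%C.
Proof. by apply: complex_eqP => /=; rewrite ?oppr0. Qed.
Lemma conj_half : conjc (2^-1 : R[i]) = 2^-1.
Proof. by rewrite conjc_inv conjc_nat. Qed.

End Conjugation.

Section ZakharovShabat.
Variables (R : realType) (T : R) (q : R -> R[i]).
Hypothesis T0 : 0 < T.
Hypothesis cq : cing T q.
Implicit Types (z w : R[i]) (X Y : R -> R[i] * R[i]).

(* X is a row of a solution of F' = F alpha. *)
Definition sol z X :=
  primitive T (fun t => (X t).1)
    (fun t => 2^-1 * ('i%C * z * (X t).1 - conjc (q t) * (X t).2)) /\
  primitive T (fun t => (X t).2)
    (fun t => 2^-1 * (q t * (X t).1 - 'i%C * z * (X t).2)).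

Definition n2 (x : R[i] * R[i]) : R := n1 x.1 + n1 x.2.
Definition ccp X := cc T (fun t => (X t).1) /\ cc T (fun t => (X t).2).

Lemma sol_ccp z X : sol z X -> ccp X.
Proof. by move=> [a b]; split; [exact: (prim_cc T0 a)|exact: (prim_cc T0 b)]. Qed.

(** In the derivative of |X1|^2 + |X2|^2 the terms with q cancel and Im z (|X2|^2 - |X1|^2) remains.
    Hence the energy times e^(-|Im z| t) does not increase, and the bound is independent of q. *)
Lemma sol_energy z X : sol z X -> forall t, 0 <= t <= T ->
  nc (X t).1 ^+ 2 + nc (X t).2 ^+ 2 <=
  (nc (X 0).1 ^+ 2 + nc (X 0).2 ^+ 2) * expR (`|cIm z| * t).
Proof.
move=> [h1 h2] t tT; pose y : R := `|cIm z|.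
have n2E (x : R[i]) : x * conjc x = (nc x ^+ 2)%:C.
  by rewrite nc_sqr; case: x => a b; apply: complex_eqP => /=; ring.
have PN := primD (primM T0 h1 (primJ h1)) (primM T0 h2 (primJ h2)).
have PE := primM T0 PN (prim_cexp T (- y%:C)).
have E s : cRe (((X s).1 * conjc (X s).1 + (X s).2 * conjc (X s).2) * cexp (- y%:C * s%:C))
   = (nc (X s).1 ^+ 2 + nc (X s).2 ^+ 2) * expR (- (y * s)).
  rewrite !n2E -rmorphD cReM /= !mul0r !subr0; congr (_ * _).
  by rewrite ?(mulr0, sub0r, oppr0, mul0r, addr0, add0r, subr0, cos0, mulr1, mulNr).
have := prim_Re_noninc PE _ tT; rewrite !E mulr0 oppr0 expR0 mulr1.
rewrite expRN ler_pdivrMr ?expR_gt0//; apply=> s sT.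
set F := (X in cRe X).
have -> : F = ((cIm z * (nc (X s).2 ^+ 2 - nc (X s).1 ^+ 2) -
   y * (nc (X s).1 ^+ 2 + nc (X s).2 ^+ 2))%:C) * cexp (- y%:C * s%:C).
  have RC (k l a b : R) : (k * (b - a) - l * (a + b))%:C =
      k%:C * (b%:C - a%:C) - l%:C * (a%:C + b%:C).
    by rewrite rmorphB !rmorphM /= rmorphB rmorphD.
  rewrite /F RC -!n2E.
  have -> : (cIm z)%:C = 2^-1 * 'i%C * (conjc z - z).
    by case: (z) => a b; apply: complex_eqP => /=; rewrite !(mul0r, mulr0, subr0, add0r); field.
  rewrite !(cJM, cJB) conj_i conj_half !conjcK.
  ring.
rewrite cReM /= ?(mulr0, sub0r, oppr0, mul0r, addr0, add0r, subr0, cos0, mulr1).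
rewrite mulr_le0_ge0 ?expR_ge0//.
have := ler_norm (cIm z); have := ler_norm (- cIm z); rewrite normrN -/y => yle yle'.
have := sqr_ge0 (nc (X s).1); have := sqr_ge0 (nc (X s).2).
move: (nc (X s).1 ^+ 2) (nc (X s).2 ^+ 2) => a b b0 a0.
have -> : cIm z * (b - a) - y * (a + b) = - ((y + cIm z) * a + (y - cIm z) * b) by ring.
by rewrite oppr_le0 addr_ge0// mulr_ge0//; lra.
Qed.

Variables U V : R[i] -> R -> R[i] * R[i].
Hypothesis solU : forall z, sol z (U z).
Hypothesis solV : forall z, sol z (V z).
Hypothesis U0 : forall z, U z 0 = (1, 0).
Hypothesis V0 : forall z, V z 0 = (0, 1).

(** The Wronskian of solutions at two parameters: q cancels in its derivative and only a multiple of
    z - w is left. For z = w this gives determinant 1; in general it produces the integrals in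
    [Sop]. *)
Lemma resolvent1 z w X : sol z X ->
  primitive T (fun t => (X t).1 * (V w t).2 - (X t).2 * (V w t).1)
   (fun t => 2^-1 * 'i%C * (z - w) * ((X t).1 * (V w t).2 + (X t).2 * (V w t).1)).
Proof.
move=> [h1 h2]; have [v1 v2] := solV w.
apply: (prim_eq T0 _ _ (primB (primM T0 h1 v2) (primM T0 h2 v1))) => // t _.
ring.
Qed.

Lemma resolvent2 z w X : sol z X ->
  primitive T (fun t => (X t).2 * (U w t).1 - (X t).1 * (U w t).2)
   (fun t => - (2^-1 * 'i%C * (z - w) * ((X t).1 * (U w t).2 + (X t).2 * (U w t).1))).
Proof.
move=> [h1 h2]; have [v1 v2] := solU w.
apply: (prim_eq T0 _ _ (primB (primM T0 h2 v1) (primM T0 h1 v2))) => // t _.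
ring.
Qed.

Lemma wronskian z t : 0 <= t <= T ->
  (U z t).1 * (V z t).2 - (U z t).2 * (V z t).1 = 1.
Proof.
move=> tT; rewrite (prim_const (resolvent1 z (solU z)))//.
  by rewrite U0 V0 /= mul1r mul0r subr0.
by move=> s _; rewrite subrr mulr0 mul0r.
Qed.

(* Variation of constants at spectral parameter w: a solution X at z satisfies
   X = (solution at w with the same initial value) + (z - w) Sop w X. Iterating this
   gives the Taylor expansion of X in z at w with explicit remainders. *)
Definition Sop w X (t : R) : R[i] * R[i] :=
  let p := CI (fun s => (X s).1 * (V w s).2 + (X s).2 * (V w s).1) t in
  let r := - CI (fun s => (X s).1 * (U w s).2 + (X s).2 * (U w s).1) t in
  (2^-1 * 'i%C * (p * (U w t).1 + r * (V w t).1),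
   2^-1 * 'i%C * (p * (U w t).2 + r * (V w t).2)).

Lemma ccU w : ccp (U w). Proof. exact: sol_ccp. Qed.
Lemma ccV w : ccp (V w). Proof. exact: sol_ccp. Qed.
Lemma cing_pair X Y : ccp X -> ccp Y ->
  cing T (fun s => (X s).1 * (Y s).2 + (X s).2 * (Y s).1).
Proof.
move=> [a b] [c d]; apply: cingD; apply: cingM => //; exact: cing_cc.
Qed.

Lemma Sop_ccp w X : ccp X -> ccp (Sop w X).
Proof.
move=> cX; have [u1 u2] := solU w; have [v1 v2] := solV w.
have p1 := prim_CI (cing_pair cX (ccV w)).
have p2 := primN (prim_CI (cing_pair cX (ccU w))).
split.
  exact: (prim_cc T0 (primZ (2^-1 * 'i%C) (primD (primM T0 p1 u1) (primM T0 p2 v1)))).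
exact: (prim_cc T0 (primZ (2^-1 * 'i%C) (primD (primM T0 p1 u2) (primM T0 p2 v2)))).
Qed.

(** Cramer's rule: X t is expanded in the basis [U w t], [V w t], whose determinant is 1. The
    coefficients are Wronskians of X with [V w] and [U w], which the two resolvent lemmas
    integrate. *)
Lemma SopP z w X t : sol z X -> 0 <= t <= T ->
  (X t).1 = (X 0).1 * (U w t).1 + (X 0).2 * (V w t).1 + (z - w) * (Sop w X t).1 /\
  (X t).2 = (X 0).1 * (U w t).2 + (X 0).2 * (V w t).2 + (z - w) * (Sop w X t).2.
Proof.
move=> sX tT; have cX := sol_ccp sX.
have [_ /(_ t tT)] := resolvent1 w sX; have [_ /(_ t tT)] := resolvent2 w sX.
rewrite U0 V0 /= !mulr0 !mulr1 !subr0.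
have [iU iV] := (cing_pair cX (ccU w), cing_pair cX (ccV w)).
rewrite (CI_N tT (cingZ _ iU)) (CI_Z _ tT iU) (CI_Z _ tT iV).
rewrite /Sop /=; set p := CI _ t; set r := CI _ t => Er Ep.
have det := wronskian w tT.
split.
  transitivity ((X t).1 * ((U w t).1 * (V w t).2 - (U w t).2 * (V w t).1)).
    by rewrite det mulr1.
  transitivity (((X t).1 * (V w t).2 - (X t).2 * (V w t).1) * (U w t).1 +
     ((X t).2 * (U w t).1 - (X t).1 * (U w t).2) * (V w t).1); first by ring.
  by rewrite Er Ep; ring.
transitivity ((X t).2 * ((U w t).1 * (V w t).2 - (U w t).2 * (V w t).1)).
  by rewrite det mulr1.
transitivity (((X t).1 * (V w t).2 - (X t).2 * (V w t).1) * (U w t).2 +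
   ((X t).2 * (U w t).1 - (X t).1 * (U w t).2) * (V w t).2); first by ring.
by rewrite Er Ep; ring.
Qed.

Lemma sol_unique z X t : sol z X -> 0 <= t <= T ->
  (X t).1 = (X 0).1 * (U z t).1 + (X 0).2 * (V z t).1 /\
  (X t).2 = (X 0).1 * (U z t).2 + (X 0).2 * (V z t).2.
Proof.
by move=> sX tT; have [h1 h2] := SopP z sX tT; split;
  [rewrite {1}h1|rewrite {1}h2]; rewrite subrr mul0r addr0.
Qed.

(** The map (x, y) -> (conj y, - conj x) carries solutions at conj z to solutions at z and (0, 1) to
    (1, 0); uniqueness does the rest. *)
Lemma sol_symmetry z t : 0 <= t <= T ->
  (U z t).1 = conjc (V (conjc z) t).2 /\ (U z t).2 = - conjc (V (conjc z) t).1.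
Proof.
move=> tT; have [v1 v2] := solV (conjc z).
pose X t := (conjc (V (conjc z) t).2, - conjc (V (conjc z) t).1).
have sX : sol z X.
  split.
    apply: (prim_eq T0 _ _ (primJ v2)) => // s _.
    rewrite /X [(_, _).1]/= [(_, _).2]/= !(cJM, cJB) conj_i conj_half conjcK; ring.
  apply: (prim_eq T0 _ _ (primN (primJ v1))) => // s _.
  rewrite /X [(_, _).1]/= [(_, _).2]/= !(cJM, cJB) conj_i conj_half !conjcK; ring.
have X0 : X 0 = (1, 0).
  rewrite /X V0; congr (_, _); first exact: conjc1.
  by rewrite (_ : conjc _ = 0) ?oppr0//; exact: conjc0.
by have [] := sol_unique sX tT; rewrite X0 /= !mul1r !mul0r !addr0 => <- <-.
Qed.

Definition rows_bounded w W := forall s, 0 <= s <= T ->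
  [/\ n1 (U w s).1 <= W, n1 (U w s).2 <= W, n1 (V w s).1 <= W & n1 (V w s).2 <= W].

Lemma rows_bounded_energy w : rows_bounded w (2 * expR (`|cIm w| * T)).
Proof.
have K X : sol w X -> nc (X 0).1 ^+ 2 + nc (X 0).2 ^+ 2 = 1 ->
  forall s, 0 <= s <= T -> n1 (X s).1 <= 2 * expR (`|cIm w| * T) /\
    n1 (X s).2 <= 2 * expR (`|cIm w| * T).
  move=> sX X1 s sT; have := sol_energy sX sT; rewrite X1 mul1r => h.
  have L : expR (`|cIm w| * s) <= expR (`|cIm w| * T) ^+ 2.
    rewrite -expRM_natr ler_expR -mulrA ler_wpM2l//.
    by case/andP: sT => s0 sT; lra.
  have E x : nc x ^+ 2 <= expR (`|cIm w| * s) -> n1 x <= 2 * expR (`|cIm w| * T).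
    move=> /le_trans/(_ L) h'; apply: (le_trans (n1_le_nc _)).
    rewrite ler_pM2l//; move: h'; rewrite ler_pXn2r ?nnegrE ?nc_ge0 ?expR_ge0//.
  have := sqr_ge0 (nc (X s).1); have := sqr_ge0 (nc (X s).2).
  by split; apply: E; lra.
move=> s sT; have [] := K _ (solU w) _ s sT.
  by rewrite U0 [(_, _).1]/= [(_, _).2]/= Normc.normc0 Normc.normc1 expr1n expr0n addr0.
have [] := K _ (solV w) _ s sT.
  by rewrite V0 [(_, _).1]/= [(_, _).2]/= Normc.normc0 Normc.normc1 expr1n expr0n add0r.
by [].
Qed.

Lemma rows_bounded_ge0 w W : rows_bounded w W -> 0 <= W.
Proof.
move=> HW; have [] := HW 0; first by rewrite lexx ltW.
by move=> h _ _ _; apply: le_trans h; exact: n1_ge0.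
Qed.

Lemma n1_half_i : n1 (2^-1 * 'i%C : R[i]) = 2^-1.
Proof.
have -> : (2^-1 * 'i%C : R[i]) = 0 +i* 2^-1.
  apply: complex_eqP; rewrite ?cReM ?cImM /= ?mulr0 ?mulr1 ?oppr0 ?mul0r ?subr0 ?add0r//; by field.
change (`|0 : R| + `|2^-1 : R| = 2^-1).
by rewrite normr0 add0r ger0_norm// invr_ge0.
Qed.

(** A Volterra estimate: the bound at t involves h only on [0, t], and this is what makes the
    iterates decay. In each component the factor 1/2 of [Sop] cancels against its two terms, leaving
    W^2 times [J h t]. *)
Lemma Sop_bound w W X h : rows_bounded w W -> ccp X -> ing T h ->
  forall t, 0 <= t <= T -> (forall s, 0 <= s <= t -> n2 (X s) <= h s) ->
  n2 (Sop w X t) <= 2 * W ^+ 2 * J h t.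
Proof.
move=> HW cX ih t tT Xh; have W0 := rows_bounded_ge0 HW.
have st s : 0 <= s <= t -> 0 <= s <= T.
  by case/andP: tT => _ tT /andP[-> h1]; exact: le_trans tT.
have K Y : ccp Y -> (forall s, 0 <= s <= T -> n1 (Y s).1 <= W /\ n1 (Y s).2 <= W) ->
    n1 (CI (fun s => (X s).1 * (Y s).2 + (X s).2 * (Y s).1) t) <= W * J h t.
  move=> cY YW; rewrite -(JZ _ tT ih).
  apply: (CI_le tT (cing_pair cX cY) (ingZ _ ih)) => s sI.
  have [y1 y2] := YW s (st s sI).
  apply: (@le_trans _ _ (W * n2 (X s))); last by rewrite ler_wpM2l// Xh.
  apply: (le_trans (n1D _ _)); rewrite [leRHS]mulrC /n2 mulrDl.
  apply: lerD; apply: (le_trans (n1M _ _)); rewrite ler_wpM2l ?n1_ge0//.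
have [a1 a2 a3 a4] := HW t tT.
have p1 := K _ (ccV w) (fun s sT => let: And4 _ _ c d := HW s sT in conj c d).
have p2 := K _ (ccU w) (fun s sT => let: And4 a b _ _ := HW s sT in conj a b).
rewrite /Sop /n2 /=; set p := CI _ t in p1 *; set r := CI _ t in p2 *.
have Jh0 : 0 <= W * J h t by apply: le_trans p1; exact: n1_ge0.
have L x y : n1 x <= W -> n1 y <= W ->
    n1 (2^-1 * 'i%C * (p * x + - r * y)) <= W ^+ 2 * J h t.
  move=> xW yW; apply: (le_trans (n1M _ _)); rewrite n1_half_i.
  have : n1 (p * x + - r * y) <= (W * J h t) * W + (W * J h t) * W.
    apply: (le_trans (n1D _ _)); apply: lerD; apply: (le_trans (n1M _ _)).
      by apply: ler_pM; rewrite ?n1_ge0.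
    by rewrite n1N; apply: ler_pM; rewrite ?n1_ge0.
  by rewrite expr2; lra.
by have := L _ _ a1 a3; have := L _ _ a2 a4; lra.
Qed.

Lemma Sop_lin w X Y c t : ccp X -> ccp Y -> 0 <= t <= T ->
  Sop w (fun s => ((X s).1 + c * (Y s).1, (X s).2 + c * (Y s).2)) t =
  ((Sop w X t).1 + c * (Sop w Y t).1, (Sop w X t).2 + c * (Sop w Y t).2).
Proof.
move=> cX cY tT; rewrite /Sop /=.
have K Z : ccp Z -> CI (fun s => ((X s).1 + c * (Y s).1) * (Z s).2 +
     ((X s).2 + c * (Y s).2) * (Z s).1) t =
   CI (fun s => (X s).1 * (Z s).2 + (X s).2 * (Z s).1) t +
   c * CI (fun s => (Y s).1 * (Z s).2 + (Y s).2 * (Z s).1) t.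
  move=> cZ; have i1 := cing_pair cX cZ; have i2 := cing_pair cY cZ.
  rewrite -(CI_Z c tT i2) -(CI_D tT i1 (cingZ _ i2)).
  by apply: (CI_eq tT) => s _; ring.
rewrite (K _ (ccU w)) (K _ (ccV w)); congr (_, _); ring.
Qed.

Lemma Sop_eq w X Y : (forall t, 0 <= t <= T -> X t = Y t) ->
  forall t, 0 <= t <= T -> Sop w X t = Sop w Y t.
Proof.
move=> XY t tT; rewrite /Sop.
have K Z : CI (fun s => (X s).1 * (Z s).2 + (X s).2 * (Z s).1) t =
    CI (fun s => (Y s).1 * (Z s).2 + (Y s).2 * (Z s).1) t.
  by apply: (CI_eq tT) => s sT; rewrite XY.
by rewrite (K (U w)) (K (V w)).
Qed.

Lemma iter_Sop_ccp w X n : ccp X -> ccp (iter n (Sop w) X).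
Proof. by move=> cX; elim: n => //= n; exact: Sop_ccp. Qed.

(** The linear operator [Sop w] is applied n times to X = X0 + (z - w) Sop w X. With X0 the solution
    at w this becomes the recursion of a tower. *)
Lemma iter_Sop_step z w X0 X n t : ccp X0 -> sol z X ->
  (forall s, 0 <= s <= T ->
     X s = ((X0 s).1 + (z - w) * (Sop w X s).1, (X0 s).2 + (z - w) * (Sop w X s).2)) ->
  0 <= t <= T -> iter n (Sop w) X t =
    ((iter n (Sop w) X0 t).1 + (z - w) * (iter n.+1 (Sop w) X t).1,
     (iter n (Sop w) X0 t).2 + (z - w) * (iter n.+1 (Sop w) X t).2).
Proof.
move=> cX0 sX H; have cX := sol_ccp sX; elim: n t => [|n IH] t tT; first exact: H.
rewrite -[LHS]/(Sop w (iter n (Sop w) X) t) (Sop_eq w IH tT).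
by rewrite Sop_lin//; [exact: iter_Sop_ccp|exact/Sop_ccp/iter_Sop_ccp].
Qed.

Lemma ing_expR (k : R) : ing T (fun s => expR (k * s)).
Proof.
apply: ing_within; apply: continuous_subspaceT => x.
apply: continuous_comp; last exact: continuous_expR.
by apply: cvgM; [exact: cvg_cst|exact: cvg_id].
Qed.

Lemma J_expR_le (k t : R) : 0 < k -> 0 <= t -> J (fun s => expR (k * s)) t <= expR (k * t) / k.
Proof.
move=> k0 t0; pose h s := k^-1 * expR (k * s).
have d (x : R) : is_derive x 1 h (expR (k * x)).
  rewrite /h; apply: is_derive_eq; rewrite /GRing.scale /=; field; exact: lt0r_neq0.
rewrite (J_FTC d)//.
  by rewrite /h mulr0 expR0 mulr1 mulrC gerBl invr_ge0 ltW.
move=> x; apply: continuous_comp; last exact: continuous_expR.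
by apply: cvgM; [exact: cvg_cst|exact: cvg_id].
Qed.

(* In the norm weighted by exp (k t) the operator Sop w is as small as one likes, so the
   Taylor remainders decay faster than any geometric rate. *)
Lemma iter_Sop_bound w W X K k n : rows_bounded w W -> ccp X -> 0 < k -> 0 <= K ->
  (forall s, 0 <= s <= T -> n2 (X s) <= K) ->
  forall t, 0 <= t <= T ->
    n2 (iter n (Sop w) X t) <= K * (2 * W ^+ 2 / k) ^+ n * expR (k * t).
Proof.
move=> HW cX k0 K0 XK; have W0 := rows_bounded_ge0 HW; elim: n => [|n IH] t tT.
  rewrite expr0 mulr1; apply: (le_trans (XK t tT)); rewrite ler_peMr//.
  rewrite -expR0 ler_expR mulr_ge0//; first exact: ltW.
  by case/andP: tT.
have /andP[t0 tT'] := tT.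
set M := K * (2 * W ^+ 2 / k) ^+ n in IH.
have W2 : 0 <= 2 * W ^+ 2 by apply: mulr_ge0 => //; exact: exprn_ge0.
have M0 : 0 <= M by apply: mulr_ge0 => //; apply/exprn_ge0/divr_ge0 => //; exact: ltW.
rewrite iterS; apply: (le_trans (Sop_bound HW (iter_Sop_ccp w n cX)
  (ingZ M (ing_expR k)) tT _)).
  by move=> s /andP[s0 st]; apply: IH; rewrite s0 (le_trans st).
rewrite (JZ _ tT (ing_expR k)).
apply: (@le_trans _ _ (2 * W ^+ 2 * (M * (expR (k * t) / k)))).
  apply: ler_wpM2l => //.
  by apply: ler_wpM2l => //; exact: J_expR_le.
have -> : K * (2 * W ^+ 2 / k) ^+ n.+1 = M * (2 * W ^+ 2 / k).
  by rewrite [(2 * W ^+ 2 / k) ^+ n.+1]exprSr mulrA.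
rewrite le_eqVlt; apply/orP; left; apply/eqP; field; exact: lt0r_neq0.
Qed.

End ZakharovShabat.

(** * Asymptotics for large spectral parameter *)
Section Asymptotics.
Variables (R : realType) (T : R) (q : R -> R[i]).
Hypothesis T0 : 0 < T.
Hypothesis cq : cing T q.
Implicit Types (z w : R[i]) (X Y : R -> R[i] * R[i]).

Lemma cc_cexp (c d : R[i]) : cc T (fun s => d * cexp (c * s%:C)).
Proof. exact: (prim_cc T0 (primZ d (prim_cexp T c))). Qed.

Lemma nc_i : nc ('i%C : R[i]) = 1.
Proof. by rewrite /= expr0n expr1n add0r sqrtr1. Qed.

Lemma cRe_iM z (s : R) : cRe ('i%C * z * s%:C) = - cIm z * s.
Proof. by rewrite !(cReM, cImM) /=; ring. Qed.

Lemma invnE n : (n%:R^-1 : R[i]) = (n%:R^-1)%:C.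
Proof. by rewrite fmorphV rmorph_nat. Qed.

Lemma n1_invn n : n1 (n%:R^-1 : R[i]) = n%:R^-1.
Proof. by rewrite invnE n1_real ger0_norm// invr_ge0. Qed.

Lemma cRe_half_iM z (s : R) : cRe (2^-1 * ('i%C * z) * s%:C) = - cIm z * s / 2.
Proof. by rewrite (invnE 2) -mulrA cReM cRe_iM /= mul0r subr0; ring. Qed.

(** For Im z >= 0 both kernels e^(izs) and e^(iz(t - s)) have modulus at most 1 on 0 <= s <= t, and
    their integrals over subintervals are at most 4 / |z|. The choice of r makes K (4 / |z|) at most
    e / 2. *)
Lemma kernel_small (f : R -> R[i]) e : cing T f -> 0 < e -> exists2 r, 0 < r &
  forall z, 0 <= cIm z -> r <= nc z -> forall t, 0 <= t <= T ->
    n1 (CI (fun s => f s * cexp ('i%C * z * s%:C)) t) <= e /\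
    n1 (CI (fun s => f s * (cexp ('i%C * z * t%:C) * cexp (- ('i%C * z) * s%:C))) t) <= e.
Proof.
move=> cf e0; have e20 : 0 < e / 2 by rewrite divr_gt0.
have [K K0 HK] := riemann_lebesgue T0 cf e20.
exists (1 + 8 * K / e); first by rewrite ltr_pwDl// divr_ge0 ?mulr_ge0// ltW.
move=> z y0 zr t tT; have /andP[t0 tT'] := tT.
have K8 : 0 <= 8 * K / e by rewrite divr_ge0 ?mulr_ge0// ltW.
have nz : 0 < nc z by apply: lt_le_trans zr; rewrite ltr_pwDl.
have z0 : z != 0 by rewrite -nc_eq0 gt_eqF.
have KB : e / 2 + K * (4 / nc z) <= e.
  have h : K * (4 / nc z) <= e / 2.
    have -> : K * (4 / nc z) = 4 * K / nc z by ring.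
    rewrite ler_pdivrMr//; have h1 : 8 * K / e <= nc z by lra.
    have -> : 4 * K = e / 2 * (8 * K / e) by field; exact: lt0r_neq0.
    by rewrite ler_pM2l.
  by rewrite [leRHS](splitr e) lerD2l.
have B0 : 0 <= 4 / nc z by rewrite divr_ge0// nc_ge0.
have c0 : 'i%C * z != 0 by rewrite -nc_eq0 Normc.normcM nc_i mul1r gt_eqF.
have nci : nc ('i%C * z) = nc z by rewrite Normc.normcM nc_i mul1r.
have b1 s : 0 <= s -> nc (1 * cexp ('i%C * z * s%:C)) <= 1.
  move=> s0; rewrite mul1r nc_cexp cRe_iM -expR0 ler_expR mulNr oppr_le0.
  by rewrite mulr_ge0.
have b2 s : s <= t -> nc (cexp ('i%C * z * t%:C) * cexp (- ('i%C * z) * s%:C)) <= 1.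
  move=> st; rewrite -cexpD nc_cexp mulNr cReD cReN !cRe_iM -expR0 ler_expR.
  have -> : - cIm z * t - - cIm z * s = - (cIm z * (t - s)) by ring.
  by rewrite oppr_le0 mulr_ge0// subr_ge0.
have n2nc x : nc x <= 1 -> n1 x <= 2 :> R.
  by move=> h; apply: (le_trans (n1_le_nc _)); lra.
split; apply: le_trans KB.
  have -> : (fun s => f s * cexp ('i%C * z * s%:C)) =
            (fun s => f s * (1 * cexp ('i%C * z * s%:C))).
    by apply/funext => s; rewrite mul1r.
  apply: HK => //; first exact: cc_cexp.
    by move=> s /andP[s0 _]; apply/n2nc/b1.
  move=> a b a0 ab bt; rewrite -nci; apply: (CI_cexp_le T0 c0).
  - by rewrite a0 (le_trans ab)// (le_trans bt).
  - by rewrite (le_trans a0)//= (le_trans bt).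
  - exact: b1.
  - by apply: b1; exact: le_trans ab.
apply: HK => //; first exact: cc_cexp.
  by move=> s /andP[_ st]; apply/n2nc/b2.
move=> a b a0 ab bt; rewrite -nci -ncN; apply: (CI_cexp_le T0).
- by rewrite oppr_eq0.
- by rewrite a0 (le_trans ab)// (le_trans bt).
- by rewrite (le_trans a0)//= (le_trans bt).
- by apply: b2; exact: le_trans bt.
- exact: b2.
Qed.

(** Multiplication by e^(izt/2) compensates the growth allowed by the energy bound, giving bounded
    functions [f1], [f2]. The obstacle is that the Riemann-Lebesgue lemma needs a fixed integrand,
    whereas conj q f2 depends on z. One integration by parts moves the oscillation to [k0f], which
    involves q alone; this settles [f1], and [f2] follows by inserting the approximation of [f1]
    into its equation. *)
Lemma sol_asymptotics e : 0 < e -> exists2 r, 0 < r &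
  forall z, 0 <= cIm z -> r <= nc z -> forall X, sol T q z X ->
    nc (X 0).1 ^+ 2 + nc (X 0).2 ^+ 2 = 1 -> n1 (X 0).1 <= 1 ->
    forall t, 0 <= t <= T ->
      n1 ((X t).1 * cexp (2^-1 * ('i%C * z) * t%:C) -
          (X 0).1 * cexp ('i%C * z * t%:C)) <= e /\
      n1 ((X t).2 * cexp (2^-1 * ('i%C * z) * t%:C) - (X 0).2) <= e.
Proof.
move=> e0; pose Q := J (fun s => n1 (q s)) T.
have TT : 0 <= T <= T by rewrite lexx ltW.
have inq := ing_n1 cq.
have Q0 : 0 <= Q by apply: (J_ge0 TT) => s _; exact: n1_ge0.
have QJ t : 0 <= t <= T -> J (fun s => n1 (q s)) t <= Q.
  by move=> /andP[t0 tT]; apply: (J_mono t0 tT (lexx _) inq) => s _; exact: n1_ge0.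
(* The errors of the two components turn out to be k (1 + 2 Q) and k (1/2 + Q / 2 + Q^2); both are
   at most k (1 + Q)^2. *)
pose k := e / (1 + Q) ^+ 2.
have k0 : 0 < k by rewrite divr_gt0// exprn_gt0// ltr_pwDl.
have kE : k * (1 + Q) ^+ 2 = e by rewrite mulfVK// expf_eq0/= gt_eqF// ltr_pwDl.
have [r1 r10 H1] := kernel_small cq k0; have [r2 r20 H2] := kernel_small (cingJ cq) k0.
exists (Num.max r1 r2); first by rewrite lt_max r10.
move=> z y0; rewrite ge_max => /andP[z1 z2] X sX N1 x1.
have [h1 h2] := sX.
pose c := 'i%C * z.
pose ee t := cexp (2^-1 * c * t%:C); pose E t := cexp (c * t%:C).
pose E' s := cexp (- c * s%:C).
have EE s : E s * E' s = 1 by rewrite /E /E' mulNr cexpN.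
pose f1 t := (X t).1 * ee t; pose f2 t := (X t).2 * ee t.
have pe := prim_cexp T (2^-1 * c).
have pf1 : primitive T f1 (fun s => c * f1 s - 2^-1 * conjc (q s) * f2 s).
  apply: (prim_eq T0 _ _ (primM T0 h1 pe)) => // s _; rewrite /f1 /f2 /ee /c.
  by field.
have pf2 : primitive T f2 (fun s => 2^-1 * q s * f1 s).
  apply: (prim_eq T0 _ _ (primM T0 h2 pe)) => // s _; rewrite /f1 /f2 /ee /c.
  by field.
have fb s : 0 <= s <= T -> n1 (f1 s) <= 2 /\ n1 (f2 s) <= 2.
  move=> sT; have := sol_energy T0 sX sT; rewrite N1 mul1r (ger0_norm y0) => h.
  have e2 : nc (ee s) ^+ 2 * expR (cIm z * s) = 1.
    rewrite nc_cexp -expRM_natr -expRD -[RHS]expR0; congr expR.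
    by rewrite /c cRe_half_iM; field.
  have L x : nc x ^+ 2 <= expR (cIm z * s) -> n1 (x * ee s) <= 2.
    move=> hx; apply: (le_trans (n1_le_nc _)).
    suff : nc (x * ee s) <= 1 by lra.
    rewrite -(@ler_pXn2r _ 2%N) ?nnegrE ?nc_ge0// Normc.normcM exprMn expr1n -e2 mulrC.
    by rewrite ler_wpM2l ?sqr_ge0.
  have := sqr_ge0 (nc (X s).1); have := sqr_ge0 (nc (X s).2).
  by split; apply: L; lra.
have cE' : cc T E' by exact: (prim_cc T0 (prim_cexp T (- c))).
pose k0f := CI (fun s => E' s * conjc (q s)).
have ik0 : cing T (fun s => E' s * conjc (q s)) by apply: cingM => //; exact: cingJ.
have pk0 : primitive T k0f (fun s => E' s * conjc (q s)) := prim_CI ik0.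
(* Only E s * k0f s is a Riemann-Lebesgue integral; the other factor e^(iz(t - s)) is bounded
   because Im z >= 0 and s <= t. *)
have Kb s t : 0 <= s <= T -> s <= t -> t <= T -> n1 (E t * k0f s) <= 2 * k.
  move=> sT st tT.
  have -> : E t * k0f s = cexp (c * (t - s)%:C) * (E s * k0f s).
    rewrite mulrA -cexpD -mulrDr -rmorphD; congr (cexp (_ * _%:C) * _); ring.
  apply: (le_trans (n1M _ _)); apply: ler_pM; rewrite ?n1_ge0//.
    apply: (le_trans (n1_cexp _)); rewrite ler_piMr//.
    rewrite -expR0 ler_expR /c cRe_iM mulNr oppr_le0 mulr_ge0// subr_ge0//.
  have [_ Hs] := H2 z y0 z2 s sT.
  rewrite -(CI_Z _ sT ik0) (_ : CI _ s = CI (fun r => conjc (q r) * (E s * E' r)) s)//.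
  by apply: (CI_eq sT) => r _; ring.
(* The integration by parts: the derivative of f1 E' is - conj q f2 E' / 2, which the derivative of
   f2 k0f / 2 cancels, leaving q f1 k0f / 4. *)
have P := primD (primM T0 pf1 (prim_cexp T (- c))) (primZ 2^-1 (primM T0 pf2 pk0)).
have P' : primitive T (fun t => f1 t * E' t + 2^-1 * (f2 t * k0f t))
     (fun t => 4^-1 * (q t * (f1 t * k0f t))).
  apply: (prim_eq T0 _ _ P) => // s _; rewrite -/(E' s); by field.
have ci := prim_cing P'.
have E00 : E' 0 = 1 by rewrite /E' rmorph0 mulr0 cexp0.
have ee0 : ee 0 = 1 by rewrite /ee rmorph0 mulr0 cexp0.
have B1 t : 0 <= t <= T -> n1 (f1 t - (X 0).1 * E t) <= k * (1 + 2 * Q).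
  move=> tT; have /andP[t0 tT'] := tT.
  have [_ /(_ t tT)] := P'; rewrite E00 /k0f CI0 !mulr0 addr0 mulr1 -/k0f => PE.
  have -> : f1 t - (X 0).1 * E t =
      E t * CI (fun t => 4^-1 * (q t * (f1 t * k0f t))) t - 2^-1 * (f2 t * (E t * k0f t)).
    have -> : (X 0).1 = f1 0 by rewrite /f1 ee0 mulr1.
    transitivity (f1 t * (E t * E' t) - f1 0 * E t); first by rewrite EE mulr1.
    have -> : f1 t * (E t * E' t) = E t * (f1 t * E' t + 2^-1 * (f2 t * k0f t))
       - 2^-1 * (f2 t * (E t * k0f t)) by ring.
    by rewrite PE; ring.
  apply: (le_trans (n1B _ _)); rewrite mulrDr mulr1 addrC; apply: lerD.
    apply: (le_trans (n1M _ _)); rewrite (n1_invn 2).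
    have [_ fb2] := fb t tT.
    have [_ Ht] := H2 z y0 z2 t tT.
    have : n1 (f2 t * (E t * k0f t)) <= 2 * k.
      apply: (le_trans (n1M _ _)); apply: ler_pM; rewrite ?n1_ge0//.
      rewrite -(CI_Z _ tT ik0) (_ : CI _ t = CI (fun r => conjc (q r) * (E t * E' r)) t)//.
      by apply: (CI_eq tT) => r _; ring.
    lra.
  rewrite -(CI_Z _ tT ci).
  have -> : k * (2 * Q) = 2 * k * Q by ring.
  apply: (@le_trans _ _ (J (fun s => 2 * k * n1 (q s)) t)); last first.
    rewrite (JZ _ tT inq) ler_wpM2l//; last exact: QJ.
    by rewrite mulr_ge0// ltW.
  apply: (CI_le tT (cingZ _ ci) (ingZ _ inq)) => s /andP[s0 st].
  have sT : 0 <= s <= T by rewrite s0 (le_trans st).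
  have -> : E t * (4^-1 * (q s * (f1 s * k0f s))) = 4^-1 * (q s * (f1 s * (E t * k0f s))) by ring.
  have [fb1 _] := fb s sT.
  have a1 : n1 (f1 s * (E t * k0f s)) <= 2 * (2 * k).
    by apply: (le_trans (n1M _ _)); apply: ler_pM; rewrite ?n1_ge0// Kb.
  apply: (le_trans (n1M _ _)); rewrite (n1_invn 4).
  have : n1 (q s * (f1 s * (E t * k0f s))) <= n1 (q s) * (2 * (2 * k)).
    by apply: (le_trans (n1M _ _)); rewrite ler_wpM2l ?n1_ge0.
  have -> : n1 (q s) * (2 * (2 * k)) = 4 * (k * n1 (q s)) by ring.
  have : 0 <= k * n1 (q s) by rewrite mulr_ge0 ?n1_ge0// ltW.
  rewrite -[2 * k * _]mulrA; lra.
have kQ : k * (1 + 2 * Q) <= e.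
  rewrite -kE ler_pM2l//; have := sqr_ge0 Q; have -> : (1 + Q) ^+ 2 = 1 + 2 * Q + Q ^+ 2 by ring.
  lra.
move=> t tT; split; first exact: le_trans (B1 t tT) kQ.
have /andP[t0 tT'] := tT.
have [_ /(_ t tT) Ef2] := pf2.
rewrite -[X in n1 (X - _)]/(f2 t) Ef2 [f2 0]/f2 ee0 mulr1.
rewrite addrAC subrr add0r.
have iqE : cing T (fun s => (X 0).1 / 2 * (q s * E s)).
  apply: cingZ; apply: (cing_eq (f := fun s => E s * q s)); first by move=> s _; rewrite mulrC.
  by apply: cingM => //; exact: (prim_cc T0 (prim_cexp T c)).
have cf1 := prim_cc T0 pf1.
have iqf : cing T (fun s => 2^-1 * q s * f1 s) := prim_cing pf2.
have id : cing T (fun s => 2^-1 * q s * f1 s - (X 0).1 / 2 * (q s * E s)).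
  by apply: cingD => //; exact: cingN.
rewrite (CI_eq (g := fun s => (X 0).1 / 2 * (q s * E s) +
  (2^-1 * q s * f1 s - (X 0).1 / 2 * (q s * E s))) tT); last by move=> s _; ring.
rewrite (CI_D tT iqE id).
apply: (le_trans (n1D _ _)).
have iqE' : cing T (fun s => q s * E s).
  apply: (cing_eq (f := fun s => E s * q s)); first by move=> s _; rewrite mulrC.
  by apply: cingM => //; exact: (prim_cc T0 (prim_cexp T c)).
rewrite (CI_Z _ tT iqE').
have b1 : n1 ((X 0).1 / 2 * CI (fun s => q s * E s) t) <= k / 2.
  have [Hq _] := H1 z y0 z1 t tT.
  apply: (le_trans (n1M _ _)).
  have : n1 ((X 0).1 / 2) <= 1 / 2.
    by apply: (le_trans (n1M _ _)); rewrite (n1_invn 2) ler_pM2r// invr_gt0.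
  have -> : k / 2 = 1 / 2 * k by ring.
  by move=> h; apply: ler_pM; rewrite ?n1_ge0.
have b2 : n1 (CI (fun s => 2^-1 * q s * f1 s - (X 0).1 / 2 * (q s * E s)) t)
    <= k * (1 + 2 * Q) / 2 * Q.
  apply: (@le_trans _ _ (J (fun s => k * (1 + 2 * Q) / 2 * n1 (q s)) t)); last first.
    rewrite (JZ _ tT inq) ler_wpM2l//; last exact: QJ.
    by rewrite divr_ge0// mulr_ge0 ?ltW// ltr_wpDr// mulr_ge0.
  apply: (CI_le tT id (ingZ _ inq)) => s /andP[s0 st].
  have sT : 0 <= s <= T by rewrite s0 (le_trans st).
  have -> : 2^-1 * q s * f1 s - (X 0).1 / 2 * (q s * E s) =
    2^-1 * (q s * (f1 s - (X 0).1 * E s)) by ring.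
  apply: (le_trans (n1M _ _)); rewrite (n1_invn 2).
  have : n1 (q s * (f1 s - (X 0).1 * E s)) <= n1 (q s) * (k * (1 + 2 * Q)).
    by apply: (le_trans (n1M _ _)); rewrite ler_wpM2l ?n1_ge0// B1.
  move=> h;
    have -> : k * (1 + 2 * Q) / 2 * n1 (q s) = 2^-1 * (n1 (q s) * (k * (1 + 2 * Q))) by ring.
  by rewrite ler_pM2l// invr_gt0.
apply: (le_trans (lerD b1 b2)).
rewrite -kE.
have -> : k / 2 + k * (1 + 2 * Q) / 2 * Q = k * (2^-1 + (1 + 2 * Q) / 2 * Q) by ring.
rewrite ler_pM2l//.
have -> : 2^-1 + (1 + 2 * Q) / 2 * Q = 2^-1 + Q / 2 + Q ^+ 2 by field.
have -> : (1 + Q) ^+ 2 = 1 + 2 * Q + Q ^+ 2 by ring.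
lra.
Qed.

End Asymptotics.

(** * Comparison with q = 0 near the real axis *)

Section NearRealAxis.
Variables (R : realType) (T : R) (q : R -> R[i]).
Hypothesis T0 : 0 < T.
Hypothesis cq : cing T q.
Implicit Types (z w : R[i]) (X Y : R -> R[i] * R[i]) (x : R).
Variables U V : R[i] -> R -> R[i] * R[i].
Hypothesis solU : forall z, sol T q z (U z).
Hypothesis solV : forall z, sol T q z (V z).
Hypothesis U0 : forall z, U z 0 = (1, 0).
Hypothesis V0 : forall z, V z 0 = (0, 1).

(** [fe] and [fei] are e^(izt/2) and e^(-izt/2), the diagonal entries of the fundamental solution
    for q = 0. *)
Definition fe z (t : R) := cexp (2^-1 * ('i%C * z) * t%:C).
Definition fei z (t : R) := cexp (- (2^-1 * ('i%C * z) * t%:C)).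

Lemma feK z t : fe z t * fei z t = 1. Proof. exact: cexpN. Qed.
Lemma fe_sqr z t : fe z t * fe z t = cexp ('i%C * z * t%:C).
Proof. by rewrite -cexpD; congr cexp; field. Qed.
Lemma nc_fe_real x t : nc (fe x%:C t) = 1.
Proof. by rewrite nc_cexp cRe_half_iM /= oppr0 !mul0r expR0. Qed.
Lemma nc_fei_real x t : nc (fei x%:C t) = 1.
Proof. by rewrite nc_cexp cReN cRe_half_iM /= oppr0 !mul0r oppr0 expR0. Qed.
Lemma n1_fe_real x t : n1 (fe x%:C t) <= 2.
Proof. by apply: (le_trans (n1_le_nc _)); rewrite nc_fe_real mulr1. Qed.
Lemma n1_fei_real x t : n1 (fei x%:C t) <= 2.
Proof. by apply: (le_trans (n1_le_nc _)); rewrite nc_fei_real mulr1. Qed.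

(* The solutions at z are e-close to the solutions for q = 0 at the real parameter x. *)
Definition close x (e : R) z := forall t, 0 <= t <= T ->
  [/\ n1 ((U z t).1 - fe x%:C t) <= e, n1 (U z t).2 <= e,
      n1 (V z t).1 <= e & n1 ((V z t).2 - fei x%:C t) <= e].

Lemma init_norms z : [/\ nc (U z 0).1 ^+ 2 + nc (U z 0).2 ^+ 2 = 1, n1 (U z 0).1 <= 1,
  nc (V z 0).1 ^+ 2 + nc (V z 0).2 ^+ 2 = 1 & n1 (V z 0).1 <= 1].
Proof.
have E0 := Normc.normc0 R; have E1 := Normc.normc1 R.
rewrite U0 V0 ![(_, _).1]/= ![(_, _).2]/=.
by rewrite E0 E1 n1_1 n10 expr1n expr0n addr0 add0r.
Qed.

Lemma close_real e : 0 < e -> exists2 r, 0 < r & forall x, r <= `|x| -> close x e x%:C.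
Proof.
move=> e0; have e20 : 0 < e / 2 by rewrite divr_gt0.
have [r r0 H] := sol_asymptotics T0 cq e20; exists r => // x rx t tT.
have [iu iu1 iv iv1] := init_norms x%:C.
have rx' : r <= nc x%:C by rewrite nc_real.
have [u1 u2] := H x%:C (lexx _) rx' _ (solU _) iu iu1 t tT.
have [v1 v2] := H x%:C (lexx _) rx' _ (solV _) iv iv1 t tT.
move: u1 u2 v1 v2; rewrite U0 V0 ![(_, _).1]/= ![(_, _).2]/=.
rewrite !mul0r !subr0 !mul1r -fe_sqr => u1 u2 v1 v2.
have L y : n1 y <= e / 2 -> n1 (y * fei x%:C t) <= e.
  move=> h; apply: (le_trans (n1M _ _)).
  have -> : e = e / 2 * 2 by field.
  by apply: ler_pM; rewrite ?n1_ge0// n1_fei_real.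
have K y : y * fe x%:C t * fei x%:C t = y by rewrite -mulrA feK mulr1.
split.
- by have := L _ u1; rewrite mulrBl !K.
- by have := L _ u2; rewrite K.
- by have := L _ v1; rewrite K.
- by have := L _ v2; rewrite mulrBl K mul1r.
Qed.

(** The factor [fe z T] is kept on the left because its inverse is unbounded in the upper
    half-plane. For q = 0 the product is exactly e^(izT) + 1. *)
Lemma trace_asymptotics e : 0 < e -> exists2 r, 0 < r & forall z, 0 <= cIm z -> r <= nc z ->
  n1 (((U z T).1 + (V z T).2) * fe z T - cexp ('i%C * z * T%:C) - 1) <= e.
Proof.
move=> e0; have e20 : 0 < e / 2 by rewrite divr_gt0.
have TT : 0 <= T <= T by rewrite lexx ltW.
have [r r0 H] := sol_asymptotics T0 cq e20; exists r => // z y0 rz.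
have [iu iu1 iv iv1] := init_norms z.
have [u1 _] := H z y0 rz _ (solU _) iu iu1 T TT.
have [_ v2] := H z y0 rz _ (solV _) iv iv1 T TT.
move: u1 v2; rewrite U0 V0 ![(_, _).1]/= ![(_, _).2]/= !mul1r => u1 v2.
have -> : ((U z T).1 + (V z T).2) * fe z T - cexp ('i%C * z * T%:C) - 1 =
  ((U z T).1 * fe z T - cexp ('i%C * z * T%:C)) + ((V z T).2 * fe z T - 1) by ring.
by rewrite (splitr e); apply: (le_trans (n1D _ _)); exact: lerD.
Qed.

Lemma sol_expansion z w t : 0 <= t <= T ->
  U z t = ((U w t).1 + (z - w) * (Sop U V w (U z) t).1,
           (U w t).2 + (z - w) * (Sop U V w (U z) t).2) /\
  V z t = ((V w t).1 + (z - w) * (Sop U V w (V z) t).1,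
           (V w t).2 + (z - w) * (Sop U V w (V z) t).2).
Proof.
move=> tT; have [a1 a2] := SopP T0 solU solV U0 V0 w (solU z) tT.
have [b1 b2] := SopP T0 solU solV U0 V0 w (solV z) tT.
move: a1 a2 b1 b2; rewrite U0 V0 /= !mul1r !mul0r !addr0 !add0r => a1 a2 b1 b2.
by rewrite -a1 -a2 -b1 -b2 -!surjective_pairing.
Qed.

(** The energy bound depends on Im z only, so [Sop] is bounded uniformly on the strip and C does not
    depend on the real parts. This carries estimates from large real x to complex discs of fixed
    radius. *)
Lemma sol_lipschitz (B : R) : exists2 C, 0 <= C & forall z w t,
  `|cIm z| <= B -> `|cIm w| <= B -> 0 <= t <= T ->
  [/\ n1 ((U z t).1 - (U w t).1) <= C * n1 (z - w),
      n1 ((U z t).2 - (U w t).2) <= C * n1 (z - w),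
      n1 ((V z t).1 - (V w t).1) <= C * n1 (z - w) &
      n1 ((V z t).2 - (V w t).2) <= C * n1 (z - w)].
Proof.
pose W := 2 * expR (B * T); have W0 : 0 <= W by rewrite mulr_ge0// expR_ge0.
have HW w : `|cIm w| <= B -> rows_bounded T U V w W.
  move=> wB s sT; have [a b c d] := rows_bounded_energy T0 solU solV U0 V0 w sT.
  have h : 2 * expR (`|cIm w| * T) <= W by rewrite ler_pM2l// ler_expR ler_pM2r.
  by split; apply: le_trans h.
exists (2 * W ^+ 2 * (2 * W * T)).
  by rewrite !mulr_ge0// ?exprn_ge0// ltW.
move=> z w t zB wB tT.
have cU := sol_ccp T0 (solU z); have cV := sol_ccp T0 (solV z).
have [EU EV] := sol_expansion z w tT.
have K X : ccp T X -> (forall s, 0 <= s <= T -> n1 (X s).1 <= W /\ n1 (X s).2 <= W) ->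
    n2 (Sop U V w X t) <= 2 * W ^+ 2 * (2 * W * T).
  move=> cX XW.
  have /andP[t0 tT'] := tT.
  apply: (le_trans (Sop_bound T0 solU solV (HW w wB) cX (ing_cst T (2 * W)) tT _)).
    move=> s /andP[s0 st]; have [] := XW s; first by rewrite s0 (le_trans st).
    by rewrite /n2; lra.
  rewrite J_cst// ler_wpM2l//; first by rewrite mulr_ge0// exprn_ge0.
  by rewrite ler_wpM2l// mulr_ge0.
have KU := K _ cU (fun s sT => let: And4 a b _ _ := HW z zB s sT in conj a b).
have KV := K _ cV (fun s sT => let: And4 _ _ a b := HW z zB s sT in conj a b).
have L y1 y2 p : n2 p <= 2 * W ^+ 2 * (2 * W * T) ->
   n1 (y1 + (z - w) * p.1 - y1) <= 2 * W ^+ 2 * (2 * W * T) * n1 (z - w) /\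
   n1 (y2 + (z - w) * p.2 - y2) <= 2 * W ^+ 2 * (2 * W * T) * n1 (z - w).
  move=> h; have := n1_ge0 p.1; have := n1_ge0 p.2; rewrite /n2 in h => p2 p1.
  have E y v : y + v - y = v :> R[i] by ring.
  rewrite !E; split; apply: (le_trans (n1M _ _)); rewrite mulrC ler_wpM2r ?n1_ge0//; lra.
have [l1 l2] := L (U w t).1 (U w t).2 _ KU.
have [l3 l4] := L (V w t).1 (V w t).2 _ KV.
by rewrite EU EV.
Qed.

Lemma close_near e : 0 < e -> exists r d, [/\ 0 < r, 0 < d & forall x z,
  r <= `|x| -> nc (z - x%:C) <= d -> close x e z].
Proof.
move=> e0; have e20 : 0 < e / 2 by rewrite divr_gt0.
have [r r0 H] := close_real e20; have [C C0 HC] := sol_lipschitz 1.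
(* The bound 1 keeps z in the strip of [sol_lipschitz]; passing from [nc] to [n1] doubles e / 4 to e
   / 2. *)
pose d := Num.min 1 (e / 4 / (1 + C)).
have C1 : 0 < 1 + C by rewrite ltr_pwDl.
have d0 : 0 < d by rewrite lt_min ltr01/= !divr_gt0.
exists r, d; split=> // x z rx; rewrite le_min => /andP[zx1 zxd] t tT.
have [u1 u2 v1 v2] := H x rx t tT.
have Iz : `|cIm z| <= 1.
  by apply: le_trans zx1; have := normIm_le_nc (z - x%:C); rewrite cImD cImN /= oppr0 addr0.
have Ix : `|cIm x%:C| <= 1 by rewrite /= normr0.
have [c1 c2 c3 c4] := HC z x%:C t Iz Ix tT.
have M : C * n1 (z - x%:C) <= e / 2.
  have h1 : n1 (z - x%:C) <= e / 2 / (1 + C).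
    apply: (le_trans (n1_le_nc _)).
    have -> : e / 2 / (1 + C) = 2 * (e / 4 / (1 + C)) by field; exact: lt0r_neq0.
    by rewrite ler_pM2l.
  apply: (@le_trans _ _ ((1 + C) * (e / 2 / (1 + C)))).
    by apply: ler_pM; rewrite ?n1_ge0// lerDr.
  by rewrite le_eqVlt; apply/orP; left; apply/eqP; field; exact: lt0r_neq0.
have L a b c : n1 (a - b) <= C * n1 (z - x%:C) -> n1 (b - c) <= e / 2 -> n1 (a - c) <= e.
  move=> h1 h2; have -> : a - c = (a - b) + (b - c) by ring.
  apply: (le_trans (n1D _ _)); rewrite (splitr e); apply: lerD => //.
  exact: le_trans M.
split; [exact: L c1 u1| | |exact: L c4 v2].
  by have := L _ _ 0 c2; rewrite !subr0; apply.
by have := L _ _ 0 c3; rewrite !subr0; apply.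
Qed.

(** For q = 0 one has U = (fe, 0) and V = (0, fei), so [Sop] maps (a1 fe, a2 fei) to i/2 times ((int
    a1) fe, - (int a2) fei). Errors of size e in U, V and X perturb this by at most D e, where D
    depends on K and T alone. *)
Lemma Sop_step (K : R) : 1 <= K -> exists2 D, 0 <= D & forall x w X (a1 a2 : R -> R[i]) e,
  0 <= e -> e <= 1 -> close x e w -> ccp T X -> cing T a1 -> cing T a2 ->
  (forall s, 0 <= s <= T -> n1 (a1 s) <= K /\ n1 (a2 s) <= K) ->
  (forall s, 0 <= s <= T -> n1 ((X s).1 - a1 s * fe x%:C s) <= e /\
     n1 ((X s).2 - a2 s * fei x%:C s) <= e) ->
  forall t, 0 <= t <= T ->
   n1 ((Sop U V w X t).1 - 2^-1 * 'i%C * CI a1 t * fe x%:C t) <= D * e /\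
   n1 ((Sop U V w X t).2 - 2^-1 * 'i%C * (- CI a2 t) * fei x%:C t) <= D * e.
Proof.
move=> K1; have K0 : 0 <= K by lra.
pose G := 7 * K + 4.
have G0 : 0 <= G by rewrite addr_ge0// mulr_ge0.
(* [G * e] bounds the error of the integrands. The three error terms are then at most 3 G T e, K T e
   and (G T e + K T) e, and e <= 1. *)
exists (4 * G * T + 2 * K * T); first by rewrite addr_ge0// !mulr_ge0// ltW.
move=> x w X a1 a2 e e0 e1 cl cX ca1 ca2 aK Xa t tT.
have /andP[t0 tT'] := tT.
have cU := sol_ccp T0 (solU w); have cV := sol_ccp T0 (solV w).
have tri a b c1 c2 : n1 (a - b) <= c1 -> n1 b <= c2 -> n1 a <= c1 + c2 :> R.
  by move=> h1 h2; rewrite -(subrK b a); apply: (le_trans (n1D _ _)); exact: lerD.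
have mulb a b c1 c2 : n1 a <= c1 -> n1 b <= c2 -> n1 (a * b) <= c1 * c2 :> R.
  by move=> h1 h2; apply: (le_trans (n1M _ _)); apply: ler_pM; rewrite ?n1_ge0.
have W1 s : 0 <= s <= T -> n1 (U w s).1 <= 3 /\ n1 (V w s).2 <= 3.
  move=> sT; have [u1 _ _ v2] := cl s sT.
  have := tri _ _ _ _ u1 (n1_fe_real x s); have := tri _ _ _ _ v2 (n1_fei_real x s).
  by lra.
have X12 s : 0 <= s <= T -> n1 (X s).1 <= 2 * K + 1 /\ n1 (X s).2 <= 2 * K + 1.
  move=> sT; have [k1 k2] := aK s sT; have [h1 h2] := Xa s sT.
  have := tri _ _ _ _ h1 (mulb _ _ _ _ k1 (n1_fe_real x s)).
  have := tri _ _ _ _ h2 (mulb _ _ _ _ k2 (n1_fei_real x s)).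
  lra.
have P1 s : 0 <= s <= T -> n1 ((X s).1 * (V w s).2 + (X s).2 * (V w s).1 - a1 s) <= G * e.
  move=> sT; have [k1 k2] := aK s sT; have [h1 h2] := Xa s sT.
  have [u1 u2 v1 v2] := cl s sT; have [w1 w2] := W1 s sT; have [x1 x2] := X12 s sT.
  have -> : (X s).1 * (V w s).2 + (X s).2 * (V w s).1 - a1 s =
    ((X s).1 - a1 s * fe x%:C s) * (V w s).2 +
    a1 s * fe x%:C s * ((V w s).2 - fei x%:C s) + (X s).2 * (V w s).1.
    transitivity ((X s).1 * (V w s).2 + (X s).2 * (V w s).1 - a1 s * (fe x%:C s * fei x%:C s)).
      by rewrite feK mulr1.
    by ring.
  apply: (le_trans (n1D _ _)); apply: (le_trans (lerD (n1D _ _) (lexx _))).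
  have b1 := mulb _ _ _ _ h1 w2.
  have b2 := mulb _ _ _ _ (mulb _ _ _ _ k1 (n1_fe_real x s)) v2.
  have b3 := mulb _ _ _ _ x2 v1.
  have E : e * 3 + K * 2 * e + (2 * K + 1) * e = (4 * K + 4) * e by ring.
  have : (4 * K + 4) * e <= (7 * K + 4) * e by rewrite ler_wpM2r//; lra.
  rewrite /G; lra.
have P2 s : 0 <= s <= T -> n1 ((X s).1 * (U w s).2 + (X s).2 * (U w s).1 - a2 s) <= G * e.
  move=> sT; have [k1 k2] := aK s sT; have [h1 h2] := Xa s sT.
  have [u1 u2 v1 v2] := cl s sT; have [w1 w2] := W1 s sT; have [x1 x2] := X12 s sT.
  have -> : (X s).1 * (U w s).2 + (X s).2 * (U w s).1 - a2 s =
    ((X s).2 - a2 s * fei x%:C s) * (U w s).1 +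
    a2 s * fei x%:C s * ((U w s).1 - fe x%:C s) + (X s).1 * (U w s).2.
    transitivity ((X s).1 * (U w s).2 + (X s).2 * (U w s).1 - a2 s * (fe x%:C s * fei x%:C s)).
      by rewrite feK mulr1.
    by ring.
  apply: (le_trans (n1D _ _)); apply: (le_trans (lerD (n1D _ _) (lexx _))).
  have b1 := mulb _ _ _ _ h2 w1.
  have b2 := mulb _ _ _ _ (mulb _ _ _ _ k2 (n1_fei_real x s)) u1.
  have b3 := mulb _ _ _ _ x1 u2.
  have E : e * 3 + K * 2 * e + (2 * K + 1) * e = (4 * K + 4) * e by ring.
  have : (4 * K + 4) * e <= (7 * K + 4) * e by rewrite ler_wpM2r//; lra.
  rewrite /G; lra.
have iP Y a : ccp T Y -> cing T a ->
   (forall s, 0 <= s <= T -> n1 ((X s).1 * (Y s).2 + (X s).2 * (Y s).1 - a s) <= G * e) ->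
   n1 (CI (fun s => (X s).1 * (Y s).2 + (X s).2 * (Y s).1) t - CI a t) <= G * T * e.
  move=> cY ca H; have i1 := cing_pair cX cY.
  rewrite -(CI_N tT ca) -(CI_D tT i1 (cingN ca)).
  apply: (@le_trans _ _ (J (fun=> G * e) t)); last first.
    rewrite J_cst// mulrAC ler_wpM2r// ler_wpM2l//.
  apply: (CI_le tT (cingD i1 (cingN ca)) (ing_cst T _)) => s /andP[s0 st].
  by apply: H; rewrite s0 (le_trans st).
have p1 := iP _ _ cV ca1 P1; have p2 := iP _ _ cU ca2 P2.
have CIK a : cing T a -> (forall s, 0 <= s <= T -> n1 (a s) <= K) -> n1 (CI a t) <= K * T.
  move=> ca H; apply: (@le_trans _ _ (J (fun=> K) t)); last first.
    by rewrite J_cst// ler_wpM2l.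
  apply: (CI_le tT ca (ing_cst T _)) => s /andP[s0 st].
  by apply: H; rewrite s0 (le_trans st).
have k1 := CIK _ ca1 (fun s sT => proj1 (aK s sT)).
have k2 := CIK _ ca2 (fun s sT => proj2 (aK s sT)).
rewrite /Sop ![(_, _).1]/= ![(_, _).2]/=.
set p := CI _ t in p1 *; set r := CI _ t in p2 *.
have [u1 u2 v1 v2] := cl t tT; have [w1 w2] := W1 t tT.
have GT0 : 0 <= G * T by rewrite mulr_ge0// ltW.
have KT0 : 0 <= K * T by rewrite mulr_ge0// ltW.
have pb := tri _ _ _ _ p1 k1.
have rb := tri _ _ _ _ p2 k2.
have half y : n1 y <= (4 * G * T + 2 * K * T) * e ->
    n1 (2^-1 * 'i%C * y) <= (4 * G * T + 2 * K * T) * e.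
  move=> h; apply: (le_trans (n1M _ _)); rewrite n1_half_i.
  have := n1_ge0 y; lra.
have ee : e * e <= e by rewrite -[leRHS]mulr1 ler_wpM2l.
have GTee : G * T * (e * e) <= G * T * e by rewrite ler_wpM2l.
split.
  have -> : 2^-1 * 'i%C * (p * (U w t).1 + - r * (V w t).1) -
      2^-1 * 'i%C * CI a1 t * fe x%:C t =
    2^-1 * 'i%C * ((p - CI a1 t) * (U w t).1 + CI a1 t * ((U w t).1 - fe x%:C t)
      + - r * (V w t).1) by ring.
  apply: half.
  apply: (le_trans (n1D _ _)); apply: (le_trans (lerD (n1D _ _) (lexx _))).
  have b1 := mulb _ _ _ _ p1 w1; have b2 := mulb _ _ _ _ k1 u1.
  have b3 : n1 (- r * (V w t).1) <= (G * T * e + K * T) * e by apply: mulb; rewrite ?n1N.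
  have E1 : (G * T * e + K * T) * e = G * T * (e * e) + K * T * e by ring.
  have E2 : (4 * G * T + 2 * K * T) * e = 4 * (G * T * e) + 2 * (K * T * e) by ring.
  lra.
have -> : 2^-1 * 'i%C * (p * (U w t).2 + - r * (V w t).2) -
    2^-1 * 'i%C * (- CI a2 t) * fei x%:C t =
  2^-1 * 'i%C * (- ((r - CI a2 t) * (V w t).2) + - (CI a2 t * ((V w t).2 - fei x%:C t))
    + p * (U w t).2) by ring.
apply: half.
apply: (le_trans (n1D _ _)); apply: (le_trans (lerD (n1D _ _) (lexx _))).
rewrite !n1N.
have b1 := mulb _ _ _ _ p2 w2; have b2 := mulb _ _ _ _ k2 v2.
have b3 : n1 (p * (U w t).2) <= (G * T * e + K * T) * e by apply: mulb.
have E1 : (G * T * e + K * T) * e = G * T * (e * e) + K * T * e by ring.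
have E2 : (4 * G * T + 2 * K * T) * e = 4 * (G * T * e) + 2 * (K * T * e) by ring.
lra.
Qed.

End NearRealAxis.

(** * Second order expansion of the trace, and Taylor towers of the monodromy entries *)

Section Trace.
Variables (R : realType) (T : R) (q : R -> R[i]).
Hypothesis T0 : 0 < T.
Hypothesis cq : cing T q.
Implicit Types (z w : R[i]) (X Y : R -> R[i] * R[i]) (x : R).
Variables U V : R[i] -> R -> R[i] * R[i].
Hypothesis solU : forall z, sol T q z (U z).
Hypothesis solV : forall z, sol T q z (V z).
Hypothesis U0 : forall z, U z 0 = (1, 0).
Hypothesis V0 : forall z, V z 0 = (0, 1).

Let TT : 0 <= T <= T. Proof. by rewrite lexx ltW. Qed.

Definition trM z := (U z T).1 + (V z T).2.
(** In [trM_expansion], [tau w] is the derivative of the trace at w and [rho w z] its divided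
    difference at w, w, z. *)
Definition tau w := (Sop U V w (U w) T).1 + (Sop U V w (V w) T).2.
Definition rho w z := (Sop U V w (Sop U V w (U z)) T).1 + (Sop U V w (Sop U V w (V z)) T).2.

Lemma iterU z w n t : 0 <= t <= T -> iter n (Sop U V w) (U z) t =
    ((iter n (Sop U V w) (U w) t).1 + (z - w) * (iter n.+1 (Sop U V w) (U z) t).1,
     (iter n (Sop U V w) (U w) t).2 + (z - w) * (iter n.+1 (Sop U V w) (U z) t).2).
Proof.
move=> tT; apply: (iter_Sop_step T0 solU solV) tT; [exact: (sol_ccp T0 (solU w))|exact: solU|].
by move=> s sT; have [] := sol_expansion T0 solU solV U0 V0 z w sT.
Qed.
Lemma iterV z w n t : 0 <= t <= T -> iter n (Sop U V w) (V z) t =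
    ((iter n (Sop U V w) (V w) t).1 + (z - w) * (iter n.+1 (Sop U V w) (V z) t).1,
     (iter n (Sop U V w) (V w) t).2 + (z - w) * (iter n.+1 (Sop U V w) (V z) t).2).
Proof.
move=> tT; apply: (iter_Sop_step T0 solU solV) tT; [exact: (sol_ccp T0 (solV w))|exact: solV|].
by move=> s sT; have [] := sol_expansion T0 solU solV U0 V0 z w sT.
Qed.

Lemma trM_expansion z w : trM z = trM w + (z - w) * tau w + (z - w) ^+ 2 * rho w z.
Proof.
rewrite /trM /tau /rho.
have a0 : (U z T).1 = (U w T).1 + (z - w) * (Sop U V w (U z) T).1.
  by have := congr1 fst (iterU z w 0 TT).
have b0 : (V z T).2 = (V w T).2 + (z - w) * (Sop U V w (V z) T).2.
  by have := congr1 snd (iterV z w 0 TT).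
have a1 : (Sop U V w (U z) T).1 =
    (Sop U V w (U w) T).1 + (z - w) * (Sop U V w (Sop U V w (U z)) T).1.
  by have := congr1 fst (iterU z w 1 TT).
have b1 : (Sop U V w (V z) T).2 =
    (Sop U V w (V w) T).2 + (z - w) * (Sop U V w (Sop U V w (V z)) T).2.
  by have := congr1 snd (iterV z w 1 TT).
have alg (ut vt uw vw su sv su' sv' ru rv d : R[i]) :
    ut = uw + d * su -> vt = vw + d * sv -> su = su' + d * ru -> sv = sv' + d * rv ->
    ut + vt = uw + vw + d * (su' + sv') + d ^+ 2 * (ru + rv).
  by move=> -> -> -> ->; ring.
exact: (alg _ _ _ _ _ _ _ _ _ _ _ a0 b0 a1 b1).
Qed.

Lemma close_mono x e e' z : e <= e' -> close T U V x e z -> close T U V x e' z.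
Proof.
by move=> ee' H t tT; have [a b c d] := H t tT; split; apply: le_trans ee'.
Qed.

Lemma CI_lin (c : R[i]) : CI (fun s => c * s%:C) T = c * (T ^+ 2 / 2)%:C.
Proof.
have d (x : R) : is_derive x 1 (fun s : R => s ^+ 2 / 2) x.
  by apply: is_derive_eq; rewrite /GRing.scale /=; field.
have JE : J (fun s => s) T = T ^+ 2 / 2.
  by rewrite (J_FTC d) ?ltW// ?expr0n ?mul0r ?subr0// => x; exact: cvg_id.
have cs : cing T (fun s : R => s%:C).
  split; first by apply: ing_within; apply: continuous_subspaceT => x; exact: cvg_id.
  exact: ing_cst.
rewrite (CI_Z _ TT cs) CIE /= JE; congr (_ * (_ +i* _)).
by rewrite J_cst ?ltW// mul0r.
Qed.

Lemma CI_cst (c : R[i]) t : 0 <= t <= T -> CI (fun=> c) t = c * t%:C.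
Proof.
move=> /andP[t0 _]; rewrite CIE !J_cst//.
by apply: complex_eqP; rewrite ?cReM ?cImM /= ?mulr0 ?subr0 ?add0r.
Qed.

Lemma rho_tau_asymptotics : exists C e0, [/\ 0 <= C, 0 < e0 & forall x e w z,
  0 <= e -> e <= e0 -> close T U V x e w -> close T U V x e z ->
  n1 (rho w z + (T ^+ 2 / 8)%:C * (fe x%:C T + fei x%:C T)) <= C * e /\
  n1 (tau w - 2^-1 * 'i%C * T%:C * (fe x%:C T - fei x%:C T)) <= C * e].
Proof.
have K1 : 1 <= 1 + T by rewrite lerDl ltW.
have [D D0 HD] := Sop_step T0 solU solV K1.
have D1 : 0 < 1 + D by rewrite ltr_pwDl.
(* The second application of [Sop_step] has accuracy (1 + D) e, which must be at most 1; this is the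
   condition on e. The factor 2 in C counts the two diagonal entries. *)
exists (2 * D * (1 + D)), (1 + D)^-1; split.
- by rewrite !mulr_ge0// ltW.
- by rewrite invr_gt0.
move=> x e w z e0 ee cw cz.
have e1 : e <= 1 by apply: (le_trans ee); rewrite invf_le1// lerDl.
have De1 : (1 + D) * e <= 1 by rewrite mulrC -ler_pdivlMr// mul1r.
have De0 : 0 <= (1 + D) * e by rewrite mulr_ge0// ltW.
have eDe : e <= (1 + D) * e by rewrite mulrDl mul1r lerDl mulr_ge0.
have DeD : D * e <= (1 + D) * e by rewrite ler_wpM2r// lerDr.
have cw' := close_mono eDe cw.
have c0 := cing_cc (cc_cst T (0 : R[i])); have c1 := cing_cc (cc_cst T (1 : R[i])).
pose h : R[i] := 2^-1 * 'i%C.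
have cl c : cing T (fun s => c * s%:C).
  apply: cingZ; split; first by apply: ing_within; apply: continuous_subspaceT => y; exact: cvg_id.
  exact: ing_cst.
have n1K (s : R) : 0 <= s <= T -> n1 (h * s%:C) <= 1 + T.
  move=> /andP[s0 sT]; apply: (le_trans (n1M _ _)); rewrite n1_half_i n1_real ger0_norm//; lra.
have b01 : n1 (0 : R[i]) <= 1 + T by rewrite n10; lra.
have b11 : n1 (1 : R[i]) <= 1 + T by rewrite n1_1.
have stepU v : close T U V x e v -> forall t, 0 <= t <= T ->
   n1 ((Sop U V w (U v) t).1 - h * t%:C * fe x%:C t) <= D * e /\
   n1 ((Sop U V w (U v) t).2 - 0 * fei x%:C t) <= D * e.
  move=> cv t tT.
  have := HD x w (U v) (fun=> 1) (fun=> 0) e e0 e1 cw (sol_ccp T0 (solU v)) c1 c0.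
  move=> /(_ (fun _ _ => conj b11 b01)) H.
  have [|] := H _ t tT.
    by move=> s sT; have [a b _ _] := cv s sT; rewrite mul1r mul0r subr0.
  by rewrite !(CI_cst _ tT) mul1r mul0r oppr0 mulr0.
have stepV v : close T U V x e v -> forall t, 0 <= t <= T ->
   n1 ((Sop U V w (V v) t).1 - 0 * fe x%:C t) <= D * e /\
   n1 ((Sop U V w (V v) t).2 - - h * t%:C * fei x%:C t) <= D * e.
  move=> cv t tT.
  have := HD x w (V v) (fun=> 0) (fun=> 1) e e0 e1 cw (sol_ccp T0 (solV v)) c0 c1.
  move=> /(_ (fun _ _ => conj b01 b11)) H.
  have [|] := H _ t tT.
    by move=> s sT; have [_ _ a b] := cv s sT; rewrite mul1r mul0r subr0.
  have -> : 2^-1 * 'i%C * CI (fun=> 0) t = 0 :> R[i] by rewrite (CI_cst _ tT) mul0r mulr0.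
  have -> // : 2^-1 * 'i%C * - CI (fun=> 1) t = - h * t%:C.
  by rewrite (CI_cst _ tT) mul1r mulrN -mulNr.
have [p1 _] := stepU _ cw T TT; have [_ p2] := stepV _ cw T TT.
have E C1 C2 : C1 <= C2 -> C1 * e <= C2 * e by move=> ?; rewrite ler_wpM2r.
have DDD : D <= D * (1 + D) by rewrite mulrDr mulr1 lerDl mulr_ge0.
have M2 : 2 * D * (1 + D) * e = D * ((1 + D) * e) + D * ((1 + D) * e) by ring.
split; last first.
  have -> : tau w - 2^-1 * 'i%C * T%:C * (fe x%:C T - fei x%:C T) =
    ((Sop U V w (U w) T).1 - h * T%:C * fe x%:C T) +
    ((Sop U V w (V w) T).2 - - h * T%:C * fei x%:C T) by rewrite /tau /h; ring.
  apply: (le_trans (n1D _ _)); rewrite M2; apply: lerD; rewrite mulrA.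
    by apply: (le_trans p1); exact: E.
  by apply: (le_trans p2); exact: E.
have cSU := Sop_ccp T0 solU solV w (sol_ccp T0 (solU z)).
have cSV := Sop_ccp T0 solU solV w (sol_ccp T0 (solV z)).
have [||q1 _] := HD x w _ (fun s => h * s%:C) (fun=> 0) _ De0 De1 cw' cSU (cl h) c0 _ _ T TT.
- by move=> s sT; split=> //; exact: n1K.
- move=> s sT; have [a b] := stepU z cz s sT.
  by split; [apply: le_trans DeD; exact: a|apply: le_trans DeD; exact: b].
have [||_ q2] := HD x w _ (fun=> 0) (fun s => - h * s%:C) _ De0 De1 cw' cSV c0 (cl (- h)) _ _ T TT.
- by move=> s sT; split=> //; rewrite mulNr n1N; exact: n1K.
- move=> s sT; have [a b] := stepV z cz s sT.
  by split; [apply: le_trans DeD; exact: a|apply: le_trans DeD; exact: b].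
rewrite !CI_lin in q1 q2.
have hh : h * h = - 4^-1.
  rewrite /h; have -> : 2^-1 * 'i%C * (2^-1 * 'i%C) = 2^-1 * 2^-1 * ('i%C ^+ 2) :> R[i] by ring.
  by rewrite sqr_i; field.
have T8 : (T ^+ 2 / 8)%:C = 4^-1 * (T ^+ 2 / 2)%:C :> R[i].
  rewrite (invnE R 4) -rmorphM; congr (_%:C); by field.
have -> : rho w z + (T ^+ 2 / 8)%:C * (fe x%:C T + fei x%:C T) =
   ((Sop U V w (Sop U V w (U z)) T).1 - h * (h * (T ^+ 2 / 2)%:C) * fe x%:C T) +
   ((Sop U V w (Sop U V w (V z)) T).2 - h * (- (- h * (T ^+ 2 / 2)%:C)) * fei x%:C T).
  rewrite /rho T8.
  have -> : h * (- (- h * (T ^+ 2 / 2)%:C)) = (h * h) * (T ^+ 2 / 2)%:C by ring.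
  rewrite [h * (h * _)]mulrA hh.
  move: (Sop U V w (Sop U V w (U z)) T) (Sop U V w (Sop U V w (V z)) T) => p p'.
  by ring.
by apply: (le_trans (n1D _ _)); rewrite M2; exact: lerD.
Qed.

(* S n is the n-th divided difference of f at w, ..., w, z; its decay replaces Cauchy estimates. *)
Definition tower_at (f : R[i] -> R[i]) w (S : nat -> R[i] -> R[i]) :=
  [/\ forall z, S 0%N z = f z, forall n z, S n z = S n w + (z - w) * S n.+1 z &
    forall r : R, 0 < r -> exists2 K : R, 0 <= K & forall n z, nc (z - w) <= r ->
      n1 (S n z) * (2 * r) ^+ n <= K].
Definition tower (f : R[i] -> R[i]) := forall w, exists S, tower_at f w S.

Lemma iter_bound w r : 0 < r -> exists2 K : R, 0 <= K & forall n z, nc (z - w) <= r ->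
  n2 (iter n (Sop U V w) (U z) T) * (2 * r) ^+ n <= K /\
  n2 (iter n (Sop U V w) (V z) T) * (2 * r) ^+ n <= K.
Proof.
move=> r0.
pose W := 2 * expR (`|cIm w| * T); have HW := rows_bounded_energy T0 solU solV U0 V0 w.
(* With this weight the factor 2 W^2 / k of [iter_Sop_bound] equals 1 / (2 r). W depends on w only;
   the solutions at z that are iterated are bounded through |Im z| <= B. *)
pose k := 2 * W ^+ 2 * (2 * r).
have W0 : 0 < W by rewrite mulr_gt0// expR_gt0.
have W2 : 0 < W ^+ 2 by rewrite exprn_gt0.
have k0 : 0 < k by rewrite /k; apply: mulr_gt0; apply: mulr_gt0.
pose B := `|cIm w| + r.
pose K := 2 * (2 * expR (B * T)).
have K0 : 0 <= K by rewrite !mulr_ge0// expR_ge0.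
exists (K * expR (k * T)); first by rewrite mulr_ge0// expR_ge0.
move=> n z zw.
have zB : `|cIm z| <= B.
  have -> : cIm z = cIm w + cIm (z - w) by rewrite cImD cImN; ring.
  by apply: (le_trans (ler_normD _ _)); rewrite lerD2l (le_trans (normIm_le_nc _)).
have Wz := rows_bounded_energy T0 solU solV U0 V0 z.
have hB : 2 * expR (`|cIm z| * T) <= 2 * expR (B * T).
  by rewrite ler_pM2l// ler_expR ler_pM2r.
have L X : ccp T X -> (forall s, 0 <= s <= T -> n2 (X s) <= K) ->
    n2 (iter n (Sop U V w) X T) * (2 * r) ^+ n <= K * expR (k * T).
  move=> cX XK.
  have := iter_Sop_bound T0 solU solV n HW cX k0 K0 XK TT.
  have -> : 2 * W ^+ 2 / k = (2 * r)^-1.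
    by rewrite /k; field; rewrite !lt0r_neq0.
  have r2 : 0 < (2 * r) ^+ n by rewrite exprn_gt0// mulr_gt0.
  rewrite exprVn => h; rewrite -ler_pdivlMr//; apply: (le_trans h).
  by rewrite mulrAC.
split; apply: L.
- exact: (sol_ccp T0 (solU z)).
- by move=> s sT; have [a b _ _] := Wz s sT; rewrite /n2 /K; lra.
- exact: (sol_ccp T0 (solV z)).
- by move=> s sT; have [_ _ a b] := Wz s sT; rewrite /n2 /K; lra.
Qed.

Lemma n1_fst_le (p : R[i] * R[i]) : n1 p.1 <= n2 p.
Proof. by rewrite lerDl n1_ge0. Qed.
Lemma n1_snd_le (p : R[i] * R[i]) : n1 p.2 <= n2 p.
Proof. by rewrite lerDr n1_ge0. Qed.

Lemma tower_at_U1 w :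
  tower_at (fun z => (U z T).1) w (fun n z => (iter n (Sop U V w) (U z) T).1).
Proof.
split=> //.
  by move=> n z; rewrite (iterU z w n TT).
move=> r r0; have [K K0 HK] := iter_bound w r0; exists K => // n z zw.
have [h _] := HK n z zw; apply: le_trans h.
by rewrite ler_wpM2r ?n1_fst_le// exprn_ge0// mulr_ge0// ltW.
Qed.
Lemma tower_at_U2 w :
  tower_at (fun z => (U z T).2) w (fun n z => (iter n (Sop U V w) (U z) T).2).
Proof.
split=> //.
  by move=> n z; rewrite (iterU z w n TT).
move=> r r0; have [K K0 HK] := iter_bound w r0; exists K => // n z zw.
have [h _] := HK n z zw; apply: le_trans h.
by rewrite ler_wpM2r ?n1_snd_le// exprn_ge0// mulr_ge0// ltW.
Qed.
Lemma tower_at_V1 w :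
  tower_at (fun z => (V z T).1) w (fun n z => (iter n (Sop U V w) (V z) T).1).
Proof.
split=> //.
  by move=> n z; rewrite (iterV z w n TT).
move=> r r0; have [K K0 HK] := iter_bound w r0; exists K => // n z zw.
have [_ h] := HK n z zw; apply: le_trans h.
by rewrite ler_wpM2r ?n1_fst_le// exprn_ge0// mulr_ge0// ltW.
Qed.
Lemma tower_at_V2 w :
  tower_at (fun z => (V z T).2) w (fun n z => (iter n (Sop U V w) (V z) T).2).
Proof.
split=> //.
  by move=> n z; rewrite (iterV z w n TT).
move=> r r0; have [K K0 HK] := iter_bound w r0; exists K => // n z zw.
have [_ h] := HK n z zw; apply: le_trans h.
by rewrite ler_wpM2r ?n1_snd_le// exprn_ge0// mulr_ge0// ltW.
Qed.

Lemma tower_U1 : tower (fun z => (U z T).1).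
Proof. by move=> w; exists (fun n z => (iter n (Sop U V w) (U z) T).1); exact: tower_at_U1. Qed.
Lemma tower_U2 : tower (fun z => (U z T).2).
Proof. by move=> w; exists (fun n z => (iter n (Sop U V w) (U z) T).2); exact: tower_at_U2. Qed.
Lemma tower_V1 : tower (fun z => (V z T).1).
Proof. by move=> w; exists (fun n z => (iter n (Sop U V w) (V z) T).1); exact: tower_at_V1. Qed.
Lemma tower_V2 : tower (fun z => (V z T).2).
Proof. by move=> w; exists (fun n z => (iter n (Sop U V w) (V z) T).2); exact: tower_at_V2. Qed.

End Trace.

(** * Entire functions *)
Section ComplexFunctions.
Variable R : realType.
Implicit Types (f g h : R[i] -> R[i]) (z w : R[i]).

(** Continuity with real radii; balls in the topology of [R[i]^o] have radii in [R[i]]. *)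
Definition ccont f w := forall e : R, 0 < e -> exists2 d : R, 0 < d &
  forall z, nc (z - w) < d -> nc (f z - f w) < e.

Notation der f w := (derivable (f : R[i]^o -> R[i]^o) w 1).

Lemma gt0_complex_real (e : R[i]) : 0 < e -> exists2 r : R, 0 < r & e = r%:C.
Proof.
rewrite ltcE /= => /andP[/eqP ie re]; exists (cRe e) => //.
exact: complex_eqP.
Qed.

Lemma nbhs_ncP w (P : R[i] -> Prop) :
  nbhs (w : R[i]^o) P <->
  exists2 d : R, 0 < d & forall z, nc (z - w) < d -> P z.
Proof.
split=> [/nbhs_ballP[e /= e0 He]|[d d0 Hd]].
  have [r r0 er] := gt0_complex_real e0; exists r => // z zw; apply: He.
  by rewrite /ball /= er -nc_norm ltcR nc_distrC.
apply/nbhs_ballP; exists d%:C => /=; first by rewrite ltcR.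
by move=> z; rewrite /ball /= -nc_norm ltcR nc_distrC; exact: Hd.
Qed.

Lemma ccontP f w : ccont f w <-> {for w, continuous (f : R[i]^o -> R[i]^o)}.
Proof.
split=> [H|/cvgrPdist_lt H].
  apply/(@cvgrPdist_lt _ (R[i]^o) _ _ (nbhs_filter (w : R[i]^o))) => e e0.
  have [r r0 ->] := gt0_complex_real e0; have [d d0 Hd] := H r r0.
  suff H' : nbhs (w : R[i]^o) (fun z => `|f w - f z| < r%:C) by exact: H'.
  apply/nbhs_ncP; exists d => // z zw.
  by rewrite -nc_norm ltcR nc_distrC; exact: Hd.
move=> e e0; have ec : 0 < e%:C by rewrite ltcR.
have /nbhs_ncP[d d0 Hd] := H _ ec; exists d => // z /Hd.
by rewrite -nc_norm ltcR nc_distrC.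
Qed.

Lemma der_ccont f w : der f w -> ccont f w.
Proof. by move=> /derivable1_diffP/differentiable_continuous/ccontP. Qed.

Lemma entire_ccont f w : entire f -> ccont f w.
Proof. by move=> ef; exact/der_ccont/ef. Qed.

Lemma caratheodory_der f g w : (forall z, f z = f w + (z - w) * g z) -> ccont g w -> der f w.
Proof.
move=> fE gw; apply/cvg_ex; exists (g w); apply/cvgrPdist_lt => e e0.
have [r r0 ->] := gt0_complex_real e0; have [d d0 Hd] := gw r r0.
have : \forall h \near (0 : R[i]^o), h != 0 ->
    `|g w - h^-1 *: (((f : R[i]^o -> R[i]^o) \o shift w) (h *: 1) - f w)| < r%:C.
  apply/nbhs_ncP; exists d => // h; rewrite subr0 => hd h0.
  have -> : h^-1 *: (((f : R[i]^o -> R[i]^o) \o shift w) (h *: 1) - f w) = g (h + w).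
    rewrite /= /GRing.scale /= mulr1 fE addrK [f w + _]addrC addrK mulrA mulVf//.
    by rewrite mul1r.
  by rewrite -nc_norm ltcR nc_distrC; apply: Hd; rewrite addrK.
by move=> H; rewrite near_withinE; near=> h => h0; move: h0; near: h.
Unshelve. all: by end_near.
Qed.

Lemma der_near f g w (d : R) : 0 < d -> (forall z, nc (z - w) < d -> f z = g z) ->
  der f w -> der g w.
Proof.
move=> d0 fg; apply: near_eq_derivable.
by apply/nbhs_ncP; exists d.
Qed.

Lemma derD f g w : der f w -> der g w -> der (fun z => f z + g z) w.
Proof. exact: derivableD. Qed.
Lemma derM f g w : der f w -> der g w -> der (fun z => f z * g z) w.
Proof. exact: derivableM. Qed.
Lemma derV f w : f w != 0 -> der f w -> der (fun z => (f z)^-1) w.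
Proof. exact: derivableV. Qed.
Lemma der_cst c w : der (fun=> c) w.
Proof. exact: derivable_cst. Qed.
Lemma der_id w : der (fun z => z) w.
Proof. exact: derivable_id. Qed.
Lemma derX f w n : der f w -> der (fun z => f z ^+ n) w.
Proof.
move=> df; elim: n => [|n IH]; first exact: der_cst.
have -> : (fun z => f z ^+ n.+1) = (fun z => f z * f z ^+ n).
  by apply/funext => z; rewrite exprS.
exact: derM.
Qed.
Lemma der_sub w z : der (fun z => z - w) z.
Proof. by apply: derD; [exact: der_id|exact: der_cst]. Qed.

Lemma entireD f g : entire f -> entire g -> entire (fun z => f z + g z).
Proof. by move=> ef eg w; apply: derD; [exact: ef|exact: eg]. Qed.
Lemma entireM f g : entire f -> entire g -> entire (fun z => f z * g z).
Proof. by move=> ef eg w; apply: derM; [exact: ef|exact: eg]. Qed.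
Lemma entire_cst c : entire (fun=> c : R[i]).
Proof. by move=> w; exact: der_cst. Qed.
Lemma entire_sub w : entire (fun z => z - w).
Proof. by move=> z; exact: der_sub. Qed.
Lemma entireX f n : entire f -> entire (fun z => f z ^+ n).
Proof. by move=> ef w; apply: derX; exact: ef. Qed.

Lemma ccontD f g w : ccont f w -> ccont g w -> ccont (fun z => f z + g z) w.
Proof.
by move=> /ccontP cf /ccontP cg; apply/ccontP; exact: (continuousD cf cg).
Qed.
Lemma ccontM f g w : ccont f w -> ccont g w -> ccont (fun z => f z * g z) w.
Proof.
by move=> /ccontP cf /ccontP cg; apply/ccontP; exact: (continuousM cf cg).
Qed.

Lemma ccont_neq0 f w : ccont f w -> f w != 0 ->
  exists2 d : R, 0 < d & forall z, nc (z - w) < d -> f z != 0.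
Proof.
move=> cf fw; have [d d0 Hd] := cf _ (nc_gt0 fw); exists d => // z /Hd h.
by apply: contraTneq h => ->; rewrite sub0r ncN ltxx.
Qed.

(** Used whenever a power of z - w is cancelled from an identity: the cancellation is valid off w,
    and continuity restores the value at w. *)
Lemma ccont_eq f g w (d : R) : ccont f w -> ccont g w -> 0 < d ->
  (forall z, z != w -> nc (z - w) < d -> f z = g z) -> f w = g w.
Proof.
move=> cf cg d0 H; apply/eqP; rewrite -subr_eq0; apply/negP => /negP fg.
have e0 : 0 < nc (f w - g w) / 2 by rewrite divr_gt0// nc_gt0.
have [d1 d10 H1] := cf _ e0; have [d2 d20 H2] := cg _ e0.
pose m : R := Num.min d (Num.min d1 d2).
have m0 : 0 < m by rewrite !lt_min d0 d10.
have m20 : 0 < m / 2 by rewrite divr_gt0.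
pose z := w + (m / 2)%:C.
have zw : nc (z - w) = m / 2 by rewrite /z addrAC subrr add0r nc_real ger0_norm// ltW.
have zm : nc (z - w) < m by rewrite zw ltr_pdivrMr// ltr_pMr// ltr1n.
have zneq : z != w by rewrite -subr_eq0 -nc_eq0 zw gt_eqF.
move: (zm); rewrite !lt_min => /and3P[l0 l1 l2].
have h1 := H1 z l1; have h2 := H2 z l2; have h3 := H z zneq l0.
have : nc (f w - g w) <= nc (f z - f w) + nc (g z - g w).
  have -> : f w - g w = - (f z - f w) + (g z - g w) by rewrite h3; ring.
  by rewrite -(ncN (f z - f w)); exact: ncD.
lra.
Qed.

(** * Orders of zeros and the identity theorem for functions with towers *)

Section Tower.
Variables (f : R[i] -> R[i]) (w : R[i]) (S : nat -> R[i] -> R[i]).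
Hypothesis fS : tower_at f w S.

Let S0 z : S 0%N z = f z. Proof. by have [? ? ?] := fS; auto. Qed.
Let SE n z : S n z = S n w + (z - w) * S n.+1 z. Proof. by have [? ? ?] := fS; auto. Qed.
Let SB (r : R) : 0 < r -> exists2 K : R, 0 <= K & forall n z, nc (z - w) <= r ->
  n1 (S n z) * (2 * r) ^+ n <= K.
Proof. by have [? ? ?] := fS; auto. Qed.

Lemma tower_ccont n : ccont (S n) w.
Proof.
move=> e e0; have [K K0 HK] := SB ltr01.
pose d := Num.min 1 (e / (1 + K)).
have K1 : 0 < 1 + K by rewrite ltr_pwDl.
exists d; first by rewrite lt_min ltr01 divr_gt0.
move=> z; rewrite lt_min => /andP[z1 ze].
rewrite SE addrAC subrr add0r Normc.normcM.
have h : nc (S n.+1 z) <= K.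
  apply: (le_trans (nc_le_n1 _)); apply: le_trans (HK n.+1 z (ltW z1)).
  by rewrite ler_peMr ?n1_ge0// exprn_ege1// mulr1 ler1n.
apply: (@le_lt_trans _ _ (nc (z - w) * (1 + K))).
  by rewrite ler_wpM2l ?nc_ge0// (le_trans h)// lerDr.
by rewrite -ltr_pdivlMr.
Qed.

(** The only continuous quotient of f by (z - w)^n is [S n]. In the induction step [S n w] is the
    value at w of (z - w) g, hence 0, and the recursion yields one more factor z - w. *)
Lemma tower_factor n g : (forall z, f z = (z - w) ^+ n * g z) -> ccont g w ->
  (forall z, f z = (z - w) ^+ n * S n z) /\ g w = S n w.
Proof.
elim: n g => [|n IH] g fE cg.
  have fg z : f z = g z by rewrite fE expr0 mul1r.
  by split=> [z|]; rewrite S0 ?expr0 ?mul1r// fg.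
have cg' : ccont (fun z => (z - w) * g z) w by apply: ccontM => //; exact/entire_ccont/entire_sub.
have [|h1 h2] := IH _ _ cg'; first by move=> z; rewrite fE exprSr mulrA.
have Sw : S n w = 0 by rewrite -h2 subrr mul0r.
have E z : f z = (z - w) ^+ n.+1 * S n.+1 z by rewrite h1 SE Sw add0r mulrA -exprSr.
split=> //; apply: (ccont_eq cg (tower_ccont _) ltr01) => z zw _.
have zw0 : (z - w) ^+ n.+1 != 0 by rewrite expf_neq0// subr_eq0.
by apply: (mulfI zw0); rewrite -fE E.
Qed.

Lemma tower_der_at n : der (S n) w.
Proof. by apply: (caratheodory_der (SE n)); exact: tower_ccont. Qed.

(** Off w, [S n.+1] is the difference quotient of [S n]; at w it is differentiable by the next step
    of the tower. *)
Lemma tower_entire n : entire f -> entire (S n).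
Proof.
move=> ef; elim: n => [|n IH] z.
  by have -> : S 0%N = f by apply/funext.
have [->|zw] := eqVneq z w; first exact: tower_der_at.
have d0 : 0 < nc (z - w) by apply: nc_gt0; rewrite subr_eq0.
have zw0 : z - w != 0 by rewrite subr_eq0.
apply: (@der_near (fun y => (S n y + - S n w) * (y - w)^-1) _ _ _ d0); last first.
  apply: derM; first by apply: derD; [exact: IH|exact: der_cst].
  by apply: derV => //; exact: der_sub.
move=> y yz; have yw : y - w != 0.
  by apply: contraTneq yz => /eqP; rewrite subr_eq0 => /eqP ->; rewrite nc_distrC ltxx.
by rewrite [S n y]SE addrAC subrr add0r mulrAC mulfV// mul1r.
Qed.

(** The identity theorem in a single step from w to z: f z = (z - w)^n S n z for all n, and the
    factor 2 in (2 r)^n leaves a bound of order 2^-n. *)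
Lemma tower_zero : (forall n, S n w = 0) -> forall z, f z = 0.
Proof.
move=> S00 z; apply: n1_eq0; apply/eqP; rewrite eq_le n1_ge0 andbT.
apply/ler_addgt0Pr => e e0; rewrite add0r.
pose r := nc (z - w) + 1.
have r0 : 0 < r by rewrite ltr_wpDl ?nc_ge0.
have [K K0 HK] := SB r0.
have fE n : f z = (z - w) ^+ n * S n z.
  elim: n => [|n IH]; first by rewrite expr0 mul1r S0.
  by rewrite IH SE S00 add0r mulrA -exprSr.
have [n Hn] : exists n : nat, 2 * K / e <= 2 ^+ n.
  exists (Num.Def.archi_bound (2 * K / e)).
  have h : 0 <= 2 * K / e by rewrite divr_ge0 ?mulr_ge0// ltW.
  apply: (le_trans (ltW (Num.Theory.archi_boundP h))).
  by rewrite -natrX ler_nat; apply: ltnW; exact: ltn_expl.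
have zr : nc (z - w) <= r by rewrite lerDl.
have := HK n z zr; rewrite exprMn => B.
have r2 : 0 < r ^+ n by rewrite exprn_gt0.
apply: (le_trans (n1_le_nc _)); rewrite (fE n) Normc.normcM ncX.
have h1 : nc (z - w) ^+ n * nc (S n z) <= r ^+ n * n1 (S n z).
  by apply: ler_pM; rewrite ?exprn_ge0 ?nc_ge0 ?nc_le_n1// lerXn2r// nnegrE ?nc_ge0// ltW.
have t0 : 0 < (2 : R) ^+ n by rewrite exprn_gt0.
have h2 : r ^+ n * n1 (S n z) <= K / 2 ^+ n.
  rewrite ler_pdivlMr//.
  by have -> : r ^+ n * n1 (S n z) * 2 ^+ n = n1 (S n z) * (2 ^+ n * r ^+ n) by ring.
have h3 : K / 2 ^+ n <= e / 2.
  rewrite ler_pdivrMr//; move: Hn; rewrite ler_pdivrMr// => Hn.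
  have -> : e / 2 * 2 ^+ n = (2 ^+ n * e) / 2 by ring.
  by rewrite ler_pdivlMr// mulrC.
lra.
Qed.

End Tower.

Lemma tower_is_entire f : tower f -> entire f.
Proof.
move=> tf w; have [S fS] := tf w; have [S0 SE _] := fS.
have -> : f = S 0%N by apply/funext => z; rewrite S0.
exact: (tower_der_at fS (n := 0%N)).
Qed.

Lemma tower_vanish f w n g : tower f -> (forall z, f z = (z - w) ^+ n * g z) ->
  entire g -> g w = 0 ->
  exists2 h, entire h & forall z, f z = (z - w) ^+ n.+1 * h z.
Proof.
move=> tf fE eg gw; have [S fS] := tf w; have [S0 SE _] := fS.
have [h1 h2] := tower_factor fS fE (entire_ccont w eg).
exists (S n.+1); first exact/(tower_entire fS)/tower_is_entire.
by move=> z; rewrite h1 SE -h2 gw add0r mulrA -exprSr.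
Qed.

(** The multiplicity is the least n with [S n w != 0], which exists by [tower_zero]. *)
Lemma tower_multiplicity f w z0 : tower f -> f z0 != 0 -> exists n, zero_multiplicity f w n.
Proof.
move=> tf fz0; have [S fS] := tf w; have [S0 SE _] := fS.
have [n Sn] : exists n, S n w != 0.
  apply: contrapT => /forallNP H; move/negP: fz0; apply; apply/eqP.
  by apply: (tower_zero fS) => n; have := H n; move/negP; rewrite negbK => /eqP.
have [m Sm mP] := ex_minnP (ex_intro (fun n => S n w != 0) n Sn).
exists m, (S m); split=> //; first exact/(tower_entire fS)/tower_is_entire.
have L k : (k <= m)%N -> forall z, f z = (z - w) ^+ k * S k z.
  elim: k => [_ z|k IH km z]; first by rewrite expr0 mul1r S0.
  have Sk : S k w = 0.
    by apply/eqP; apply: contraTT km => /mP; rewrite -leqNgt.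
  by rewrite (IH (ltnW km)) SE Sk add0r mulrA -exprSr.
exact: L.
Qed.

Lemma tower_add f g : tower f -> tower g -> tower (fun z => f z + g z).
Proof.
move=> tf tg w; have [S [S0 SE SB]] := tf w; have [S' [S0' SE' SB']] := tg w.
exists (fun n z => S n z + S' n z); split=> [z|n z|r r0].
- by rewrite S0 S0'.
- by rewrite [S n z]SE [S' n z]SE'; ring.
have [K K0 HK] := SB r r0; have [K' K0' HK'] := SB' r r0.
exists (K + K'); first exact: addr_ge0.
move=> n z zw; apply: le_trans (lerD (HK n z zw) (HK' n z zw)).
rewrite -mulrDl ler_wpM2r ?n1D//; apply: exprn_ge0; lra.
Qed.

Lemma tower_cst (c : R[i]) : tower (fun=> c).
Proof.
move=> w; exists (fun n _ => if n is 0%N then c else 0); split=> // [n z|r r0].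
  by rewrite mulr0 addr0.
exists (n1 c); first exact: n1_ge0.
by move=> [|n] z _; rewrite ?expr0 ?mulr1// n10 mul0r n1_ge0.
Qed.

Lemma zero_multiplicity_isolated f w n : zero_multiplicity f w n ->
  exists2 d : R, 0 < d & forall z, z != w -> nc (z - w) < d -> f z != 0.
Proof.
move=> [g [eg gw fE]]; have [d d0 Hd] := ccont_neq0 (entire_ccont w eg) gw.
exists d => // z zw /Hd gz; rewrite fE mulf_neq0// expf_neq0// subr_eq0//.
Qed.

(** No tower is available for h, so its order at w is not read off from an expansion. The quotient
    is glued from h / (z - w)^j off w and v / B near w. *)
Lemma local_quotient h B v w j : entire h -> entire B -> entire v -> B w != 0 ->
  (forall z, h z * B z = (z - w) ^+ j * v z) ->
  exists2 h1, entire h1 & forall z, h z = (z - w) ^+ j * h1 z.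
Proof.
move=> eh eB ev Bw E.
pose h1 z := if z == w then v w / B w else h z / (z - w) ^+ j.
have h1E z : z != w -> h1 z = h z / (z - w) ^+ j by rewrite /h1 => /negbTE ->.
have hE z : h z = (z - w) ^+ j * h1 z.
  have [->|zw] := eqVneq z w; last first.
    by rewrite h1E// mulrC mulfVK// expf_neq0// subr_eq0.
  rewrite /h1 eqxx; have := E w; rewrite subrr => Ew.
  by apply: (mulIf Bw); rewrite Ew mulrA mulfVK.
exists h1; last exact: hE.
move=> z; have [->|zw] := eqVneq z w; last first.
  have zw0 : z - w != 0 by rewrite subr_eq0.
  apply: (@der_near (fun y => h y * ((y - w) ^+ j)^-1) _ _ _ (nc_gt0 zw0)).
    move=> y yz; rewrite h1E//; apply: contraTneq yz => ->.
    by rewrite nc_distrC ltxx.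
  apply: derM; first exact: eh.
  by apply: derV; [rewrite expf_neq0|apply: derX; exact: der_sub].
have [d d0 Hd] := ccont_neq0 (entire_ccont w eB) Bw.
apply: (@der_near (fun y => v y * (B y)^-1) _ _ _ d0).
  move=> y yw; have By := Hd y yw; rewrite /h1.
  have [->//|ynw] := eqVneq y w.
  have yw0 : (y - w) ^+ j != 0 by rewrite expf_neq0// subr_eq0.
  apply: (mulIf By); rewrite mulfVK//; apply: (mulfI yw0).
  by rewrite -E mulrCA mulrA mulfVK// mulrC.
by apply: derM; [exact: ev|apply: derV; [exact: Bw|exact: eB]].
Qed.

(** The values b1 w / hp w, with the local data chosen separately at each w, agree with b / p
    wherever p does not vanish. In a disc around w where hp has no zero, p can vanish only at w, so
    the glued function is b1 / hp there. *)
Lemma entire_dvd_local p b : (forall w, exists k hp b1,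
    [/\ entire hp, entire b1, hp w != 0, forall z, p z = (z - w) ^+ k * hp z &
      forall z, b z = (z - w) ^+ k * b1 z]) -> entire_dvd p b.
Proof.
move=> H.
have /choice[B HB] : forall w, exists Bw, exists k hp b1,
    [/\ entire hp, entire b1, hp w != 0, forall z, p z = (z - w) ^+ k * hp z &
      forall z, b z = (z - w) ^+ k * b1 z] /\ Bw = b1 w / hp w.
  by move=> w; have [k [hp [b1 h]]] := H w; exists (b1 w / hp w), k, hp, b1.
have BE z : p z != 0 -> B z = b z / p z.
  have [k [hp [b1 [[_ _ hpz pE bE] ->]]]] := HB z; rewrite pE bE subrr.
  by case: k {pE bE} => [|k]; rewrite ?expr0 ?mul1r// exprS !mul0r eqxx.
exists B; split; last first.
  move=> z; have [pz|pz] := eqVneq (p z) 0; last by rewrite BE// mulrC mulfVK.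
  have [k [hp [b1 [[_ _ hpz pE bE] _]]]] := HB z; rewrite pz mul0r bE subrr.
  move: pz; rewrite pE subrr; case: k {pE bE} => [|k]; last by rewrite exprS !mul0r.
  by rewrite expr0 mul1r => /eqP; rewrite (negbTE hpz).
move=> w; have [k [hp [b1 [[ehp eb1 hpw pE bE] Bw]]]] := HB w.
have [d d0 Hd] := ccont_neq0 (entire_ccont w ehp) hpw.
apply: (@der_near (fun y => b1 y * (hp y)^-1) _ _ _ d0).
  move=> y yw; have [->//|ynw] := eqVneq y w.
  have yw0 : (y - w) ^+ k != 0 by rewrite expf_neq0// subr_eq0.
  have hy := Hd y yw.
  have py : p y != 0 by rewrite pE mulf_neq0.
  by rewrite BE// pE bE invfM mulrACA mulfV// mul1r.
by apply: derM; [exact: eb1|apply: derV; [exact: hpw|exact: ehp]].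
Qed.

(* Move from w in the direction that makes the first nonvanishing term of the expansion a
   negative multiple of g w. *)
Lemma local_min_modulus (g rh : R[i] -> R[i]) w (c1 : R[i]) :
  (forall z, g z = g w + (z - w) * c1 + (z - w) ^+ 2 * rh z) -> ccont rh w ->
  g w != 0 -> c1 != 0 \/ rh w != 0 ->
  forall d : R, 0 < d -> exists2 z, nc (z - w) < d & nc (g z) < nc (g w).
Proof.
move=> gE crh gw H d d0; have G0 := nc_gt0 gw.
have frac (a b : R) : 0 < a -> 0 <= b -> a / (1 + b) * b < a.
  move=> a0 b0; rewrite mulrAC ltr_pdivrMr ?ltr_pwDl// ltr_pM2l//; lra.
have pfrac (a b : R) : 0 < a -> 0 <= b -> 0 < a / (1 + b).
  by move=> a0 b0; rewrite divr_gt0// ltr_pwDl.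
have [c10|c1n] := eqVneq c1 0.
  case: H => [|r0]; first by rewrite c10 eqxx.
  (* With s^2 = c, the displacement e s has (e s)^2 rh w = - e^2 g w: the leading part of g shrinks
     by the factor 1 - e^2, and continuity of rh makes the error smaller than the gain. *)
  pose c := - g w / rh w.
  have gwE : g w = - (c * rh w) by rewrite /c mulfVK// opprK.
  clearbody c; pose s := sqrtC c.
  have [d2 d20 H2] := crh _ (pfrac _ _ G0 (nc_ge0 c)).
  pose m := Num.min d d2; have m0 : 0 < m by rewrite lt_min d0.
  pose e := Num.min 1 (m / (1 + nc s)).
  have e0 : 0 < e by rewrite lt_min ltr01 pfrac ?nc_ge0.
  have e1 : e <= 1 by rewrite ge_min lexx.
  have em : e * nc s < m.
    apply: le_lt_trans (frac _ _ m0 (nc_ge0 s)).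
    by rewrite ler_wpM2r ?nc_ge0// ge_min lexx orbT.
  have zw : nc (w + e%:C * s - w) = e * nc s.
    by rewrite addrAC subrr add0r Normc.normcM nc_real ger0_norm// ltW.
  have zm : nc (w + e%:C * s - w) < m by rewrite zw.
  move: (zm); rewrite lt_min => /andP[zd zd2].
  exists (w + e%:C * s) => //.
  have h := H2 _ zd2; set z := w + e%:C * s in h *.
  have -> : g z = (1 - e ^+ 2)%:C * g w + (e ^+ 2)%:C * (c * (rh z - rh w)).
    rewrite gE c10 mulr0 addr0 /z addrAC subrr add0r -/z exprMn.
    rewrite (sqrtCK c) rmorphB rmorphXn /=.
    by rewrite gwE; ring.
  apply: (le_lt_trans (ncD _ _)); rewrite !Normc.normcM !nc_real.
  have e21 : e ^+ 2 <= 1 by rewrite expr_le1// ltW.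
  have e20 : 0 < e ^+ 2 by rewrite exprn_gt0.
  rewrite (ger0_norm (ltW e20)) ger0_norm ?subr_ge0//.
  have : nc c * nc (rh z - rh w) < nc (g w).
    have [->|cn] := eqVneq c 0; first by rewrite Normc.normc0 mul0r.
    apply: le_lt_trans (frac _ _ G0 (nc_ge0 c)).
    by rewrite mulrC ler_wpM2r ?nc_ge0// ltW.
  rewrite -(ltr_pM2l e20) => L.
  have -> : (1 - e ^+ 2) * nc (g w) = nc (g w) - e ^+ 2 * nc (g w) by ring.
  by rewrite -addrA gtrDl addrC subr_lt0.
have [d1 d10 H1] := crh _ ltr01.
pose M := nc (rh w) + 1; have M0 : 0 <= M by rewrite addr_ge0 ?nc_ge0.
have HM z : nc (z - w) < d1 -> nc (rh z) <= M.
  move=> /H1 h; have -> : rh z = rh w + (rh z - rh w) by ring.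
  by apply: (le_trans (ncD _ _)); rewrite lerD2l ltW.
pose c := g w / c1; have gwE : g w = c * c1 by rewrite /c mulfVK.
clearbody c; pose m := Num.min d d1.
have m0 : 0 < m by rewrite lt_min d0.
have B0 : 0 <= nc c ^+ 2 * M by rewrite mulr_ge0 ?sqr_ge0.
pose e := Num.min 1 (Num.min (m / (1 + nc c)) (nc (g w) / (1 + nc c ^+ 2 * M))).
have e0 : 0 < e by rewrite !lt_min ltr01 !pfrac ?nc_ge0.
have e1 : e <= 1 by rewrite ge_min lexx.
have em : e * nc c < m.
  apply: le_lt_trans (frac _ _ m0 (nc_ge0 c)).
  by rewrite ler_wpM2r ?nc_ge0// !ge_min lexx !orbT.
have eB : e * (nc c ^+ 2 * M) < nc (g w).
  apply: le_lt_trans (frac _ _ G0 B0).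
  by rewrite ler_wpM2r// !ge_min lexx !orbT.
have zw : nc (w - e%:C * c - w) = e * nc c.
  by rewrite [w - _]addrC addrK ncN Normc.normcM nc_real ger0_norm// ltW.
have zm : nc (w - e%:C * c - w) < m by rewrite zw.
move: (zm); rewrite lt_min => /andP[zd zd1].
exists (w - e%:C * c) => //.
have h := HM _ zd1; set z := w - e%:C * c in h *.
have -> : g z = (1 - e)%:C * g w + (e ^+ 2)%:C * (c ^+ 2 * rh z).
  have -> : g z = g w + (- (e%:C * c)) * c1 + (- (e%:C * c)) ^+ 2 * rh z.
    by rewrite gE; congr (_ + _ * _ + _ ^+ 2 * _); rewrite /z; ring.
  rewrite rmorphB rmorphXn /=.
  by rewrite gwE; ring.
apply: (le_lt_trans (ncD _ _)); rewrite (Normc.normcM _ (g w)).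
rewrite (Normc.normcM _ (_ * rh z)) (Normc.normcM _ (rh z)) ncX !nc_real.
have e20 : 0 < e ^+ 2 by rewrite exprn_gt0.
rewrite (ger0_norm (ltW e20)) ger0_norm ?subr_ge0//.
have h2 : e ^+ 2 * (nc c ^+ 2 * nc (rh z)) <= e * (e * (nc c ^+ 2 * M)).
  by rewrite mulrA -expr2 ler_pM2l// ler_wpM2l// sqr_ge0.
have h3 : e * (e * (nc c ^+ 2 * M)) < e * nc (g w) by rewrite ltr_pM2l.
have -> : (1 - e) * nc (g w) = nc (g w) - e * nc (g w) by ring.
by rewrite -addrA gtrDl addrC subr_lt0; exact: le_lt_trans h3.
Qed.

Lemma nc_lipschitz z w : `|nc z - nc w| <= nc (z - w).
Proof.
rewrite ler_norml; apply/andP; split.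
  by have := ncD (w - z) z; rewrite subrK (nc_distrC w z); lra.
by have := ncD (z - w) w; rewrite subrK; lra.
Qed.

(** Compactness is taken from products of real segments, hence squares in place of discs. *)
Let toC (p : R * R) : R[i] := p.1 +i* p.2.
Let square (r : R) := (`[- r, r]%classic `*` `[- r, r]%classic : set (R * R)).

Let compact_square r : compact (square r).
Proof. by apply: compact_setX; exact: segment_compact. Qed.

Let nc_toC p p' : nc (toC p - toC p') <= `|p.1 - p'.1| + `|p.2 - p'.2|.
Proof. exact: nc_le_n1. Qed.

Lemma min_on_square (g : R[i] -> R[i]) (x : R[i]) (r : R) : 0 < r -> (forall z, ccont g z) ->
  exists2 w, `|cRe (w - x)| <= r /\ `|cIm (w - x)| <= r &
   forall z, `|cRe (z - x)| <= r -> `|cIm (z - x)| <= r -> nc (g w) <= nc (g z).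
Proof.
move=> r0 cg; pose F p := nc (g (x + toC p)).
have cF : continuous F.
  move=> p; apply/cvgrPdist_lt => e e0; have [d d0 Hd] := cg (x + toC p) e e0.
  have d20 : 0 < d / 2 by rewrite divr_gt0.
  exists (ball p.1 (d / 2), ball p.2 (d / 2)).
    by split; exact: nbhsx_ballx.
  move=> p' [/= h1 h2].
  apply: (le_lt_trans (nc_lipschitz _ _)); rewrite nc_distrC; apply: Hd.
  have -> : x + toC p' - (x + toC p) = toC p' - toC p by ring.
  apply: (le_lt_trans (nc_toC _ _)); rewrite (splitr d).
  by apply: ltrD; rewrite distrC.
have ne : square r !=set0.
  by exists (0, 0); split; rewrite /= in_itv /= oppr_le0 (ltW r0).
have [p + pmin] := compact_EVT_min ne (@compact_square r) (continuous_subspaceT cF).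
rewrite inE => -[]; rewrite /= !in_itv /= => p1 p2.
exists (x + toC p).
  have -> : x + toC p - x = toC p by ring.
  by rewrite /= !ler_norml.
move=> z z1 z2; pose p' := (cRe (z - x), cIm (z - x)).
have -> : z = x + toC p'.
  have -> : toC p' = z - x by rewrite /toC /p'; case: (z - x).
  by ring.
by apply: pmin; rewrite inE; split; rewrite /= in_itv /= -ler_norml.
Qed.

(** Near each p only [toC p] itself can lie in Z. Compactness is used along the filter of finite
    sequences directed by inclusion: a property is eventual if it holds for all sequences containing
    a given one. *)
Lemma isolated_finite (Z : R[i] -> Prop) (r : R) :
  (forall w, exists2 d : R, 0 < d & forall z, z != w -> nc (z - w) < d -> ~ Z z) ->
  exists s : seq R[i], forall z, nc z <= r -> Z z -> z \in s.
Proof.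
move=> HZ.
have /choice[d Hd] : forall p : R * R, exists d : R, 0 < d /\
    forall z, z != toC p -> nc (z - toC p) < d -> ~ Z z.
  by move=> p; have [d d0 H] := HZ (toC p); exists d.
pose F : set_system (seq R[i]) :=
  [set P : set (seq R[i]) | exists s0 : seq R[i], forall s : seq R[i], {subset s0 <= s} -> P s].
have FF : Filter F.
  split; first by exists ([::] : seq R[i]).
    move=> P Q [s1 H1] [s2 H2]; exists (s1 ++ s2) => s sub; split.
      by apply: H1 => z zs; apply: sub; rewrite mem_cat zs.
    by apply: H2 => z zs; apply: sub; rewrite mem_cat zs orbT.
  by move=> P Q PQ [s0 H]; exists s0 => s /H/PQ.
have cov := (compact_near_coveringP _).1 (@compact_square r).
have [p sp|s0 H] := cov _ F (fun s p => Z (toC p) -> toC p \in s) FF.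
  have [dp Hp] := Hd p; have dp2 : 0 < d p / 2 by rewrite divr_gt0.
  exists ((fun p' => ball p.1 (d p / 2) p'.1 /\ ball p.2 (d p / 2) p'.2),
    [set s : seq R[i] | toC p \in s]) => /=.
    split; last by exists ([:: toC p] : seq R[i]) => s; apply; rewrite mem_head.
    by exists (ball p.1 (d p / 2), ball p.2 (d p / 2)) => //; split; exact: nbhsx_ballx.
  move=> [p' s] /= [[h1 h2] ps] Zp'.
  have [->//|zp] := eqVneq (toC p') (toC p).
  exfalso; apply: (Hp _ zp) Zp'; apply: (le_lt_trans (nc_toC _ _)).
  by rewrite (splitr (d p)); apply: ltrD; rewrite distrC.
exists s0 => z zr Zz.
pose p' := (cRe z, cIm z); have zE : z = toC p' by rewrite /toC /p'; case: (z).
have sp' : square r p'.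
  split; rewrite /= in_itv /= -ler_norml; apply: le_trans zr.
    exact: normRe_le_nc.
  exact: normIm_le_nc.
have := H s0 (fun y (ys : y \in s0) => ys) p' sp'; rewrite -zE; exact.
Qed.

End ComplexFunctions.

(** * Zeros of the discriminant *)
Section ExponentialNearOne.
Variable R : realType.

Lemma cexp_period (u : R[i]) (k : int) : cexp (u + (2 * pi * k%:~R) *i) = cexp u.
Proof.
have P (f : R -> R) : periodic f (pi *+ 2) -> forall a, f (a + 2 * pi * k%:~R) = f a.
  move=> pf a; have pn := periodicn pf.
  have E n : pi *+ 2 *+ n = 2 * pi * n%:R :> R.
    by rewrite -[RHS]mulrA [pi * _]mulr_natr mulr_natl mulrnAC.
  case: k => n; first by rewrite -pmulrn -E pn.
  rewrite NegzE mulrNz -pmulrn mulrN -E -(pn n.+1 (a - _)).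
  by rewrite subrK.
by rewrite /cexp cReD cImD /= addr0 (P _ (@cosD2pi R)) (P _ (@sinD2pi R)).
Qed.

(** If Re u <= - r then |e^u| <= e^(-r); if Im u is at least s away from the multiples of 2 pi then
    Re e^u is at most max(0, cos s). Both are bounded away from 1. Taking s <= 1 gives 0 <= cos s <
    1. *)
Lemma cexp_near1 (r : R) : 0 < r -> exists2 d : R, 0 < d & forall u : R[i],
  cRe u <= 0 -> nc (cexp u - 1) < d ->
  `|cRe u| < r /\ exists k : int, `|cIm u - 2 * pi * k%:~R| < r.
Proof.
move=> r0; pose s : R := Num.min r 1.
have s0 : 0 < s by rewrite lt_min r0 ltr01.
have s1 : s <= 1 by rewrite ge_min lexx orbT.
have sr : s <= r by rewrite ge_min lexx.
have pi2 : 2 <= pi :> R by exact: pi_ge2.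
have coss : cos s < 1.
  by rewrite -[X in _ < X](@cos0 R) ltr_cos// in_itv /= ?lexx ?pi_ge0 ?(ltW s0)//; lra.
have coss0 : 0 <= cos s.
  by apply: cos_ge0_pihalf; apply/andP; split; lra.
pose d := Num.min (1 - expR (- r)) (1 - cos s).
have er : expR (- r) < 1 by rewrite -expR0 ltr_expR oppr_lt0.
exists d; first by rewrite lt_min !subr_gt0 er.
move=> u u0; rewrite lt_min => /andP[d1 d2]; split.
  rewrite ler0_norm// ltNge; apply/negP => ru.
  have h1 : nc (cexp u) <= expR (- r) by rewrite nc_cexp ler_expR; lra.
  have h2 := ncB (cexp u) (cexp u - 1).
  have : nc (1 : R[i]) <= nc (cexp u) + nc (cexp u - 1).
    by rewrite [X in nc X <= _](_ : 1 = cexp u - (cexp u - 1)) ?ncB//; ring.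
  rewrite Normc.normc1; lra.
(* Adding pi before rounding down selects the nearest multiple, so that x = Im u - 2 pi k lies in [-
   pi, pi). *)
pose k := Num.floor ((cIm u + pi) / (2 * pi)); exists k.
have pi0 : 0 < pi :> R by exact: pi_gt0.
have p20 : 0 < 2 * pi :> R by rewrite mulr_gt0.
have k1 : k%:~R <= (cIm u + pi) / (2 * pi) by exact: floor_le.
have k2 : (cIm u + pi) / (2 * pi) < k%:~R + 1.
  by have := floorD1_gt ((cIm u + pi) / (2 * pi)); rewrite intrD.
rewrite ler_pdivlMr// in k1; rewrite ltr_pdivrMr// in k2.
set x := cIm u - _.
have x1 : - pi <= x by rewrite /x [2 * pi * _]mulrC; lra.
have x2 : x < pi by rewrite /x [2 * pi * _]mulrC; lra.
rewrite ltNge; apply/negP => rx.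
have cu : cexp u = cexp (cRe u +i* x).
  have -> : u = (cRe u +i* x) + (2 * pi * k%:~R) *i.
    by apply: complex_eqP; rewrite ?cReD ?cImD /= ?addr0// /x subrK.
  by rewrite cexp_period cReD /= addr0.
have ax : `|x| <= pi by rewrite ler_norml x1 ltW.
have cx : cos x <= cos s.
  rewrite -cos_norm leNgt; apply/negP; rewrite ltr_cos ?in_itv /= ?normr_ge0//.
    by rewrite ltNge (le_trans sr).
  by rewrite (ltW s0) /=; lra.
have h : 1 - expR (cRe u) * cos x <= nc (cexp u - 1).
  apply: le_trans (normRe_le_nc _); rewrite cu cReD /=.
  by rewrite -normrN; apply: le_trans (ler_norm _); lra.
have e1 : expR (cRe u) <= 1 by rewrite -expR0 ler_expR.
have [c0|c0] := leP (cos x) 0.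
  have : expR (cRe u) * cos x <= 0 by rewrite mulr_ge0_le0// expR_ge0.
  lra.
have : expR (cRe u) * cos x <= 1 * cos s by apply: ler_pM; rewrite ?expR_ge0// ltW.
lra.
Qed.

End ExponentialNearOne.

(** * Zeros of Delta -+ 2 and the nodes 2 pi k / T *)

Section Lattice.
Variables (R : realType) (T : R) (q : R -> R[i]).
Hypothesis T0 : 0 < T.
Hypothesis cq : cing T q.
Implicit Types (z w : R[i]) (X Y : R -> R[i] * R[i]) (x : R).
Variables U V : R[i] -> R -> R[i] * R[i].
Hypothesis solU : forall z, sol T q z (U z).
Hypothesis solV : forall z, sol T q z (V z).
Hypothesis U0 : forall z, U z 0 = (1, 0).
Hypothesis V0 : forall z, V z 0 = (0, 1).

Let TT : 0 <= T <= T. Proof. by rewrite lexx ltW. Qed.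
Notation tr := (trM T U V).
Notation ta := (tau T U V).
Notation rh := (rho T U V).

Definition node (k : int) : R := 2 * pi / T * k%:~R.

Lemma lam0E k : lam0 T k = (node k)%:C. Proof. by []. Qed.

(** The sign s is (-1)^k; it enters later arguments only through s^2 = 1. *)
Lemma fe_node k : exists2 s : R[i], s ^+ 2 = 1 & fe (node k)%:C T = s /\ fei (node k)%:C T = s.
Proof.
have h : fe (node k)%:C T ^+ 2 = 1.
  rewrite expr2 fe_sqr -(cexp0 R) -(cexp_period 0 k) add0r; congr cexp.
  apply: complex_eqP; rewrite !(cReM, cImM) /=; first by ring.
  by rewrite /node; field; exact: lt0r_neq0.
exists (fe (node k)%:C T) => //; split=> //.
have K := feK (node k)%:C T.
by rewrite -[LHS]mul1r -{1}h expr2 -mulrA K mulr1.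
Qed.

Lemma rho_ccont w : ccont (rh w) w.
Proof.
apply: ccontD.
  exact: (tower_ccont (tower_at_U1 T0 solU solV U0 V0 w) 2%N).
exact: (tower_ccont (tower_at_V2 T0 solU solV U0 V0 w) 2%N).
Qed.

Lemma trM_tower : tower tr.
Proof.
by apply: tower_add; [exact: tower_U1 solV U0 V0|exact: tower_V2 solU solV U0 V0].
Qed.

Lemma norm_sign (s : R[i]) : s ^+ 2 = 1 -> nc s = 1.
Proof.
move=> s1; have h : nc s ^+ 2 = 1 by rewrite -ncX s1 Normc.normc1.
by apply/eqP; rewrite -(@eqrXn2 _ 2%N) ?nc_ge0// h expr1n.
Qed.

(* At the points x considered here the solution for q = 0 has monodromy s, and
   rho tends to - s T^2 / 4. *)
Lemma rho_near_node : exists r X0 : R, [/\ 0 < r, 0 < X0 & forall x s w z,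
  X0 <= `|x| -> s ^+ 2 = 1 -> fe x%:C T = s /\ fei x%:C T = s ->
  nc (w - x%:C) <= r -> nc (z - x%:C) <= r ->
  T ^+ 2 / 8 <= nc (rh w z) <= T ^+ 2].
Proof.
have [C [e0 [C0 e00 H]]] := rho_tau_asymptotics T0 solU solV.
(* The limit of rho has modulus T^2 / 4, so an error of T^2 / 16 leaves room for both bounds. *)
pose e := Num.min e0 (T ^+ 2 / 16 / (1 + C)).
have C1 : 0 < 1 + C by rewrite ltr_pwDl.
have T2 : 0 < T ^+ 2 by rewrite exprn_gt0.
have e_0 : 0 < e by rewrite lt_min e00 !divr_gt0.
have [X0 [r [X00 r0 Hc]]] := close_near T0 cq solU solV U0 V0 e_0.
exists r, X0; split=> // x s w z xX s1 [f1 f2] wr zr.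
have ee0 : e <= e0 by rewrite ge_min lexx.
have [h _] := H x e w z (ltW e_0) ee0 (Hc x w xX wr) (Hc x z xX zr).
have Ce : C * e <= T ^+ 2 / 16.
  apply: (@le_trans _ _ ((1 + C) * (T ^+ 2 / 16 / (1 + C)))).
    by apply: ler_pM; rewrite ?(ltW e_0)// ?lerDr// ge_min lexx orbT.
  by rewrite mulrC mulfVK// lt0r_neq0.
have {}h := le_trans (nc_le_n1 _) (le_trans h Ce).
have sn := norm_sign s1.
have E : nc ((T ^+ 2 / 8)%:C * (fe x%:C T + fei x%:C T)) = T ^+ 2 / 4.
  rewrite f1 f2; have -> : s + s = 2%:R%:C * s by rewrite rmorph_nat; ring.
  rewrite !Normc.normcM sn !nc_real !ger0_norm//; last by rewrite divr_ge0// ltW.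
  by field.
set y := _ * _ in h E.
have h1 : nc (rh w z) <= nc (rh w z + y) + nc y.
  by have := ncB (rh w z + y) y; rewrite addrK.
have h2 : nc y <= nc (rh w z + y) + nc (rh w z).
  by have := ncB (rh w z + y) (rh w z); rewrite [rh w z + y]addrC addrK.
apply/andP; split; lra.
Qed.

(* Near x the function tr - 2 s is a small perturbation of - s T^2 / 4 * (z - x)^2, so the
   minimum of its modulus over a square around x is attained inside, where it must be 0. *)
Lemma trace_zero_near_node (r1 : R) : 0 < r1 -> exists X0 : R, forall x s,
  X0 <= `|x| -> s ^+ 2 = 1 -> fe x%:C T = s /\ fei x%:C T = s ->
  exists2 w, nc (w - x%:C) < r1 & tr w = 2 * s.
Proof.
move=> r10; have [r2 [X1 [r20 X10 Hrho]]] := rho_near_node.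
pose r := Num.min r1 (r2 / 2).
have r0 : 0 < r by rewrite lt_min r10 divr_gt0.
have r2r : 2 * r <= r2.
  have : r <= r2 / 2 by rewrite ge_min lexx orbT.
  lra.
have [C [e0 [C0 e00 H]]] := rho_tau_asymptotics T0 solU solV.
have T2 : 0 < T ^+ 2 by rewrite exprn_gt0.
(* If the minimum w had |w - x| >= r, then |(w - x)^2 rho| would be at least A. Its expression
   through the expansion at x is at most 4 e + 2 r C e: twice 2 e from g, and C e from tau over a
   distance of at most 2 r. *)
pose A := r ^+ 2 * (T ^+ 2 / 8).
have A0 : 0 < A by rewrite mulr_gt0 ?divr_gt0// exprn_gt0.
have D0 : 0 < 5 + 2 * r * C.
  by rewrite ltr_pwDl// mulr_ge0// mulr_ge0// ltW.
pose e := Num.min e0 (A / (5 + 2 * r * C)).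
have e_0 : 0 < e by rewrite lt_min e00 divr_gt0.
have eA : 4 * e + 2 * r * C * e < A.
  have h : e * (5 + 2 * r * C) <= A.
    by rewrite -ler_pdivlMr// ge_min lexx orbT.
  have -> : 4 * e + 2 * r * C * e = e * (5 + 2 * r * C) - e by ring.
  lra.
have [X2 X20 Hc] := close_real T0 cq solU solV U0 V0 e_0.
exists (Num.max X1 X2) => x s; rewrite ge_max => /andP[xX1 xX2] s1 fs.
have [f1 f2] := fs; have cx := Hc x xX2.
have ee0 : e <= e0 by rewrite ge_min lexx.
pose g z := tr z - 2 * s.
have gx : nc (g x%:C) <= 2 * e.
  apply: (le_trans (nc_le_n1 _)); have [a _ _ b] := cx T TT.
  have -> : g x%:C = ((U x%:C T).1 - fe x%:C T) + ((V x%:C T).2 - fei x%:C T).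
    by rewrite /g /trM f1 f2; ring.
  by apply: (le_trans (n1D _ _)); lra.
have tx : nc (ta x%:C) <= C * e.
  have [_] := H x e x%:C x%:C (ltW e_0) ee0 cx cx.
  by rewrite f1 f2 subrr mulr0 subr0; exact: le_trans (nc_le_n1 _).
have cg z : ccont g z.
  apply: ccontD; first exact/entire_ccont/tower_is_entire/trM_tower.
  exact/entire_ccont/entire_cst.
have gE z w : g z = g w + (z - w) * ta w + (z - w) ^+ 2 * rh w z.
  by rewrite /g (trM_expansion T0 solU solV U0 V0 z w); ring.
have [w [w1 w2] wmin] := min_on_square x%:C r0 cg.
have sq z : `|cRe (z - x%:C)| <= r -> `|cIm (z - x%:C)| <= r -> nc (z - x%:C) <= 2 * r.
  by move=> h1 h2; apply: (le_trans (nc_le_n1 _)); rewrite /n1; lra.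
have wr2 := le_trans (sq w w1 w2) r2r.
have xr2 : nc (x%:C - x%:C) <= r2 by rewrite subrr Normc.normc0 ltW.
have wx : nc (g w) <= nc (g x%:C).
  by apply: wmin; rewrite subrr /= normr0 ltW.
have wr : nc (w - x%:C) < r.
  rewrite ltNge; apply/negP => rw.
  have := sq w w1 w2; set d := w - x%:C => d2r.
  have /andP[rho1 _] := Hrho x s x%:C w xX1 s1 fs xr2 wr2.
  have h : nc d ^+ 2 * (T ^+ 2 / 8) <= nc (g w) + nc (g x%:C) + nc d * (C * e).
    apply: (@le_trans _ _ (nc (d ^+ 2 * rh x%:C w))).
      by rewrite Normc.normcM ncX ler_wpM2l// exprn_ge0// nc_ge0.
    have -> : d ^+ 2 * rh x%:C w = g w - g x%:C - d * ta x%:C.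
      by rewrite (gE w x%:C) -/d; move: (ta _) (rh _ _) => p p'; ring.
    apply: (le_trans (ncB _ _)); apply: lerD; first exact: ncB.
    by rewrite Normc.normcM ler_wpM2l// nc_ge0.
  have h1 : A <= nc d ^+ 2 * (T ^+ 2 / 8).
    rewrite ler_pM2r ?divr_gt0// lerXn2r// nnegrE ?nc_ge0// ltW//.
  have h2 : nc d * (C * e) <= 2 * r * (C * e).
    by rewrite ler_wpM2r// mulr_ge0// ltW.
  have h3 : 2 * r * (C * e) = 2 * r * C * e by ring.
  lra.
exists w; first by apply: (lt_le_trans wr); rewrite ge_min lexx.
apply/eqP; rewrite -subr_eq0 -/(g w); apply/negP => /negP gw.
have /andP[rho1 _] := Hrho x s w w xX1 s1 fs wr2 wr2.
have rw : rh w w != 0.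
  by rewrite -nc_eq0 gt_eqF//; apply: lt_le_trans rho1; rewrite divr_gt0.
have d0 : 0 < r - nc (w - x%:C) by rewrite subr_gt0.
have [z zw gz] := local_min_modulus (fun z => gE z w) (@rho_ccont w) gw (or_intror rw) d0.
have zr : nc (z - x%:C) < r.
  have -> : z - x%:C = (z - w) + (w - x%:C) by ring.
  by apply: (le_lt_trans (ncD _ _)); rewrite -ltrBrDr.
have : nc (g w) <= nc (g z).
  by apply: wmin; apply: ltW; apply: le_lt_trans zr; [exact: normRe_le_nc|exact: normIm_le_nc].
by rewrite leNgt gz.
Qed.

Lemma trM_conj z : tr (conjc z) = conjc (tr z).
Proof.
have [a1 a2] := sol_symmetry T0 solU solV U0 V0 z TT.
have [b1 b2] := sol_symmetry T0 solU solV U0 V0 (conjc z) TT.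
rewrite conjcK in b1; rewrite /trM cJD b1 a1 conjcK; exact: addrC.
Qed.

(** For Im z >= 0 put f = [fe z T]. With tr z = 2 s the quantity in [trace_asymptotics] is 2 s f -
    f^2 - 1 = - (f - s)^2, so f is close to s, f^2 = e^(izT) is close to 1, and [cexp_near1] locates
    z. Conjugation covers the lower half-plane, since the nodes are real. *)
Lemma trace_zero_location (r : R) : 0 < r -> exists X0 : R, forall z s,
  X0 <= nc z -> s ^+ 2 = 1 -> tr z = 2 * s -> exists k, nc (z - (node k)%:C) <= r.
Proof.
move=> r0; pose r1 := r * T / 2.
have r10 : 0 < r1 by rewrite divr_gt0// mulr_gt0.
have [d d0 Hd] := cexp_near1 r10.
(* The square matches - (f - s)^2, and |f + s| <= 2 then gives |f^2 - 1| <= 2 d / 3 < d. *)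
pose e := (d / 3) ^+ 2.
have e0 : 0 < e by rewrite exprn_gt0// divr_gt0.
have [X0 X00 HX] := trace_asymptotics T0 cq solU solV U0 V0 e0.
exists X0.
suff main z s : 0 <= cIm z -> X0 <= nc z -> s ^+ 2 = 1 -> tr z = 2 * s ->
    exists k, nc (z - (node k)%:C) <= r.
  move=> z s zX s1 tz; have [y0|y0] := leP 0 (cIm z); first exact: main zX s1 tz.
  have [||||k Hk] := main (conjc z) (conjc s).
  - by rewrite cImJ oppr_ge0 ltW.
  - by rewrite ncJ.
  - by rewrite expr2 -cJM -expr2 s1 conjc1.
  - by rewrite trM_conj tz cJM conjc_nat.
  exists k; rewrite -ncJ cJB.
  by rewrite (_ : conjc _%:C = (node k)%:C)//; exact: conjc_real.
move=> y0 zX s1 tz; have := HX z y0 zX; rewrite -/(trM T U V z) tz -fe_sqr.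
set f := fe z T => h.
have fs : nc (f - s) <= d / 3.
  rewrite -(@ler_pXn2r _ 2%N) ?nnegrE ?nc_ge0//; last by rewrite divr_ge0// ltW.
  rewrite -ncX -[leLHS]ncN.
  apply: (le_trans (nc_le_n1 _)); apply: le_trans h.
  have -> // : 2 * s * f - f * f - 1 = - (f - s) ^+ 2.
  by rewrite -[X in _ - X = _]s1; ring.
have nf : nc f <= 1.
  by rewrite nc_cexp -[leRHS]expR0 ler_expR cRe_half_iM !mulNr oppr_le0 divr_ge0// mulr_ge0// ltW.
have sn := norm_sign s1.
have f2 : nc (cexp ('i%C * z * T%:C) - 1) < d.
  rewrite -fe_sqr -/f; have -> : f * f - 1 = (f - s) * (f + s) by rewrite -[X in _ - X = _]s1; ring.
  rewrite Normc.normcM; have h2 := ncD f s; rewrite sn in h2.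
  apply: (@le_lt_trans _ _ (d / 3 * 2)); last by lra.
  by apply: ler_pM; rewrite ?nc_ge0//; lra.
have u0 : cRe ('i%C * z * T%:C) <= 0 by rewrite cRe_iM mulNr oppr_le0 mulr_ge0// ltW.
have [h1 [k h2]] := Hd _ u0 f2.
exists k; apply: (le_trans (nc_le_n1 _)); rewrite /n1 cReD cImD cReN cImN /= subr0.
rewrite cRe_iM mulNr normrN normrM (gtr0_norm T0) in h1.
have hI : cIm ('i%C * z * T%:C) = cRe z * T by rewrite !(cReM, cImM) /=; ring.
rewrite hI in h2.
have E : cRe z * T - 2 * pi * k%:~R = (cRe z - node k) * T.
  by rewrite /node; field; exact: lt0r_neq0.
rewrite E normrM (gtr0_norm T0) in h2.
rewrite -(ler_pM2r T0) mulrDl; rewrite /r1 in h1 h2; lra.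
Qed.

(** Needed to give Delta -+ 2 zeros of finite order. High on the imaginary axis f = [fe z T] is
    tiny, so tr z = 2 s would make 2 s f - f^2 - 1 close to -1, against the bound 1 / 4. The summand
    32 / T yields |f| <= e^(-16) <= 1 / 16. *)
Lemma trM_not_const (s : R[i]) : s ^+ 2 = 1 -> exists z, tr z - 2 * s != 0.
Proof.
move=> s1; have e0 : 0 < 1 / 4 :> R by rewrite divr_gt0.
have [X0 X00 HX] := trace_asymptotics T0 cq solU solV U0 V0 e0.
pose y := X0 + 32 / T.
have yT : 0 < 32 / T by rewrite divr_gt0.
have y0 : 0 < y by rewrite addr_gt0.
pose z : R[i] := 0 +i* y; exists z.
have zX : X0 <= nc z.
  by apply: le_trans (normIm_le_nc z); rewrite /= gtr0_norm// /y lerDl ltW.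
have := HX z (ltW y0) zX; rewrite -/(trM T U V z) -fe_sqr => h.
apply: contraTneq h => /eqP; rewrite subr_eq0 => /eqP ->; rewrite -ltNge.
set f := fe z T.
have nf : nc f <= 1 / 16.
  rewrite nc_cexp cRe_half_iM /= -[1 / 16]invrK -[X in X <= _]invrK.
  rewrite lef_pV2 ?posrE ?invr_gt0 ?divr_gt0 ?expR_gt0// -expRN.
  have -> : (1 / 16)^-1 = 16 :> R by field.
  apply: le_trans (expR_ge1Dx _).
  have -> : - (- y * T / 2) = X0 * T / 2 + 16.
    by rewrite /y; field; exact: lt0r_neq0.
  have : 0 <= X0 * T / 2 by rewrite divr_ge0// mulr_ge0// ltW.
  lra.
apply: (lt_le_trans _ (nc_le_n1 _)).
have sn := norm_sign s1.
have h1 : nc (1 : R[i]) <= nc (2 * s * f - f * f) + nc (2 * s * f - f * f - 1).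
  rewrite [X in nc X <= _](_ : 1 = (2 * s * f - f * f) - (2 * s * f - f * f - 1)) ?ncB//.
  by ring.
have h2 := ncB (2 * s * f) (f * f).
rewrite Normc.normc1 in h1; rewrite !Normc.normcM sn in h2.
have n2' : nc (2 : R[i]) = 2.
  by have := nc_real (2 : R); rewrite rmorph_nat normr_nat.
rewrite n2' in h2.
have h3 : nc f * nc f <= 1 / 16 * 1 by apply: ler_pM; rewrite ?nc_ge0//; lra.
lra.
Qed.

End Lattice.

(** * The perturbed Fourier nodes *)
Section Enumeration.
Variable R : realType.

Lemma esum_large_finite (I : choiceType) (a : I -> R) (c : R) : 0 < c ->
  (forall k, 0 <= a k) -> (\esum_(k in [set: I]) (a k)%:E < +oo)%E ->
  finite_set [set k | c <= a k].
Proof.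
move=> c0 a0 Hs; apply: contrapT => inf.
have S0 : (0 <= \esum_(k in [set: I]) (a k)%:E)%E by apply: esum_ge0 => k _; rewrite lee_fin.
have Sfin : (\esum_(k in [set: I]) (a k)%:E)%E \is a fin_num by rewrite ge0_fin_numE.
set S := (\esum_(k in _) _)%E in Hs S0 Sfin.
pose n := Num.Def.archi_bound (fine S / c).
have [B BA Bn] := infinite_set_fset n inf.
have BA' : forall k, k \in finmap.enum_fset B -> c <= a k by move=> k kB; exact: BA.
have : (\sum_(k <- finmap.enum_fset B) (a k)%:E <= S)%E.
  apply: esum_ge; exists [set` finmap.enum_fset B]; first by split.
  by rewrite -fsbig_seq ?finmap.fset_uniq.
apply/negP; rewrite -ltNge -(fineK Sfin) sumEFin lte_fin.
apply: (@lt_le_trans _ _ (n%:R * c)).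
  by rewrite -ltr_pdivrMr// Num.Theory.archi_boundP// divr_ge0// ?fine_ge0// ltW.
apply: (@le_trans _ _ (\sum_(k <- finmap.enum_fset B) c)).
  rewrite big_const_seq count_predT iter_addr_0 -[leRHS]mulr_natl ler_wpM2r ?(ltW c0)//.
  by rewrite ler_nat.
by rewrite big_seq [leRHS]big_seq; apply: ler_sum => k; exact: BA'.
Qed.

Lemma finite_int_bounded (A : set int) :
  finite_set A <-> exists N : nat, forall k, (N <= `|k|)%N -> ~ A k.
Proof.
split=> [/finite_seqP[s ->]|[N HN]].
  exists (\max_(k <- s) `|k|%N).+1 => k Nk /= ks.
  by move: Nk; rewrite leqNgt ltnS => /negP; apply; exact: leq_bigmax_seq.
apply: (@sub_finite_set _ _ ((fun n : nat => n%:Z - N%:Z) @` `I_(N + N).+1)).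
  move=> k Ak; have kN : (`|k| < N)%N by rewrite ltnNge; apply/negP => /HN; exact.
  exists (absz (k + N%:Z)%R); first by rewrite /= ltnS; lia.
  lia.
exact/finite_image/finite_II.
Qed.

Variables (T : R) (M : R[i] -> 'M[R[i]]_2) (lam : int -> R[i]).
Hypothesis T0 : 0 < T.
Hypothesis hlam : zero_enumeration T M lam.

Notation f := (fun z => mon_a M z - mon_d M z).

Lemma enum_root k : f (lam k) = 0.
Proof.
have [/(_ (lam k))[n [[g [_ _ gE]] Hn]] _] := hlam.
rewrite gE subrr; case: n gE Hn => [|n] _ Hn; last by rewrite exprS !mul0r.
have : ([set j | lam j = lam k] #= `I_0)%card by [].
rewrite II0 card_eq0 => /eqP /seteqP[/(_ k)] /=.
by move=> /(_ erefl).
Qed.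

Lemma enum_zero w : f w = 0 -> exists k, lam k = w.
Proof.
have [/(_ w)[n [[g [_ gw gE]] Hn]] _] := hlam => fw.
apply: contrapT => /forallNP H.
have E : [set j | lam j = w] = set0 by apply/seteqP; split=> // j /= /H.
move: Hn; rewrite E => /card_esym; rewrite card_eq0 => /eqP.
case: n gE => [|n] gE.
  by move: fw; rewrite gE expr0 mul1r => /eqP; rewrite (negbTE gw).
by move=> /seteqP[/(_ 0%N)] /=; move=> /(_ (ltn0Sn n)).
Qed.

Lemma enum_multiplicity w : exists n, zero_multiplicity f w n.
Proof. by have [/(_ w)[n [Hn _]] _] := hlam; exists n. Qed.

Lemma enum_simple k : (forall j, lam j = lam k -> j = k) -> zero_multiplicity f (lam k) 1.
Proof.
move=> H; have [/(_ (lam k))[n [Hn Hc]] _] := hlam.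
have E : [set j | lam j = lam k] = [set k].
  by apply/seteqP; split=> [j /= /H|j ->].
move: Hc; rewrite E (card_eql card_set1) => /card_eq_II n1.
by rewrite n1.
Qed.

Lemma enum_cvg (e : R) : 0 < e ->
  exists N : nat, forall k, (N <= `|k|)%N -> nc (lam k - lam0 T k) < e.
Proof.
move=> e0; have [_ Hs] := hlam.
have e2 : 0 < e ^+ 2 by rewrite exprn_gt0.
have /finite_int_bounded[N HN] := esum_large_finite e2 (fun k => sqr_ge0 _) Hs.
exists N => k /HN /= /negP; rewrite -ltNge.
by rewrite ltr_pXn2r ?nnegrE ?nc_ge0 ?(ltW e0).
Qed.

Lemma node_sep k j : k != j -> 2 * pi / T <= `|node T k - node T j|.
Proof.
move=> kj; rewrite /node -mulrBr normrM -intrB.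
have p0 : 0 < 2 * pi / T by rewrite divr_gt0// mulr_gt0// pi_gt0.
rewrite (gtr0_norm p0) ler_peMr ?(ltW p0)// -intr_norm -[1]/(1%:~R) ler_int.
have : k - j != 0 by rewrite subr_eq0.
lia.
Qed.

Lemma node_large (B : R) : exists N : nat, forall k, (N <= `|k|)%N -> B <= `|node T k|.
Proof.
have p0 : 0 < 2 * pi / T by rewrite divr_gt0// mulr_gt0// pi_gt0.
exists (Num.Def.archi_bound (`|B| / (2 * pi / T))) => k Nk.
rewrite /node normrM (gtr0_norm p0) mulrC -ler_pdivrMr//.
apply: le_trans (_ : `|B| / (2 * pi / T) <= _).
  by rewrite ler_pM2r ?invr_gt0// ler_norm.
apply: (le_trans (ltW (Num.Theory.archi_boundP _))); first by rewrite divr_ge0// ltW.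
rewrite -intr_norm; have -> : `|k|%R = `|k|%N%:Z by rewrite abszE.
by rewrite -pmulrn ler_nat.
Qed.

(** For |j| >= N1 the zero lam j lies within r of its own node, and distinct nodes are at least 2 pi
    / T > 2 r apart. The finitely many other zeros, numbered arbitrarily, are bounded by B and far
    from the nodes of large index. *)
Lemma enum_isolated (r : R) : 0 < r -> r < pi / T -> exists N : nat, forall k,
  (N <= `|k|)%N -> nc (lam k - lam0 T k) < r /\
  forall j, nc (lam j - lam0 T k) <= r -> j = k.
Proof.
move=> r0 rT; have [N1 H1] := enum_cvg r0.
have [B HB] : exists B : R, forall j, (`|j| < N1)%N -> nc (lam j) <= B.
  exists (\sum_(n < N1.*2.+1) nc (lam (n%:Z - N1%:Z))) => j jN.
  have h : (`|(j + N1%:Z)%R| < N1.*2.+1)%N by lia.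
  rewrite (bigD1 (Ordinal h)) //=.
  have -> : `|(j + N1%:Z)%R|%N%:Z - N1%:Z = j by lia.
  by rewrite lerDl sumr_ge0// => i _; exact: nc_ge0.
have [N2 H2] := node_large (B + r + 1).
exists (maxn N1 N2) => k; rewrite geq_max => /andP[k1 k2]; split; first exact: H1.
move=> j jr; apply/eqP; apply: contrapT => /negP jk.
have [jN|jN] := leqP N1 `|j|%N.
  have h1 := H1 j jN; have h2 := node_sep jk.
  have : nc (lam0 T j - lam0 T k) <= nc (lam j - lam0 T k) + nc (lam j - lam0 T j).
    rewrite -[X in nc X <= _](_ : (lam j - lam0 T k) - (lam j - lam0 T j) = _) ?ncB//.
    by ring.
  have -> : nc (lam0 T j - lam0 T k) = `|node T j - node T k|.
    by rewrite !lam0E -rmorphB nc_real.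
  have E : 2 * pi / T = 2 * (pi / T) by rewrite mulrA.
  rewrite E in h2; lra.
have h1 := HB j jN; have h2 := H2 k k2.
have : nc (lam0 T k) <= nc (lam j) + nc (lam j - lam0 T k).
  rewrite -[X in nc X <= _](_ : lam j - (lam j - lam0 T k) = _) ?ncB//.
  by ring.
have -> : nc (lam0 T k) = `|node T k| by rewrite lam0E nc_real.
lra.
Qed.

End Enumeration.

(** * Greatest common divisors of entire functions *)
Section GreatestCommonDivisor.
Variable R : realType.
Implicit Types (f g h b c : R[i] -> R[i]) (z w : R[i]).

Lemma entire_powM w n g : entire g -> entire (fun z => (z - w) ^+ n * g z).
Proof. by move=> eg; apply: entireM; [apply/entireX/entire_sub|exact: eg]. Qed.

(** Here k is the minimum of n and the orders of b and c at w, and j is the excess. The induction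
    runs on n because b or c may vanish identically and then has no order. *)
Lemma common_order b c w n : tower b -> tower c -> exists j k b1 c1,
  [/\ n = (j + k)%N, entire b1 /\ entire c1, forall z, b z = (z - w) ^+ k * b1 z,
    forall z, c z = (z - w) ^+ k * c1 z & (0 < j)%N -> b1 w != 0 \/ c1 w != 0].
Proof.
move=> tb tc; elim: n => [|n [j [k [b1 [c1 [nE [eb1 ec1] bE cE Hj]]]]]].
  exists 0%N, 0%N, b, c; split=> //; first by split; exact: tower_is_entire.
    by move=> z; rewrite expr0 mul1r.
  by move=> z; rewrite expr0 mul1r.
have [j0|j0] := posnP j; last first.
  by exists j.+1, k, b1, c1; split=> //; [rewrite nE|move=> _; exact: Hj].
rewrite {}nE {Hj}j0 add0n.
have [bw|bw] := eqVneq (b1 w) 0; last first.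
  by exists 1%N, k, b1, c1; split=> // _; left.
have [cw|cw] := eqVneq (c1 w) 0; last first.
  by exists 1%N, k, b1, c1; split=> // _; right.
have [b2 eb2 b2E] := tower_vanish tb bE eb1 bw.
have [c2 ec2 c2E] := tower_vanish tc cE ec1 cw.
by exists 0%N, k.+1, b2, c2.
Qed.

Lemma prod_multiplicity (s : seq R[i]) (J : R[i] -> nat) w : uniq s ->
  exists Pw, [/\ entire Pw, Pw w != 0 & forall z,
    \prod_(v <- s) (z - v) ^+ J v = (z - w) ^+ (if w \in s then J w else 0%N) * Pw z].
Proof.
elim: s => [_|v s IH /= /andP[vs us]].
  exists (fun=> 1); split; [exact: entire_cst|exact: oner_neq0|].
  by move=> z; rewrite big_nil expr0 mul1r.
have [P' [eP' P'w P'E]] := IH us; rewrite inE.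
have [wv|wv] := eqVneq w v.
  exists P'; split=> // z; rewrite big_cons P'E wv.
  by rewrite (negbTE vs) expr0 mul1r.
exists (fun z => (z - v) ^+ J v * P' z); split.
- exact: entire_powM.
- by rewrite mulf_neq0// expf_neq0// subr_eq0.
- by move=> z; rewrite big_cons P'E mulrCA.
Qed.

(* p is f divided by \prod (z - w)^j(w), where w runs over the finitely many bad zeros and
   j(w) is the excess of the order of f at w over those of b and c. *)
Lemma gcd_construction f b c (bad : seq R[i]) : entire f -> tower b -> tower c ->
  (forall w, exists n, zero_multiplicity f w n) ->
  (forall w, w \notin bad -> f w = 0 -> [/\ b w = 0, c w = 0 & zero_multiplicity f w 1]) ->
  exists p P B C, [/\ entire_gcd3 p f b c, [/\ entire P, entire B & entire C],
    [/\ forall z, f z = p z * P z, forall z, b z = p z * B z & forall z, c z = p z * C z] &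
    forall w, exists k, zero_multiplicity p w k].
Proof.
move=> ef tb tc fmult Hbad.
have eb := tower_is_entire tb; have ec := tower_is_entire tc.
(* [J w] is the excess at w. Off [bad] it is 0: there f either does not vanish or has a simple zero
   shared by b and c. *)
have /choice[J HJ] : forall w, exists j, exists k g b1 c1,
   [/\ entire g /\ (entire b1 /\ entire c1), g w != 0 /\ (forall z, f z = (z - w) ^+ (j + k) * g z),
     (forall z, b z = (z - w) ^+ k * b1 z) /\ (forall z, c z = (z - w) ^+ k * c1 z),
     (0 < j)%N -> b1 w != 0 \/ c1 w != 0 & w \notin bad -> j = 0%N].
  move=> w; have [wb|wb] := boolP (w \in bad).
    have [n [g [eg gw gE]]] := fmult w.
    have [j [k [b1 [c1 [nE e1 bE cE Hj]]]]] := common_order w n tb tc.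
    by exists j, k, g, b1, c1; split=> //; rewrite -nE.
  have [fw|fw] := eqVneq (f w) 0; last first.
    exists 0%N, 0%N, f, b, c; split=> //; split=> // z; by rewrite expr0 mul1r.
  have [bw cw [g [eg gw gE]]] := Hbad w wb fw.
  have [|b1 eb1 b1E] := tower_vanish (w := w) (n := 0%N) (g := b) tb _ eb bw.
    by move=> z; rewrite expr0 mul1r.
  have [|c1 ec1 c1E] := tower_vanish (w := w) (n := 0%N) (g := c) tc _ ec cw.
    by move=> z; rewrite expr0 mul1r.
  by exists 0%N, 1%N, g, b1, c1.
pose s := undup bad; pose P z := \prod_(v <- s) (z - v) ^+ J v.
have Pf w : exists Pw, [/\ entire Pw, Pw w != 0 & forall z, P z = (z - w) ^+ J w * Pw z].
  have [Pw [ePw Pww PE]] := prod_multiplicity J w (undup_uniq bad).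
  exists Pw; split=> // z; rewrite /P PE mem_undup.
  case: ifPn => // wb; have [k [g [b1 [c1 [_ _ _ _ /(_ wb) ->]]]]] := HJ w.
  by [].
have eP : entire P.
  have [Pw [ePw _ PE]] := Pf 0.
  have -> : P = (fun z => (z - 0) ^+ J 0 * Pw z) by apply/funext.
  exact: entire_powM.
have Piso w : exists2 d : R, 0 < d & forall z, z != w -> nc (z - w) < d -> P z != 0.
  have [Pw [ePw Pww PE]] := Pf w.
  by apply: (@zero_multiplicity_isolated _ P w (J w)); exists Pw.
have fiso w : exists2 d : R, 0 < d & forall z, z != w -> nc (z - w) < d -> f z != 0.
  by have [n Hn] := fmult w; exact: zero_multiplicity_isolated Hn.
have [p [ep pE]] : entire_dvd P f.
  apply: entire_dvd_local => w; have [Pw [ePw Pww PE]] := Pf w.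
  have [k [g [b1 [c1 [[eg _] [_ gE] _ _ _]]]]] := HJ w.
  exists (J w), Pw, (fun z => (z - w) ^+ k * g z).
  split; [exact: ePw|exact: entire_powM|exact: Pww|exact: PE|].
  by move=> z; rewrite gE exprD mulrA.
have pmult w : exists k g b1 c1 h,
   [/\ entire h /\ h w != 0, forall z, p z = (z - w) ^+ k * h z,
     [/\ entire b1, entire c1, forall z, b z = (z - w) ^+ k * b1 z &
      forall z, c z = (z - w) ^+ k * c1 z], (0 < J w)%N -> b1 w != 0 \/ c1 w != 0
     & g = h].
  have [Pw [ePw Pww PE]] := Pf w.
  have [k [g [b1 [c1 [[eg [eb1 ec1]] [gw gE] [bE cE] H _]]]]] := HJ w.
  have E z : p z * Pw z = (z - w) ^+ k * g z.
    have E0 y : y != w -> p y * Pw y = (y - w) ^+ k * g y.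
      move=> yw; have y0 : (y - w) ^+ J w != 0 by rewrite expf_neq0// subr_eq0.
      apply: (mulfI y0); rewrite mulrA [_ * p y]mulrC -mulrA -PE mulrC -pE gE exprD.
      by rewrite mulrA.
    have [->|zw] := eqVneq z w; last exact: E0.
    apply: (@ccont_eq _ (fun y => p y * Pw y) (fun y => (y - w) ^+ k * g y) w _ _ _ ltr01).
    - by apply: entire_ccont; exact: entireM.
    - by apply: entire_ccont; exact: entire_powM.
    - by move=> y yw _; exact: E0.
  have [h eh hE] := local_quotient ep ePw eg Pww E.
  exists k, h, b1, c1, h; split=> //; split=> //.
  have : h w * Pw w = g w.
    apply: (@ccont_eq _ (fun y => h y * Pw y) g w _ _ _ ltr01).
    - by apply: entire_ccont; exact: entireM.
    - exact: entire_ccont.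
    - move=> y yw _; have y0 : (y - w) ^+ k != 0 by rewrite expf_neq0// subr_eq0.
      by apply: (mulfI y0); rewrite mulrA -hE.
  by move=> hPg; apply: contraNneq gw => h0; rewrite -hPg h0 mul0r.
have [B [eB BE]] : entire_dvd p b.
  apply: entire_dvd_local => w.
  have [k [_ [b1 [c1 [h [[eh hw] hE [eb1 _ b1E _] _ _]]]]]] := pmult w.
  by exists k, h, b1.
have [C [eC CE]] : entire_dvd p c.
  apply: entire_dvd_local => w.
  have [k [_ [b1 [c1 [h [[eh hw] hE [_ ec1 _ c1E] _ _]]]]]] := pmult w.
  by exists k, h, c1.
have BC w : (0 < J w)%N -> B w != 0 \/ C w != 0.
  move=> /[dup] Jw; have [k [_ [b1 [c1 [h [[eh hw] hE [eb1 ec1 b1E c1E] H _]]]]]] := pmult w.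
  have K u u1 W : entire u1 -> entire W -> (forall z, u z = (z - w) ^+ k * u1 z) ->
      (forall z, u z = p z * W z) -> u1 w != 0 -> W w != 0.
    move=> eu1 eW uE uW u1w.
    have E : u1 w = h w * W w.
      apply: (@ccont_eq _ u1 (fun y => h y * W y) w _ _ _ ltr01).
      - exact: entire_ccont.
      - by apply: entire_ccont; exact: entireM.
      - move=> y yw _; have y0 : (y - w) ^+ k != 0 by rewrite expf_neq0// subr_eq0.
        by apply: (mulfI y0); rewrite mulrA -hE -uW uE.
    by apply: contraNneq u1w => W0; rewrite E W0 mulr0.
  by move=> /H[b1w|c1w]; [left; exact: K eb1 eB b1E BE b1w|right; exact: K ec1 eC c1E CE c1w].
exists p, P, B, C; split=> //; last first.
- by move=> w; have [k [_ [b1 [c1 [h [[eh hw] hE _ _ _]]]]]] := pmult w; exists k, h.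
- by split=> // z; rewrite pE mulrC.
split=> //.
  by split; [exists P; split=> // z; rewrite pE mulrC|exists B|exists C].
move=> r er [h [eh hE]] [hb [ehb hbE]] [hc [ehc hcE]].
(* Maximality of p: let r divide f = P p, b and c, with f = r h. Cancelling r gives h B = P hb and h
   C = P hc. Where [J w > 0] one of B, C is nonzero at w, so (z - w)^(J w) divides h. Hence P
   divides h, and p = r (h / P). *)
have key (u : R[i] -> R[i]) W hu w : entire W -> entire hu ->
    (forall z, u z = p z * W z) -> (forall z, u z = r z * hu z) ->
    forall z, h z * W z = P z * hu z.
  move=> eW ehu uW uh z; have [d d0 Hd] := fiso z.
  apply: (@ccont_eq _ (fun y => h y * W y) (fun y => P y * hu y) z _ _ _ d0).
  - by apply: entire_ccont; exact: entireM.
  - by apply: entire_ccont; exact: entireM.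
  - move=> y yz yd; have fy := Hd y yz yd.
    have ry : r y != 0 by apply: contraNneq fy => r0; rewrite hE r0 mul0r.
    apply: (mulfI ry); rewrite mulrA -hE pE -mulrA -uW uh; ring.
have [e [ee eE]] : entire_dvd P h.
  apply: entire_dvd_local => w; have [Pw [ePw Pww PE]] := Pf w.
  have L W hu (u : R[i] -> R[i]) : entire W -> entire hu -> (forall z, u z = p z * W z) ->
     (forall z, u z = r z * hu z) -> W w != 0 ->
     exists2 h1, entire h1 & forall z, h z = (z - w) ^+ J w * h1 z.
    move=> eW ehu uW uh Ww.
    apply: (local_quotient eh eW (entireM ePw ehu) Ww) => z.
    by rewrite (key u W hu w)// PE mulrA.
  have [J0|J0] := posnP (J w).
    exists 0%N, P, h; split=> //; last by move=> z; rewrite expr0 mul1r.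
      by rewrite PE J0 expr0 mul1r.
    by move=> z; rewrite expr0 mul1r.
  have [h1 eh1 h1E] : exists2 h1, entire h1 & forall z, h z = (z - w) ^+ J w * h1 z.
    by case: (BC w J0) => H; [exact: L eB ehb BE hbE H|exact: L eC ehc CE hcE H].
  by exists (J w), Pw, h1.
exists e; split=> // z; have [d d0 Hd] := Piso z.
apply: (@ccont_eq _ p (fun y => r y * e y) z _ _ _ d0).
- exact: entire_ccont.
- by apply: entire_ccont; exact: entireM.
- move=> y yz yd; have Py := Hd y yz yd.
  by apply: (mulfI Py); rewrite -pE hE eE mulrCA.
Qed.

Lemma quotient_multiplicity p Q D w k n : entire Q ->
  (forall z, D z = p z ^+ 2 * Q z) -> zero_multiplicity p w k -> zero_multiplicity D w n ->
  exists m, zero_multiplicity Q w m.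
Proof.
move=> eQ DE [h [eh hw hE]] [g [eg gw gE]].
have E y : (y - w) ^+ (k + k) * (h y ^+ 2 * Q y) = (y - w) ^+ n * g y.
  by rewrite -gE DE hE exprD; ring.
have eh2 : entire (fun y => h y ^+ 2) by exact: entireX.
have [kn|nk] := leqP (k + k) n; last first.
  exfalso; move/negP: gw; apply; apply/eqP.
  have -> : 0 = (fun y => (y - w) ^+ (k + k - n) * (h y ^+ 2 * Q y)) w :> R[i].
    have : (0 < k + k - n)%N by rewrite subn_gt0.
    by rewrite /= subrr; case: (k + k - n)%N => [|m _] //; rewrite exprS !mul0r.
  apply/esym.
  apply: (@ccont_eq _ (fun y => (y - w) ^+ (k + k - n) * (h y ^+ 2 * Q y)) g w _ _ _ ltr01).
  - by apply: entire_ccont; apply: entire_powM; exact: entireM.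
  - exact: entire_ccont.
  - move=> y yw _; have y0 : (y - w) ^+ n != 0 by rewrite expf_neq0// subr_eq0.
    by apply: (mulfI y0); rewrite -E [LHS]mulrA -exprD subnKC// ltnW.
pose m := (n - (k + k))%N.
have E1 y : Q y * h y ^+ 2 = (y - w) ^+ m * g y.
  apply: (@ccont_eq _ (fun y => Q y * h y ^+ 2) (fun y => (y - w) ^+ m * g y) y _ _ _
    (_ : 0 < if y == w then 1 else nc (y - w))).
  - by apply: entire_ccont; exact: entireM.
  - by apply: entire_ccont; exact: entire_powM.
  - by case: eqVneq => [//|yw]; apply: nc_gt0; rewrite subr_eq0.
  move=> x xy xd; have xw : x != w.
    move: xd; case: eqVneq => [yw _|yw xd]; first by rewrite -yw.
    by apply: contraTneq xd => ->; rewrite nc_distrC ltxx.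
  have x0 : (x - w) ^+ (k + k) != 0 by rewrite expf_neq0// subr_eq0.
  apply: (mulfI x0); rewrite [Q x * _]mulrC E [RHS]mulrA -exprD subnKC//.
have [Q1 eQ1 Q1E] := local_quotient eQ eh2 eg (expf_neq0 2 hw) E1.
exists m, Q1; split=> //.
have : Q1 w * h w ^+ 2 = g w.
  apply: (@ccont_eq _ (fun y => Q1 y * h y ^+ 2) g w _ _ _ ltr01).
  - by apply: entire_ccont; exact: entireM.
  - exact: entire_ccont.
  - move=> y yw _; have y0 : (y - w) ^+ m != 0 by rewrite expf_neq0// subr_eq0.
    by apply: (mulfI y0); rewrite mulrA -Q1E.
by move=> H; apply: contraNneq gw => h0; rewrite -H h0 mul0r.
Qed.

(** Existing multiplicities isolate the zeros, and compactness makes them finite in number. The list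
    repeats each candidate as often as its multiplicity; candidates that are not zeros are repeated
    0 times. *)
Lemma bounded_zeros_finite (Q : R[i] -> R[i]) (r : R) :
  (forall w, exists m, zero_multiplicity Q w m) -> (forall z, r <= nc z -> Q z != 0) ->
  finitely_many_zeros Q.
Proof.
move=> Qm Qr.
have [s Hs] : exists s : seq R[i], forall z, nc z <= r -> Q z = 0 -> z \in s.
  apply: isolated_finite => w; have [m Hm] := Qm w.
  have [d d0 Hd] := zero_multiplicity_isolated Hm; exists d => // z zw zd /eqP Qz.
  by move: (Hd z zw zd); rewrite Qz.
have [m Hm] := choice Qm.
exists (flatten [seq nseq (m v) v | v <- undup s]) => w.
have -> : count_mem w (flatten [seq nseq (m v) v | v <- undup s]) =
    (if w \in undup s then m w else 0)%N.
  elim: (undup s) (undup_uniq s) => //= v t IH /andP[vt ut].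
  rewrite count_cat count_nseq IH// in_cons /= (eq_sym v w).
  case: (eqVneq w v) => [->|_]; last by rewrite mul0n.
  by rewrite mul1n (negbTE vt) addn0.
rewrite mem_undup; case: ifPn => // ws.
have [g [eg gw gE]] := Hm w.
have Qw : Q w != 0.
  have [wr|rw] := leP (nc w) r; last exact/Qr/ltW.
  by apply: contraNneq ws => /(Hs w wr).
case: (m w) gE => [|j] gE; first by exists g.
by move: Qw; rewrite gE subrr exprS !mul0r eqxx.
Qed.

End GreatestCommonDivisor.

Lemma int_window (N : nat) (k : int) : (`|k| < N)%N ->
  (absz (k + N%:Z)%R < N.*2.+1)%N /\ (absz (k + N%:Z)%R)%:Z - N%:Z = k.
Proof. by move=> kN; split; lia. Qed.

(** * Finite gap potentials *)
Section FiniteGap.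
Variables (R : realType) (T : R) (q : R -> R[i]).
Hypothesis T0 : 0 < T.
Hypothesis cq : cing T q.
Implicit Types (z w : R[i]).
Variables U V : R[i] -> R -> R[i] * R[i].
Hypothesis solU : forall z, sol T q z (U z).
Hypothesis solV : forall z, sol T q z (V z).
Hypothesis U0 : forall z, U z 0 = (1, 0).
Hypothesis V0 : forall z, V z 0 = (0, 1).
Variables (M : R[i] -> 'M[R[i]]_2) (lam : int -> R[i]).
Hypothesis Ma : forall z, mon_a M z = (U z T).1.
Hypothesis Mb : forall z, mon_b M z = (U z T).2.
Hypothesis Mc : forall z, mon_c M z = (V z T).1.
Hypothesis Md : forall z, mon_d M z = (V z T).2.
Hypothesis hlam : zero_enumeration T M lam.

Let TT : 0 <= T <= T. Proof. by rewrite lexx ltW. Qed.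
Notation f := (fun z => mon_a M z - mon_d M z).
Notation tr := (trM T U V).

Lemma trace_trM z : \tr (M z) = tr z.
Proof.
rewrite /mxtrace !big_ord_recl big_ord0 addr0 /trM -Ma -Md.
by congr (_ + M z _ _); apply: val_inj.
Qed.

Lemma monodromy_det z : mon_a M z * mon_d M z - mon_b M z * mon_c M z = 1.
Proof. by rewrite Ma Mb Mc Md (wronskian T0 solU solV U0 V0 z TT). Qed.

Lemma monodromy_symmetry z :
  mon_a M z = conjc (mon_d M (conjc z)) /\ mon_b M z = - conjc (mon_c M (conjc z)).
Proof.
by rewrite Ma Mb Mc Md; exact: (sol_symmetry T0 solU solV U0 V0 z TT).
Qed.

(** Write 4 as 4 (a d - b c). This shows that p^2 divides Delta^2 - 4 for every common divisor p of
    a - d, b and c. *)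
Lemma discriminant z :
  tr z ^+ 2 - 4 = f z ^+ 2 + 4 * (mon_b M z * mon_c M z).
Proof.
rewrite /trM -Ma -Md.
have E : 4 = 4 * (mon_a M z * mon_d M z - mon_b M z * mon_c M z) :> R[i].
  by rewrite monodromy_det mulr1.
rewrite [X in _ - X = _]E; ring.
Qed.

(** At a scalar monodromy the two diagonal contributions to [tau] are the same integral, the pairing
    of [U w] with [V w], with opposite signs. *)
Lemma tau_scalar w : mon_a M w = mon_d M w -> mon_b M w = 0 -> mon_c M w = 0 ->
  tau T U V w = 0.
Proof.
rewrite Ma Mb Mc Md /tau /Sop ![(_, _).1]/= ![(_, _).2]/= => -> -> ->.
have -> : CI (fun s => (V w s).1 * (U w s).2 + (V w s).2 * (U w s).1) T =
    CI (fun s => (U w s).1 * (V w s).2 + (U w s).2 * (V w s).1) T.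
  by apply: (CI_eq TT) => s _; ring.
by move: (CI _ T) (CI _ T) (CI _ T) => p r r'; ring.
Qed.

Lemma entire_f : entire f.
Proof.
have -> : f = (fun z => (U z T).1 + -1 * (V z T).2).
  by apply/funext => z; rewrite Ma Md mulN1r.
apply: entireD.
  by apply/tower_is_entire; exact: (tower_U1 T0 solU solV U0 V0).
apply: entireM; first exact: entire_cst.
by apply/tower_is_entire; exact: (tower_V2 T0 solU solV U0 V0).
Qed.

Lemma tower_b : tower (mon_b M).
Proof.
have -> : mon_b M = (fun z => (U z T).2) by apply/funext.
exact: (tower_U2 T0 solU solV U0 V0).
Qed.

Lemma tower_c : tower (mon_c M).
Proof.
have -> : mon_c M = (fun z => (V z T).1) by apply/funext.
exact: (tower_V1 T0 solU solV U0 V0).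
Qed.

Let trtower : tower tr := trM_tower T0 solU solV U0 V0.
Let piT0 : 0 < pi / T. Proof. by rewrite divr_gt0// pi_gt0. Qed.

Lemma finite_gap_vanish : finite_gap M ->
  exists N : nat, forall k, (N <= `|k|)%N -> mon_b M (lam k) = 0.
Proof.
move=> [p [Q [[ep [[f1 [_ f1E]] [b1 [_ b1E]] _] _] eQ trE [s Hs]]]].
pose r := pi / T / 4.
have r0 : 0 < r by rewrite divr_gt0.
have rT : r < pi / T by rewrite ltr_pdivrMr// ltr_pMr// (_ : 1 = 1%:R)// ltr_nat.
have [N1 H1] := enum_isolated T0 hlam r0 rT.
have [X0 HE] := trace_zero_near_node T0 cq solU solV U0 V0 r0.
have [N2 H2] := node_large T0 X0.
pose B := \sum_(v <- s) nc v.
have HB v : v \in s -> nc v <= B.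
  move=> vs; rewrite /B (big_rem v)//= lerDl sumr_ge0// => *; exact: nc_ge0.
have [N3 H3] := node_large T0 (B + r + 1).
exists (maxn N1 (maxn N2 N3)) => k; rewrite !geq_max => /and3P[k1 k2 k3].
have [sg sg2 fs] := fe_node T0 k.
have [w wr trw] := HE (node T k) sg (H2 k k2) sg2 fs.
(* B bounds the moduli of the zeros of Q, and |w| > B since the node has modulus at least B + r +
   1. *)
have ws : w \notin s.
  apply/negP => /HB wB; have h3 := H3 k k3.
  have := ncB w (w - (node T k)%:C); rewrite opprB addrC subrK nc_real; lra.
have Qw : Q w != 0.
  by have := Hs w; rewrite (count_memPn ws) => -[g [_ gw gE]]; rewrite gE expr0 mul1r.
have pw : p w = 0.
  have := trE w; rewrite trace_trM trw exprMn sg2 mulr1 => E.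
  have : p w ^+ 2 * Q w = 0 by rewrite -E; ring.
  by move/eqP; rewrite mulf_eq0 (negbTE Qw) orbF expf_eq0 /= => /eqP.
have fw : f w = 0 by rewrite f1E pw mul0r.
have [j lj] := enum_zero hlam fw.
have [_ Hk] := H1 k k1.
have jk : j = k by apply: Hk; rewrite lj lam0E ltW.
by rewrite -jk lj b1E pw mul0r.
Qed.

Lemma vanish_finite_gap :
  (exists N : nat, forall k, (N <= `|k|)%N -> mon_b M (lam k) = 0) -> finite_gap M.
Proof.
move=> [N0 HN0].
have [r1 [X1 [r10 X10 Hrho]]] := rho_near_node T0 cq solU solV U0 V0.
(* [r1] gives the bounds on rho, pi / (4 T) the isolation of lam k, and 1 / (2 T) the final estimate
   |z - w|^2 T^2 <= 1. *)
pose r := Num.min r1 (Num.min (pi / T / 4) (1 / (2 * T))).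
have r0 : 0 < r.
  rewrite !lt_min r10 (divr_gt0 piT0)//; apply: divr_gt0 => //.
  exact: mulr_gt0.
have rr1 : r <= r1 by rewrite ge_min lexx.
have rT : r < pi / T.
  apply: (@le_lt_trans _ _ (pi / T / 4)); first by rewrite !ge_min lexx orbT.
  by rewrite ltr_pdivrMr// ltr_pMr// (_ : 1 = 1%:R)// ltr_nat.
have rT2 : 2 * r <= T^-1.
  have : r <= 1 / (2 * T) by rewrite !ge_min lexx !orbT.
  rewrite div1r invfM mulrC ler_pdivlMr// mulrC; exact.
have [N1 H1] := enum_isolated T0 hlam r0 rT.
have [N2 H2] := node_large T0 X1.
pose N := maxn N0 (maxn N1 N2).
have good k : (N <= `|k|)%N -> [/\ nc (lam k - (node T k)%:C) < r, X1 <= `|node T k|,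
    mon_a M (lam k) = mon_d M (lam k), mon_b M (lam k) = 0 & mon_c M (lam k) = 0] /\
    zero_multiplicity f (lam k) 1.
  rewrite !geq_max => /and3P[k0 k1 k2].
  have [kr kj] := H1 k k1.
  have fk := enum_root hlam k.
  have ad : mon_a M (lam k) = mon_d M (lam k) by apply/eqP; rewrite -subr_eq0 fk.
  have b0 := HN0 k k0.
  (* Conjugation preserves the zeros of a - d and the distance to the real node, so isolation forces
     conj (lam k) = lam k. *)
  have fc : f (conjc (lam k)) = 0.
    have [a1 _] := monodromy_symmetry (lam k).
    have [a2 _] := monodromy_symmetry (conjc (lam k)).
    by rewrite conjcK in a2; rewrite a2 -ad a1 conjcK subrr.
  have [j jE] := enum_zero hlam fc.
  have real : conjc (lam k) = lam k.
    rewrite -{2}(kj j) ?jE// -ncJ cJB conjcK.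
    by rewrite (_ : conjc (lam0 T k) = lam0 T k) ?ltW//; exact: conjc_real.
  split; last first.
    by apply: (enum_simple hlam) => j' j'k; apply: kj; rewrite j'k ltW.
  split=> //; first exact: H2.
  have [_] := monodromy_symmetry (lam k); rewrite b0 real => /eqP.
  by rewrite eq_sym oppr_eq0 conjc_eq0 => /eqP.
pose bad := [seq lam (n%:Z - N%:Z) | n <- iota 0 N.*2.+1].
have Hbad w : w \notin bad -> f w = 0 ->
    [/\ mon_b M w = 0, mon_c M w = 0 & zero_multiplicity f w 1].
  move=> wb fw; have [k kw] := enum_zero hlam fw.
  have kN : (N <= `|k|)%N.
    rewrite leqNgt; apply/negP => /int_window[kN kE]; move/negP: wb; apply.
    apply/mapP; exists (absz (k + N%:Z)%R); first by rewrite mem_iota.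
    by rewrite -kw kE.
  by have [[_ _ _ hb hc] hm] := good k kN; rewrite -kw.
have eb := tower_is_entire tower_b; have ec := tower_is_entire tower_c.
have [p [P [B [C [gcdp [eP eB eC] [fE bE cE] pmult]]]]] :=
  gcd_construction entire_f tower_b tower_c (enum_multiplicity hlam) Hbad.
(* This is the [discriminant] identity with p^2 taken out. *)
pose Q z := P z ^+ 2 + 4 * (B z * C z).
have eQ : entire Q.
  apply: entireD; first exact: entireX.
  by apply: entireM; [exact: entire_cst|exact: entireM].
have DE z : tr z ^+ 2 - 4 = p z ^+ 2 * Q z.
  by rewrite discriminant [f z]fE bE cE /Q; ring.
exists p, Q; split=> //.
  by move=> z; rewrite trace_trM.
have s1 : (1 : R[i]) ^+ 2 = 1 by rewrite expr1n.
have sN1 : (-1 : R[i]) ^+ 2 = 1 by rewrite sqrrN expr1n.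
(* The factors Delta - 2 and Delta + 2 are treated separately: each has a tower, and the orders
   add. *)
have Dmult w : exists n, zero_multiplicity (fun z => tr z ^+ 2 - 4) w n.
  have K (sg : R[i]) : sg ^+ 2 = 1 -> exists n, zero_multiplicity (fun z => tr z + - (2 * sg)) w n.
    move=> sg2; have [z0 z0E] := trM_not_const T0 cq solU solV U0 V0 sg2.
    exact: (@tower_multiplicity _ (fun z => tr z + - (2 * sg)) w z0
      (tower_add trtower (tower_cst _)) z0E).
  have [n1 [g1 [eg1 g1w g1E]]] := K _ s1; have [n2 [g2 [eg2 g2w g2E]]] := K _ sN1.
  exists (n1 + n2)%N, (fun z => g1 z * g2 z); split.
  - exact: entireM.
  - by rewrite mulf_neq0.
  - move=> z; have -> : tr z ^+ 2 - 4 = (tr z + - (2 * 1)) * (tr z + - (2 * -1)) by ring.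
    by rewrite g1E g2E exprD; ring.
have [X2 HX2] := trace_zero_location T0 cq solU solV U0 V0 r0.
(* [Bd] bounds all nodes of index |k| < N, so the node close to a zero z beyond Bd + r has index at
   least N. *)
pose Bd := \sum_(n < N.*2.+1) `|node T (n%:Z - N%:Z)|.
apply: (@bounded_zeros_finite _ Q (Num.max X2 (Bd + r + 1))).
  move=> w; have [k Hk] := pmult w; have [n Hn] := Dmult w.
  exact: (quotient_multiplicity eQ DE Hk Hn).
move=> z; rewrite ge_max => /andP[z2 zB]; apply/negP => /eqP Qz.
have tz : tr z = 2 * (tr z / 2) by field.
have tz1 : (tr z / 2) ^+ 2 = 1.
  have h : tr z ^+ 2 = 4 by apply/eqP; rewrite -subr_eq0 DE Qz mulr0.
  by rewrite exprMn h; field.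
have [k zk] := HX2 z _ z2 tz1 tz.
have kN : (N <= `|k|)%N.
  rewrite leqNgt; apply/negP => /int_window[kN kE].
  have : `|node T k| <= Bd.
    by rewrite /Bd (bigD1 (Ordinal kN))//= kE lerDl sumr_ge0.
  have := ncD (z - (node T k)%:C) (node T k)%:C; rewrite subrK nc_real; lra.
have [[wr kX ad b0 c0] fm] := good k kN; set w := lam k in wr ad b0 c0 fm.
have [sg sg2 fs] := fe_node T0 k.
have wr1 : nc (w - (node T k)%:C) <= r1 by apply: le_trans rr1; exact: ltW.
have zr1 := le_trans zk rr1.
have Gw : forall y, nc (y - (node T k)%:C) <= r1 -> rho T U V w y != 0.
  move=> y yr; have /andP[h _] := Hrho (node T k) sg w y kX sg2 fs wr1 yr.
  by rewrite -nc_eq0 gt_eqF//; apply: lt_le_trans h; rewrite divr_gt0// exprn_gt0.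
pose aw := mon_a M w.
have aw2 : aw ^+ 2 = 1.
  by have := monodromy_det w; rewrite -ad b0 mul0r subr0 expr2.
have trw : tr w = 2 * aw by rewrite /trM -Ma -Md -ad /aw; ring.
(* Delta^2 - 4 = (Delta - 2 aw) (Delta + 2 aw) with aw = 1 or -1; as tau vanishes at w, Delta - 2 aw
   = (y - w)^2 rho. *)
pose G y := rho T U V w y * (4 * aw + (y - w) ^+ 2 * rho T U V w y).
have DG y : tr y ^+ 2 - 4 = (y - w) ^+ 2 * G y.
  rewrite (trM_expansion T0 solU solV U0 V0 y w) tau_scalar// trw mulr0 addr0 /G.
  have E : 4 = 4 * aw ^+ 2 :> R[i] by rewrite aw2 mulr1.
  by rewrite [X in _ - X = _]E; move: (rho _ _ _ _ _) (aw) => u v; ring.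
have [g [eg _ gE]] := fm.
have [b1 eb1 b1E] : exists2 b1, entire b1 & forall y, mon_b M y = (y - w) ^+ 1 * b1 y.
  by apply: (tower_vanish (n := 0%N) tower_b _ eb b0) => y; rewrite expr0 mul1r.
have [c1 ec1 c1E] : exists2 c1, entire c1 & forall y, mon_c M y = (y - w) ^+ 1 * c1 y.
  by apply: (tower_vanish (n := 0%N) tower_c _ ec c0) => y; rewrite expr0 mul1r.
have [_ _ univ] := gcdp.
(* The maximality of p gives the factor y - w, whose square cancels the double zero of Delta^2 - 4:
   what remains is e^2 Q = G, so a zero of Q is a zero of G. *)
have [e [ee eE]] : entire_dvd (fun y => (y - w) ^+ 1) p.
  apply: univ; first exact/entireX/entire_sub.
  - by exists g.
  - by exists b1.
  - by exists c1.
have QG y : y != w -> e y ^+ 2 * Q y = G y.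
  move=> yw; have y0 : (y - w) ^+ 2 != 0 by rewrite expf_neq0// subr_eq0.
  apply: (mulfI y0); rewrite -DG DE eE expr1; ring.
have QGw y : e y ^+ 2 * Q y = G y.
  have [->|yw] := eqVneq y w; last exact: QG.
  apply: (@ccont_eq _ (fun y => e y ^+ 2 * Q y) G w _ _ _ ltr01).
  - by apply: entire_ccont; apply: entireM; [exact: entireX|exact: eQ].
  - have cr := rho_ccont T0 solU solV U0 V0 w.
    apply: ccontM; first exact: cr.
    apply: ccontD; first exact/entire_ccont/entire_cst.
    by apply: ccontM; [exact/entire_ccont/entireX/entire_sub|exact: cr].
  - by move=> x xw _; exact: QG.
have := QGw z; rewrite Qz mulr0 => /esym/eqP; rewrite mulf_eq0 (negbTE (Gw z zr1)) /=.
rewrite addr_eq0 => /eqP h.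
have /andP[_ h1] := Hrho (node T k) sg w z kX sg2 fs wr1 zr1.
have zw : nc (z - w) <= T^-1.
  apply: le_trans rT2; have -> : z - w = (z - (node T k)%:C) - (w - (node T k)%:C) by ring.
  by apply: (le_trans (ncB _ _)); lra.
(* Q z = 0 would give 4 aw = - (z - w)^2 rho w z, but the right-hand side has modulus <= 1. *)
have n4 : nc (4 : R[i]) = 4 by have := nc_real (4 : R); rewrite rmorph_nat normr_nat.
have : nc (4 * aw) <= 1.
  rewrite h ncN Normc.normcM ncX.
  have -> : 1 = T^-1 ^+ 2 * T ^+ 2 by rewrite -exprMn mulVf ?expr1n// lt0r_neq0.
  apply: ler_pM; rewrite ?nc_ge0 ?exprn_ge0 ?nc_ge0//.
  by rewrite lerXn2r// nnegrE ?nc_ge0// invr_ge0 ltW.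
rewrite Normc.normcM n4 (norm_sign aw2); lra.
Qed.

End FiniteGap.

(** * The rows of the fundamental solution as solutions of the linear system *)

Section FundamentalSolution.
Variables (R : realType) (T : R) (q : R -> R[i]).
Hypothesis T0 : 0 < T.
Hypothesis hq : L2_potential T q.

(** On the finite interval [0, T] the function 1 + |q|^2 is integrable and dominates |Re q| and |Im
    q|, because |h| <= 1 + h^2. *)
Lemma L2_potential_integrable : cing T q.
Proof.
have [m1 m2 fin] := hq.
pose k s := 1 + (cRe (q s) ^+ 2 + cIm (q s) ^+ 2).
have ik : ing T k.
  apply: ingD; first exact: ing_cst.
  apply/integrableP; split.
    by apply/measurable_realfun.measurable_EFinP; apply: measurable_realfun.measurable_funD;
      exact: measurable_realfun.measurable_funX.
  apply: le_lt_trans fin; rewrite le_eqVlt; apply/orP; left; apply/eqP.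
  by apply: eq_integral => s _; rewrite /= -nc_sqr ger0_norm// exprn_ge0// nc_ge0.
have K (h : R -> R) : measurable_fun `[0, T] h ->
    (forall s, h s ^+ 2 <= cRe (q s) ^+ 2 + cIm (q s) ^+ 2) -> ing T h.
  move=> mh hk; apply: (le_integrable _ _ _ ik) => //.
    exact/measurable_realfun.measurable_EFinP.
  move=> s _; rewrite /= lee_fin [leRHS]ger0_norm; last first.
    by rewrite !addr_ge0// ?sqr_ge0.
  rewrite /k; have := hk s; have := sqr_ge0 (`|h s| - 1).
  rewrite sqrrB expr1n mulr1 real_normK ?num_real// => h1 h2.
  have := normr_ge0 (h s); lra.
split; apply: K => // s; first by rewrite lerDl sqr_ge0.
by rewrite lerDr sqr_ge0.
Qed.

Variables (F : R -> R[i] -> 'M[R[i]]_2).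
Hypothesis hF : fundamental_solution T q F.

Lemma lift1 : lift ord0 ord0 = 1 :> 'I_2. Proof. exact: val_inj. Qed.

Lemma fundamental_entry z s i :
  (F s z *m alpha q z s) i 0 =
    2^-1 * ('i%C * z * F s z i 0 - conjc (q s) * F s z i 1) /\
  (F s z *m alpha q z s) i 1 =
    2^-1 * (q s * F s z i 0 - 'i%C * z * F s z i 1).
Proof.
have e10 : (1 == 0 :> 'I_2) = false by [].
have -> (B : 'M[R[i]]_2) j : (F s z *m B) i j = F s z i 0 * B 0 j + F s z i 1 * B 1 j.
  by rewrite mxE !big_ord_recl big_ord0 lift1 addr0.
have -> (B : 'M[R[i]]_2) j : (F s z *m B) i j = F s z i 0 * B 0 j + F s z i 1 * B 1 j.
  by rewrite mxE !big_ord_recl big_ord0 lift1 addr0.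
rewrite !mxE !eqxx e10; move: (F s z i 0) (F s z i 1) (conjc (q s)) => x y c.
by split; ring.
Qed.

Lemma fundamental_sol (i : 'I_2) z :
  sol T q z (fun t => (F t z i 0, F t z i 1)) /\
  (F 0 z i 0, F 0 z i 1) = ((1%:M : 'M[R[i]]_2) i 0, (1%:M : 'M[R[i]]_2) i 1).
Proof.
have cqi := L2_potential_integrable.
have [c01 c02 E0] := hF z i 0; have [c11 c12 E1] := hF z i 1.
have cF0 : cc T (fun t => F t z i 0) by [].
have cF1 : cc T (fun t => F t z i 1) by [].
have TT : (0 : R) <= 0 <= T by rewrite lexx (ltW T0).
have I0 := E0 0 TT; have I1 := E1 0 TT.
rewrite -/(CI _ _) CI0 addr0 in I0; rewrite -/(CI _ _) CI0 addr0 in I1.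
have qF (u : R -> R[i]) k : cing T u -> cc T (fun t => F t z i k) ->
   cing T (fun s => u s * F s z i k).
  move=> cu cF; apply: (cing_eq (f := fun s => F s z i k * u s)).
    by move=> s _; rewrite mulrC.
  exact: cingM.
split; last by rewrite I0 I1.
split; split.
- apply: cingZ; apply: cingD; first by apply: cingZ; exact: cing_cc.
  by apply: cingN; apply: qF => //; exact: cingJ.
- move=> t tT /=; rewrite I0 E0//; congr (_ + _); apply: (CI_eq tT) => s _.
  by have [-> _] := fundamental_entry z s i.
- apply: cingZ; apply: cingD; first exact: qF.
  by apply: cingN; apply: cingZ; exact: cing_cc.
- move=> t tT /=; rewrite I1 E1//; congr (_ + _); apply: (CI_eq tT) => s _.
  by have [_ ->] := fundamental_entry z s i.
Qed.

End FundamentalSolution.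

Theorem proposition4p4 (R : realType) (T : R) (hT : 0 < T) (q : R -> R[i])
    (hq : L2_potential T q) (F : R -> R[i] -> 'M[R[i]]_2)
    (hF : fundamental_solution T q F) (lam : int -> R[i])
    (hlam : zero_enumeration T (F T) lam) :
  finite_gap (F T) <->
  finite_set [set k : int | perturbed_fourier (F T) lam k <> 0].
Proof.
have cq := L2_potential_integrable hq.
pose U z t := (F t z 0 0, F t z 0 1); pose V z t := (F t z 1 0, F t z 1 1).
have sU z : sol T q z (U z) by have [] := fundamental_sol hT hq hF 0 z.
have sV z : sol T q z (V z) by have [] := fundamental_sol hT hq hF 1 z.
have U0 z : U z 0 = (1, 0).
  by have [_] := fundamental_sol hT hq hF 0 z; rewrite /U !mxE.
have V0 z : V z 0 = (0, 1).
  by have [_] := fundamental_sol hT hq hF 1 z; rewrite /V !mxE.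
have pE k : perturbed_fourier (F T) lam k = 0 <-> mon_b (F T) (lam k) = 0.
  rewrite /perturbed_fourier; split=> [/eqP|->]; last by rewrite mulr0.
  rewrite !mulf_eq0 pnatr_eq0 /= => /orP[|/eqP//].
  by rewrite expfz_eq0 oppr_eq0 oner_eq0 andbF.
split.
  move=> /(finite_gap_vanish hT cq sU sV U0 V0 (fun=> erefl)
    (fun=> erefl) hlam)[N HN].
  by apply/finite_int_bounded; exists N => k /HN/pE bk; apply.
move=> /finite_int_bounded[N HN].
apply: (vanish_finite_gap hT cq sU sV U0 V0 _ _ _ _ hlam) => //.
by exists N => k /HN/contrapT/pE.
Qed.
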